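(* In the linear model with measurement errors and the two-step optimal subsampling scheme described in the context, suppose that: (A1) the matrix $\mathcal{H}_{W}=\frac{1}{n}\sum_{i=1}^{n}\mathbf{W}_{i}\mathbf{W}_{i}^{T}-\boldsymbol{\Sigma}_{uu}$ converges in probability to a positive definite matrix; (A2) $\frac{1}{n}\sum_{i=1}^{n}\|\mathbf{W}_{i}\|^{4}=O_{P}(1)$ and $\frac{1}{n}\sum_{i=1}^{n}(y_{i}-\mathbf{W}_{i}^{T}\hat{\boldsymbol{\beta}})^{4}=O_{P}(1)$; (A3) $\max_{i=1,\ldots,n}(n\pi_{i})^{-1}=O_{P}(1)$ for the subsampling probabilities $\pi_i=\pi_i(\tilde{\boldsymbol{\beta}}_0)$; (A4) there exists some $\delta>0$ such that $\frac{1}{n}\sum_{i=1}^{n}|y_{i}-\mathbf{W}_{i}^{T}\hat{\boldsymbol{\beta}}|^{2+\delta}\|\mathbf{W}_{i}\|^{2+\delta}=O_{P}(1)$. If $r=o(n)$, then as $r_{0}r^{-1/2}\to 0$ and $r\to\infty$, $\breve{\boldsymbol{\beta}}-\hat{\boldsymbol{\beta}}$ converges to a normal distribution in conditional probability given $\mathcal{F}_{n}$, that is, $$(V^{\tilde{\boldsymbol{\beta}}_{0}})^{-1/2}(\breve{\boldsymbol{\beta}}-\hat{\boldsymbol{\beta}})\xrightarrow{d}N_{p}(\mathbf{0},I),$$ where $V^{\tilde{\boldsymbol{\beta}}_{0}}=\mathcal{H}_{W}^{-1}V_{c}^{\tilde{\boldsymbol{\beta}}_{0}}\mathcal{H}_{W}^{-1}$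 and $$V_{c}^{\tilde{\boldsymbol{\beta}}_{0}}=\frac{1}{rn^{2}}\sum_{i=1}^{n}\frac{(y_{i}-\mathbf{W}_{i}^{T}\hat{\boldsymbol{\beta}})^{2}\mathbf{W}_{i}\mathbf{W}_{i}^{T}}{\pi_{i}(\tilde{\boldsymbol{\beta}}_{0})}-\frac{1}{r}(\boldsymbol{\Sigma}_{uu}\hat{\boldsymbol{\beta}})(\boldsymbol{\Sigma}_{uu}\hat{\boldsymbol{\beta}})^{T}.$$
   Context: Model. For $i=1,\ldots,n$, $y_{i}=\mathbf{X}_{i}^{T}\boldsymbol{\beta}+\epsilon_{i}$ and $\mathbf{W}_{i}=\mathbf{X}_{i}+\mathbf{U}_{i}$, where $\mathbf{X}_{i}$ is a $p$-dimensional covariate vector, $y_i$ is the scalar response, $\boldsymbol{\beta}\in\mathbb{R}^{p}$ is unknown, $\epsilon_{i}$ is a random error with mean zero and variance $\sigma^{2}$, and $\mathbf{U}_{i}$ is a random measurement error vector with mean zero and known covariance matrix $\boldsymbol{\Sigma}_{uu}$, independent of $\epsilon_{i}$ and $\mathbf{X}_{i}$. Only $\mathbf{W}_i$ (not $\mathbf{X}_i$) is observed. The full data are $\mathcal{F}_{n}=\{(\mathbf{W}_{i},y_{i}):i=1,\ldots,n\}$. $\|\cdot\|$ is the Euclidean norm. Full-data estimator. $\hat{\boldsymbol{\beta}}=\arg\min_{\boldsymbol{\beta}}\big\{\frac{1}{2n}\sum_{i=1}^{n}(y_{i}-\mathbf{W}_{i}^{T}\boldsymbol{\beta})^{2}-\frac12\boldsymbol{\beta}^{T}\boldsymbol{\Sigma}_{uu}\boldsymbol{\beta}\big\}=\big(\sum_{i=1}^{n}\mathbf{W}_{i}\mathbf{W}_{i}^{T}-n\boldsymbol{\Sigma}_{uu}\big)^{-1}\sum_{i=1}^{n}\mathbf{W}_{i}y_{i}$.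 Weighted subsample estimator. For data points $(\mathbf{W}_{i}^{*},y_{i}^{*})$, $i=1,\ldots,s$, drawn with replacement from the full data, with attached sampling probabilities $\pi_i^*$, the estimator is the minimizer over $\boldsymbol{\beta}$ of $$\frac{1}{2n}\sum_{i=1}^{s}\frac{1}{s\pi_{i}^{*}}(y_{i}^{*}-\mathbf{W}_{i}^{*T}\boldsymbol{\beta})^{2}-\frac12\boldsymbol{\beta}^{T}\boldsymbol{\Sigma}_{uu}\boldsymbol{\beta}.$$ Two-step optimal subsampling. Step 1: draw a subsample of size $r_0$ with replacement with uniform probabilities $1/n$, and let $\tilde{\boldsymbol{\beta}}_{0}$ be the resulting weighted subsample estimator (pilot estimate). Define the probabilities $\pi_i(\tilde{\boldsymbol{\beta}}_0)$, $i=1,\dots,n$, by replacing $\hat{\boldsymbol{\beta}}$ by $\tilde{\boldsymbol{\beta}}_0$ in either $$\pi_{i}^{mV}=\frac{|y_{i}-\mathbf{W}_{i}^{T}\hat{\boldsymbol{\beta}}|\,\|\mathcal{H}_{W}^{-1}\mathbf{W}_{i}\|}{\sum_{j=1}^{n}|y_{j}-\mathbf{W}_{j}^{T}\hat{\boldsymbol{\beta}}|\,\|\mathcal{H}_{W}^{-1}\mathbf{W}_{j}\|}\quad\text{or}\quad\pi_{i}^{mV_{c}}=\frac{|y_{i}-\mathbf{W}_{i}^{T}\hat{\boldsymbol{\beta}}|\,\|\mathbf{W}_{i}\|}{\sum_{j=1}^{n}|y_{j}-\mathbf{W}_{j}^{T}\hat{\boldsymbol{\beta}}|\,\|\mathbf{W}_{j}\|}.$$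 Step 2: draw a subsample of size $r$ with replacement with probabilities $\pi_i(\tilde{\boldsymbol{\beta}}_0)$. Combine the $r_0+r$ sampled points of the two steps (with attached probabilities $1/n$ for the first-step points and $\pi_i(\tilde{\boldsymbol{\beta}}_0)$ for the second-step points); $\breve{\boldsymbol{\beta}}$ is the weighted subsample estimator with $s=r_0+r$ based on the combined sample. Convention. Convergence to a normal distribution ''in conditional probability given $\mathcal{F}_n$'' means that the conditional distribution function given $\mathcal{F}_n$ converges in probability, at each point, to that of the limiting normal law. $N_p(\mathbf{0},I)$ is the $p$-dimensional standard normal distribution.
   Formalization: Added assumption: the smallest eigenvalue of r V_c (at the pilot estimate) is bounded away from 0 in probability; (A1)-(A4) alone allow V = 0, where V^{-1/2} does not exist, or V > 0 with a non-normal (Poisson) limit. *)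

(* Defs.v *)
(* MathComp / MathComp-Analysis. *)
From HB Require Import structures.
From mathcomp Require Import all_boot all_order all_algebra.
From mathcomp Require Import all_classical all_reals all_analysis.

Set Implicit Arguments.
Unset Strict Implicit.
Unset Printing Implicit Defensive.

Import Order.TTheory GRing.Theory Num.Theory.
Import numFieldNormedType.Exports.

Local Open Scope classical_set_scope.
Local Open Scope ring_scope.

Section linear_algebra.
Context {R : realType} {p : nat}.
Implicit Types (v b : 'cV[R]_p) (A S V : 'M[R]_p).

Definition dotv v b : R := (v^T *m b) 0 0.

(* Euclidean norm; MathComp-Analysis norms matrices by the sup norm. *)
Definition enorm v : R := Num.sqrt (dotv v v).

Definition quadform A v : R := (v^T *m A *m v) 0 0.

Definition posdefmx A : Prop :=
  A^T = A /\ forall v, v != 0 -> 0 < quadform A v.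

(* V^{-1/2}, the positive definite square root of V^{-1}
   (0 when V is not positive definite). *)
Definition invsqrtmx V : 'M[R]_p :=
  xget 0 [set S | posdefmx S /\ S *m S = invmx V].

(* The minimizer: the point where f is uniquely minimal (0 if there is none). *)
Definition argmin (f : 'cV[R]_p -> R) : 'cV[R]_p :=
  xget 0 [set b | forall b', b' != b -> f b < f b'].

End linear_algebra.

(* A data set of size n is given by the first n terms, indexed by 0, ..., n-1,
   of the sequences W and y. *)
Section estimators.
Context {R : realType} {p : nat}.
Variable Sigma : 'M[R]_p.

Definition resid (W : nat -> 'cV[R]_p) (y : nat -> R) (b : 'cV[R]_p)
  (i : nat) : R := y i - dotv (W i) b.

Definition full_loss n W y (b : 'cV[R]_p) : R :=
  (2 * n%:R)^-1 * (\sum_(i < n) resid W y b i ^+ 2) - 2^-1 * quadform Sigma b.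

Definition full_estimator n W y : 'cV[R]_p := argmin (full_loss n W y).

(* Ws, ys, pis: the s drawn points and their attached probabilities. *)
Definition subsample_loss n s (Ws : nat -> 'cV[R]_p) (ys pis : nat -> R)
    (b : 'cV[R]_p) : R :=
  (2 * n%:R)^-1 *
    (\sum_(k < s) (s%:R * pis k)^-1 * resid Ws ys b k ^+ 2)
  - 2^-1 * quadform Sigma b.

Definition subsample_estimator n s Ws ys pis : 'cV[R]_p :=
  argmin (subsample_loss n s Ws ys pis).

Definition HW n (W : nat -> 'cV[R]_p) : 'M[R]_p :=
  n%:R^-1 *: (\sum_(i < n) W i *m (W i)^T) - Sigma.

Variant criterion := mV | mVc.

Definition prob_weight (c : criterion) n W y (b : 'cV[R]_p) (i : nat) : R :=
  `|resid W y b i| *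
  match c with
  | mV => enorm (invmx (HW n W) *m W i)
  | mVc => enorm (W i)
  end.

(* pi_i^{mV} or pi_i^{mVc}, with b in place of the full-data estimator. *)
Definition subprob c n W y (b : 'cV[R]_p) (i : nat) : R :=
  prob_weight c n W y b i / \sum_(j < n) prob_weight c n W y b j.

(* I k: index of the k-th point drawn in the first step (k < r0);
   J k: index of the k-th point drawn in the second step (k < r). *)
Definition pilot n r0 W y (I : nat -> nat) : 'cV[R]_p :=
  subsample_estimator n r0 (W \o I) (y \o I) (fun=> n%:R^-1).

Definition pilot_subprob c n r0 W y I : nat -> R :=
  subprob c n W y (pilot n r0 W y I).

Definition two_step_estimator c n r0 r W y (I J : nat -> nat) : 'cV[R]_p :=
  let K k := if (k < r0)%N then I k else J (k - r0)%N in
  let pis k := if (k < r0)%N then n%:R^-1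
               else pilot_subprob c n r0 W y I (J (k - r0)%N) in
  subsample_estimator n (r0 + r)%N (W \o K) (y \o K) pis.

Definition Vc_mx c n r0 r W y I : 'M[R]_p :=
  let bhat := full_estimator n W y in
  (r%:R * n%:R ^+ 2)^-1 *:
    (\sum_(i < n) (resid W y bhat i ^+ 2 / pilot_subprob c n r0 W y I i)
       *: (W i *m (W i)^T))
  - r%:R^-1 *: ((Sigma *m bhat) *m (Sigma *m bhat)^T).

Definition V_mx c n r0 r W y I : 'M[R]_p :=
  invmx (HW n W) *m Vc_mx c n r0 r W y I *m invmx (HW n W).

Definition standardized_error c n r0 r W y I J : 'cV[R]_p :=
  invsqrtmx (V_mx c n r0 r W y I) *m
  (two_step_estimator c n r0 r W y I J - full_estimator n W y).

End estimators.

Section probability.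
Context {d : measure_display} {T : measurableType d} {R : realType}.
Variable P : probability T R.

Definition sigma_gen (I : Type) (f : I -> T -> R) : set (set T) :=
  <<s \bigcup_(i in [set: I]) preimage_set_system setT (f i) measurable >>.

Definition independent_sigma (F G : set (set T)) : Prop :=
  forall A B, F A -> G B -> P (A `&` B) = (P A * P B)%E.

(* g is a version of the conditional probability of E given F. *)
Definition is_cond_prob (F : set (set T)) (E : set T) (g : T -> R) : Prop :=
  [/\ forall B : set R, measurable B -> F (g @^-1` B),
      P.-integrable setT (EFin \o g)
    & forall A, F A -> (\int[P]_(w in A) (g w)%:E)%E = P (A `&` E)].

Definition bigO_P (Z : nat -> T -> \bar R) : Prop :=
  forall e : R, 0 < e -> exists M : R,
    \forall n \near \oo, (P [set w | M%:E < `|Z n w|] <= e%:E)%E.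

Definition cvg_in_prob (Z : nat -> T -> R) (l : R) : Prop :=
  forall e : R, 0 < e -> P [set w | e < `|Z n w - l|] @[n --> \oo] --> 0%E.

(* For matrices, convergence in probability is entrywise. *)
Definition mx_cvg_in_prob m k (Z : nat -> T -> 'M[R]_(m, k)) (L : 'M[R]_(m, k))
  : Prop := forall i j, cvg_in_prob (fun n w => Z n w i j) (L i j).

Definition random_vector p (X : T -> 'cV[R]_p) : Prop :=
  forall j, measurable_fun setT (fun w => X w j 0).

(* The smallest eigenvalue of Z n is bounded away from 0 in probability.
   For Z n = r Vc_mx this is what normalizing by V^{-1/2} needs: moment bounds
   on the data do not keep Vc_mx from being zero, or positive but so small that
   the Lindeberg condition fails for the normalized sum. *)
Definition nondegenerate_in_prob p (Z : nat -> T -> 'M[R]_p) : Prop :=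
  forall e : R, 0 < e -> exists2 c : R, 0 < c &
    \forall n \near \oo,
      (P [set w | exists v, (quadform (Z n w) v < c * enorm v ^+ 2)%R]
       <= e%:E)%E.

(* Given F, the indices K 0, ..., K (s-1) are independent draws from
   {0, ..., n-1} with the F-measurable random probabilities q.  Nothing is
   required where q is not a probability vector, which is where
   data-dependent probabilities take the form 0/0. *)
Definition draws_given (F : set (set T)) n s (q : T -> nat -> R)
    (K : T -> nat -> nat) : Prop :=
  forall A, F A ->
    (forall w, A w ->
       (forall i : 'I_n, 0 <= q w i) /\ \sum_(i < n) q w i = 1) ->
  forall k : {ffun 'I_s -> 'I_n},
    P (A `&` [set w | forall j : 'I_s, K w j = k j]) =
    (\int[P]_(w in A) (\prod_(j < s) q w (k j))%:E)%E.

Definition std_normal_cdf (x : R) : R := fine (normal_prob 0 1 `]-oo, x]).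

(* Convergence to N_p(0, I) in conditional probability given F n; the
   distribution function of N_p(0, I) at t is \prod_j Phi (t j). *)
Definition cond_cvg_std_normal p (F : nat -> set (set T))
    (Z : nat -> T -> 'cV[R]_p) : Prop :=
  forall (t : 'cV[R]_p) (g : nat -> T -> R),
    (forall n, is_cond_prob (F n)
                 [set w | forall j, Z n w j 0 <= t j 0] (g n)) ->
    cvg_in_prob g (\prod_j std_normal_cdf (t j 0)).

End probability.

Section model.
Context {d : measure_display} {T : measurableType d} {R : realType}.
Variables (P : probability T R) (p : nat).

Definition coords (X : T -> 'cV[R]_p) (j : 'I_p) : T -> R :=
  fun w => X w j 0.

Record measurement_error_model (beta : 'cV[R]_p) (sigma : R)
    (Sigma : 'M[R]_p) (X U W : nat -> T -> 'cV[R]_p) (eps y : nat -> T -> R)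
    : Prop := {
  model_X : forall i, random_vector (X i);
  model_U : forall i, random_vector (U i);
  model_eps : forall i, measurable_fun setT (eps i);
  model_y : forall i w, y i w = dotv (X i w) beta + eps i w;
  model_W : forall i w, W i w = X i w + U i w;
  eps_mean : forall i, ('E_P[eps i] = 0)%E;
  eps_var : forall i, ('V_P[eps i] = (sigma ^+ 2)%:E)%E;
  U_mean : forall i j, ('E_P[coords (U i) j] = 0)%E;
  U_cov : forall i j k,
    covariance P (coords (U i) j) (coords (U i) k) = (Sigma j k)%:E;
  U_indep : forall i,
    independent_sigma P (sigma_gen (coords (U i)))
      (sigma_gen (fun o : option 'I_p =>
                    if o is Some j then coords (X i) j else eps i))
}.

(* sigma(F_n), generated by W_i, y_i for i < n *)
Definition sigma_data (W : nat -> T -> 'cV[R]_p) (y : nat -> T -> R) n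
    : set (set T) :=
  sigma_gen (fun k : 'I_n * option 'I_p =>
    if k.2 is Some j then coords (W k.1) j else y k.1).

(* sigma(F_n) enlarged by the indices drawn in the first step *)
Definition sigma_data_pilot (W : nat -> T -> 'cV[R]_p) (y : nat -> T -> R)
    n r0 (I : T -> nat -> nat) : set (set T) :=
  sigma_gen (fun k : ('I_n * option 'I_p) + 'I_r0 =>
    match k with
    | inl k => if k.2 is Some j then coords (W k.1) j else y k.1
    | inr k => fun w => (I w k)%:R
    end).

Record two_step_sampling (Sigma : 'M[R]_p) (W : nat -> T -> 'cV[R]_p)
    (y : nat -> T -> R) (c : criterion) n r0 r (I J : T -> nat -> nat)
    : Prop := {
  measurable_I : forall k, measurable_fun setT (I ^~ k);
  measurable_J : forall k, measurable_fun setT (J ^~ k);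
  first_step : draws_given P (sigma_data W y n) n r0 (fun _ _ => n%:R^-1) I;
  second_step : draws_given P (sigma_data_pilot W y n r0 I) n r
    (fun w => pilot_subprob Sigma c n r0 (W ^~ w) (y ^~ w) (I w)) J
}.

End model.

(* Main.v *)
Require Import Defs.
From HB Require Import structures.
From mathcomp Require Import all_boot all_order all_algebra.
From mathcomp Require Import all_classical all_reals all_analysis.
From mathcomp Require Import ring lra measurable_realfun.

Set Implicit Arguments.
Unset Strict Implicit.
Unset Printing Implicit Defensive.

Import Order.TTheory GRing.Theory Num.Theory.
Import numFieldNormedType.Exports.

Local Open Scope classical_set_scope.
Local Open Scope ring_scope.

(** Given the data and the first step, the two-step estimator depends only on
    [r] independent draws from a finite population with known probabilities. So
    the theorem is a central limit theorem for fixed data, uniform over the data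
    that satisfy a list of bounds ([fixed_data_clt]), together with the fact
    that the observed data satisfy these bounds with probability close to 1.

    For fixed data, the loss is quadratic and the error of the estimator solves
    a linear equation. Its matrix is the Hessian of the combined sample, which is
    close to [HW] by Chebyshev's inequality. Its right-hand side is a mean of
    second-step scores, centred because of the first-order condition of the
    full-data estimator, up to the contribution of the first step, which is of
    order [r0 / r] and hence negligible against [1 / sqrt r]. So the
    standardized error is close to a sum of [r] independent centred vectors
    whose covariances add up to the identity ([estimator_perturb]), and the
    moment of order [2 + delta] gives Lindeberg's condition
    ([nscore_lindeberg]).

    The central limit theorem itself ([sampling_clt]) is proved by Lindeberg's
    method, with the products of [Phi ((t j - x j) / sqrt v)] as test functions.
    Such a product is an explicit solution of the heat equation in the
    variance [v], so that adding one draw of covariance [1 / r] times the identity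
    is the same, up to a Taylor remainder, as raising [v] by [1 / r]. After [r]
    steps the variance has grown by 1. As [v] tends to 0 the test
    functions approximate the indicators of orthants from both sides, which
    also absorbs the perturbation between the error and the sum of draws.

    To return to random data, the conditional probability given the data and the
    first step is computed by averaging over the draws with the rest held
    constant ([draws_cond_prob]). This requires that every quantity
    involved, minimizers and inverse square roots of matrices included,
    be a measurable function of the data; the closed form of the
    minimizer and an iteration that converges to the square root provide this.
    The result is that the probability of the error event within any event [A]
    of the data is nearly the normal probability times that of [A]
    ([cond_prob_error_event]), and applying this to the events where a conditional
    probability is too large or too small shows that it converges in probability
    ([cond_prob_deviation]). *)

(** * The standard normal distribution function *)

Section normal_cdf.
Context {R : realType}.
Implicit Types x y z v h : R.

Definition npdf x : R := normal_pdf 0 1 x.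

Lemma npdfE x : npdf x = normal_peak 1 * expR (- (x ^+ 2 / 2)).
Proof.
rewrite /npdf normal_pdfE ?oner_eq0// /normal_fun subr0 expr1n.
by rewrite mulNr.
Qed.

Lemma npdf_ge0 x : 0 <= npdf x. Proof. exact: normal_pdf_ge0. Qed.

Lemma is_derive_npdf x : is_derive x 1 npdf (- x * npdf x).
Proof.
have -> : npdf = (fun y => normal_peak 1 * expR (- (y ^+ 2 / 2))).
  by apply/funext => y; rewrite npdfE.
have d1 : is_derive x 1 (fun y : R => - (y ^+ 2 / 2)) (- x).
  by apply: is_derive_eq; rewrite /GRing.scale/=; field.
have d2 := @is_derive1_comp R _ (fun y : R => - (y ^+ 2 / 2)) _ _ _
  (is_derive_expR (- (x ^+ 2 / 2))) d1.
have := is_deriveZ (normal_peak 1) d2 => d3.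
apply: is_derive_eq; rewrite /GRing.scale/=; ring.
Qed.

Lemma is_derive_std_normal_cdf x : is_derive x 1 (@std_normal_cdf R) (npdf x).
Proof.
have [] := @continuous_FTC1 R npdf -oo%O x (x + 1).
- by rewrite ltrDl.
- by apply: integrableS (integrable_normal_pdf 0 1).
- by rewrite ltNyr.
- by apply: continuous_normal_pdf; rewrite oner_eq0.
- move=> dF dE; apply: DeriveDef; first exact: dF.
  by rewrite -derive1E; exact: dE.
Qed.

Lemma std_normal_cdf_ge0 x : 0 <= std_normal_cdf x :> R.
Proof. by rewrite fine_ge0. Qed.

Lemma std_normal_cdf_le1 x : std_normal_cdf x <= 1 :> R.
Proof.
rewrite -lee_fin fineK; first exact: (probability_le1 (normal_prob 0 1)).
exact: (fin_num_measure (normal_prob 0 1)).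
Qed.

Lemma continuous_std_normal_cdf : continuous (@std_normal_cdf R).
Proof.
by move=> x; apply/differentiable_continuous/derivable1_diffP; apply: ex_derive;
  exact: is_derive_std_normal_cdf.
Qed.

Lemma std_normal_cdf_homo : {homo (@std_normal_cdf R) : x y / x <= y}.
Proof.
move=> x y xy; apply: fine_le; rewrite ?(fin_num_measure (normal_prob 0 1))//.
by apply: (le_measure (normal_prob 0 1)); rewrite ?inE//; apply: subset_itvl.
Qed.

Local Definition id_rv : measurableTypeR R -> R := idfun.

HB.instance Definition _ :=
  @isMeasurableFun.Build _ _ _ _ id_rv (@measurable_id _ _ setT).

Lemma cvg_std_normal_cdf_pinfty : std_normal_cdf x @[x --> +oo] --> (1 : R).
Proof.
by have /fine_cvg := @cvg_cdfy1 _ _ R (normal_prob 0 1) id_rv.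
Qed.

Lemma cvg_std_normal_cdf_ninfty : std_normal_cdf x @[x --> -oo] --> (0 : R).
Proof.
by have /fine_cvg := @cvg_cdfNy0 _ _ R (normal_prob 0 1) id_rv.
Qed.

(** From the mean value theorem; applied three times, it gives the Taylor
    remainder of third order without any higher-order Taylor formula. *)
Lemma mvt_pow (f df : R -> R) (K : R) n :
  (forall y, is_derive y 1 f (df y)) -> f 0 = 0 ->
  (forall y, `|df y| <= K * `|y| ^+ n) ->
  forall y, `|f y| <= K * `|y| ^+ n.+1.
Proof.
move=> dfE f0 dfK y.
have K0 : 0 <= K.
  by have := dfK 1; rewrite normr1 expr1n mulr1; apply: le_trans.
have cf a b : {within `[a, b], continuous f}.
  by apply: derivable_within_continuous => x _; exact: ex_derive.
have key c : `|c| <= `|y| -> `|df c * y| <= K * `|y| ^+ n.+1.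
  move=> cy; rewrite normrM exprSr mulrA ler_wpM2r//.
  by apply: (le_trans (dfK c)); rewrite ler_wpM2l// lerXn2r// nnegrE.
have [y0|y0] := leP 0 y.
  have [c] := MVT_segment y0 (fun x _ => dfE x) (cf _ _).
  rewrite in_itv/= f0 !subr0 => /andP[c0 cy] ->.
  by apply: key; rewrite !ger0_norm.
have [c] := MVT_segment (ltW y0) (fun x _ => dfE x) (cf _ _).
rewrite in_itv/= f0 !sub0r => /andP[yc c0] /eqP.
rewrite eqr_oppLR mulrN opprK => /eqP ->.
by apply: key; rewrite !ler0_norm ?lerN2// ltW.
Qed.

(** Squares the inequality [1 + u <= expR u], so that the Gaussian density beats
    every polynomial of degree at most 4, which is all that the derivatives below
    need. *)
Lemma expR_half_sqr_ge x : (1 + x ^+ 2 / 4) ^+ 2 <= expR (x ^+ 2 / 2).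
Proof.
have -> : x ^+ 2 / 2 = x ^+ 2 / 4 + x ^+ 2 / 4 by field.
rewrite expRD -expr2 lerXn2r ?nnegrE ?expR_ge0//; last exact: expR_ge1Dx.
by rewrite addr_ge0// divr_ge0// sqr_ge0.
Qed.

Definition npdf_bound : R := 16 * normal_peak 1.

Lemma npdf_bound_ge0 : 0 <= npdf_bound.
Proof. by rewrite mulr_ge0// normal_peak_ge0. Qed.

Lemma npdf_poly_bound (q : R) x :
  `|q| <= 16 * (1 + x ^+ 2 / 4) ^+ 2 -> `|q * npdf x| <= npdf_bound.
Proof.
move=> qx; rewrite normrM (ger0_norm (npdf_ge0 x)) npdfE /npdf_bound.
rewrite mulrCA [16 * _]mulrC ler_wpM2l ?normal_peak_ge0// expRN.
rewrite -ler_pdivlMr ?invr_gt0 ?expR_gt0// invrK.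
apply: (le_trans qx); rewrite ler_wpM2l//; exact: expR_half_sqr_ge.
Qed.

End normal_cdf.

(** * Gaussian distribution functions and the heat equation *)

Section heat.
Context {R : realType}.
Implicit Types x y z v h : R.

Lemma is_derive_shift (f : R -> R) x y df :
  is_derive (x + y) 1 f df -> is_derive y 1 (fun y => f (x + y)) df.
Proof.
move=> fd; rewrite -[df]mulr1.
have d1 : is_derive y 1 (fun y : R => x + y) (0 + 1) by apply: is_deriveD.
rewrite add0r in d1.
exact: (@is_derive1_comp R f (fun y : R => x + y) y _ _ fd d1).
Qed.

Definition dnpdf x : R := - x * npdf x.
Definition ddnpdf x : R := (x ^+ 2 - 1) * npdf x.

Lemma is_derive_dnpdf x : is_derive x 1 dnpdf (ddnpdf x).
Proof.
have d1 : is_derive x 1 npdf (- x * npdf x) := is_derive_npdf x.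
have d2 : is_derive x 1 (fun y : R => - y) (- 1) by apply: is_derive_eq.
have d3 := is_deriveM d2 d1.
apply: is_derive_eq; rewrite /GRing.scale/= /ddnpdf; ring.
Qed.

Lemma dnpdf_bound x : `|dnpdf x| <= npdf_bound.
Proof.
apply: npdf_poly_bound; rewrite normrN.
have := sqr_ge0 x; have := sqr_ge0 (`|x| - 1).
rewrite -[x ^+ 2]real_normK ?num_real//; have := normr_ge0 x.
by set a := `|x|; nra.
Qed.

Lemma ddnpdf_bound x : `|ddnpdf x| <= npdf_bound.
Proof.
apply: npdf_poly_bound; rewrite ler_norml; have := sqr_ge0 x.
by set a := x ^+ 2; move=> a0; apply/andP; split; nra.
Qed.

Lemma x_ddnpdf_bound x : `|x * ddnpdf x| <= npdf_bound.
Proof.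
rewrite /ddnpdf mulrA; apply: npdf_poly_bound.
rewrite normrM.
have : `|x ^+ 2 - 1| <= 1 + x ^+ 2.
  rewrite ler_norml; have := sqr_ge0 x; set a := x ^+ 2 => a0.
  by apply/andP; split; lra.
have := sqr_ge0 (`|x| - 1); have := sqr_ge0 x.
rewrite -[x ^+ 2]real_normK ?num_real//; have := normr_ge0 x.
set a := `|x|; set b := `|a ^+ 2 - 1| => a0 a2 a1 ab.
apply: (@le_trans _ _ (a * (1 + a ^+ 2))); first by rewrite ler_wpM2l.
have : 2 * a <= 1 + a ^+ 2 by nra.
move=> a12.
apply: (@le_trans _ _ ((1 + a ^+ 2) ^+ 2 / 2)).
  by rewrite [leRHS](_ : _ = (1 + a ^+ 2) / 2 * (1 + a ^+ 2)); [nra|field].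
have : 0 <= a ^+ 2 by [].
by set t := a ^+ 2; nra.
Qed.

(** Each derivative of the remainder is again a remainder, of one order less, and
    the last one is bounded by the bound on the third derivative. *)
Lemma std_normal_cdf_taylor x y :
  `|std_normal_cdf (x + y) - std_normal_cdf x - npdf x * y
    - dnpdf x / 2 * y ^+ 2| <= npdf_bound * `|y| ^+ 3.
Proof.
pose f2 y := dnpdf (x + y) - dnpdf x.
pose f1 y := npdf (x + y) - npdf x - dnpdf x * y.
pose f0 y := std_normal_cdf (x + y) - std_normal_cdf x - npdf x * y
    - dnpdf x / 2 * y ^+ 2.
have b2 z : `|f2 z| <= npdf_bound * `|z| ^+ 1.
  apply: (@mvt_pow _ f2 (fun z => ddnpdf (x + z))).
  - move=> t; have d1 := is_derive_shift (is_derive_dnpdf (x + t)).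
    by apply: is_derive_eq; rewrite subr0.
  - by rewrite /f2 addr0 subrr.
  - by move=> t; rewrite expr0 mulr1 ddnpdf_bound.
have b1 z : `|f1 z| <= npdf_bound * `|z| ^+ 2.
  apply: (@mvt_pow _ f1 f2) => //.
  - move=> t; have d1 := is_derive_shift (is_derive_npdf (x + t)).
    by apply: is_derive_eq; rewrite /f2 /dnpdf /GRing.scale/=; ring.
  - by rewrite /f1 addr0; ring.
apply: (@mvt_pow _ f0 f1) => //.
- move=> t; have d1 := is_derive_shift (is_derive_std_normal_cdf (x + t)).
  by apply: is_derive_eq; rewrite /f1 /GRing.scale/=; field.
- by rewrite /f0 addr0; ring.
Qed.

(** The standard deviation enters through its reciprocal, written as a power so
    that the derivative in the variance is available. *)
Definition rsd v : R := v `^ (- 2^-1).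

Lemma rsd_gt0 v : 0 < v -> 0 < rsd v.
Proof. exact: powR_gt0. Qed.

Lemma rsd_sqr v : 0 < v -> rsd v ^+ 2 = v^-1.
Proof.
move=> v0; rewrite -powR_mulrn ?powR_ge0// -powRrM.
by rewrite -[v^-1]powR_inv1 ?ltW//; congr (_ `^ _); field.
Qed.

Lemma is_derive_rsd v : 0 < v -> is_derive v 1 rsd (- (rsd v / (2 * v))).
Proof.
move=> v0; have := is_derive1_powR (- 2^-1) v0.
rewrite powRB ?(gt_eqF v0)//; last by rewrite implybT.
rewrite powRr1 ?ltW// => d1; apply: is_derive_eq.
by rewrite /rsd; field; rewrite gt_eqF.
Qed.

(** The distribution function at [z] of a centred normal law of variance [v]. As a
    function of [v] and [z] it solves the heat equation, which the proof uses in
    place of a convolution with a Gaussian density: [is_derive_heat] says that the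
    derivative in [v] is half the second derivative in [z]. *)
Definition heat v z : R := std_normal_cdf (z * rsd v).
Definition heat_z v z : R := npdf (z * rsd v) * rsd v.
Definition heat_zz v z : R := dnpdf (z * rsd v) * rsd v ^+ 2.

Lemma is_derive_z_rsd v z : 0 < v ->
  is_derive v 1 (fun v => z * rsd v) (- (z * rsd v) / (2 * v)).
Proof.
move=> v0; have d1 := is_deriveZ z (is_derive_rsd v0).
by apply: is_derive_eq; rewrite /GRing.scale/=; field; rewrite gt_eqF.
Qed.

Lemma is_derive_heat v z : 0 < v ->
  is_derive v 1 (heat ^~ z) (heat_zz v z / 2).
Proof.
move=> v0; have dx := is_derive_z_rsd z v0.
have d3 := @is_derive1_comp R _ (fun v => z * rsd v) _ _ _
  (is_derive_std_normal_cdf _) dx.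
apply: is_derive_eq; rewrite /heat_zz /dnpdf rsd_sqr//.
by field; rewrite gt_eqF.
Qed.

Lemma is_derive_heat_zz v z : 0 < v ->
  is_derive v 1 (heat_zz ^~ z)
    (- (dnpdf (z * rsd v) + (z * rsd v) * ddnpdf (z * rsd v) / 2) / v ^+ 2).
Proof.
move=> v0; have dx := is_derive_z_rsd z v0.
have d1 := is_derive_rsd v0.
have d2 := @is_derive1_comp R _ (fun v => z * rsd v) _ _ _
  (is_derive_dnpdf _) dx.
have d3 := is_deriveM d2 (is_deriveX 2 d1).
apply: is_derive_eq; rewrite /GRing.scale/= expr1.
rewrite (_ : (rsd ^+ 2) v = v^-1) ?rsd_sqr//; last by rewrite -rsd_sqr.
rewrite [X in dnpdf _ * X](_ : _ = - (rsd v ^+ 2 / v)); last first.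
  by field; rewrite gt_eqF.
by rewrite rsd_sqr//; field; rewrite gt_eqF.
Qed.

(** Space and time Taylor expansions of the heat solution, with constants that
    are uniform as long as the variance stays away from 0. *)
Lemma heat_taylor (d : R) : 0 < d -> exists2 C : R, 0 <= C &
  [/\ forall v z, d <= v -> 0 <= heat v z <= 1,
      forall v z, d <= v -> `|heat_z v z| <= C,
      forall v z, d <= v -> `|heat_zz v z| <= C,
      forall v z h, d <= v ->
        `|heat v (z - h) - (heat v z - heat_z v z * h + heat_zz v z / 2 * h ^+ 2)|
          <= C * `|h| ^+ 3 &
      forall v z h, d <= v -> 0 <= h ->
        `|heat (v + h) z - (heat v z + heat_zz v z / 2 * h)| <= C * h ^+ 2].
Proof.
move=> d0; set B := @npdf_bound R; have B0 : 0 <= B := npdf_bound_ge0.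
pose k := rsd d; have k0 : 0 < k := rsd_gt0 d0.
have kv v : d <= v -> 0 < rsd v <= k.
  move=> dv; have v0 : 0 < v := lt_le_trans d0 dv.
  rewrite rsd_gt0//= -(@ler_pXn2r _ 2) ?nnegrE ?(ltW k0) ?(ltW (rsd_gt0 v0))//.
  by rewrite /k (rsd_sqr v0) (rsd_sqr d0) lef_pV2 ?posrE.
have kX v n : d <= v -> rsd v ^+ n <= k ^+ n.
  move=> dv; have /andP[s0 sk] := kv _ dv.
  by rewrite lerXn2r// nnegrE ltW.
have nb x : npdf x <= B.
  rewrite -[npdf x]mul1r -[leLHS]ger0_norm ?mul1r ?npdf_ge0// -[npdf x]mul1r.
  apply: npdf_poly_bound; rewrite normr1; have := sqr_ge0 x.
  by set t := x ^+ 2; nra.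
pose C := B * (k + k ^+ 2 + k ^+ 3 + 2 * k ^+ 4).
have kn n : 0 <= k ^+ n by rewrite exprn_ge0// ltW.
have le1 : B * k <= C.
  by rewrite ler_wpM2l//; have := kn 2; have := kn 3; have := kn 4; lra.
have le2 : B * k ^+ 2 <= C.
  by rewrite ler_wpM2l//; have := kn 1; have := kn 3; have := kn 4; rewrite expr1; lra.
have le3 : B * k ^+ 3 <= C.
  by rewrite ler_wpM2l//; have := kn 1; have := kn 2; have := kn 4; rewrite expr1; lra.
have le4 : 2 * B * k ^+ 4 <= C.
  rewrite mulrAC mulrC ler_wpM2l//.
  by have := kn 1; have := kn 2; have := kn 3; rewrite expr1; lra.
have bzz v z : d <= v -> `|heat_zz v z| <= B * k ^+ 2.
  move=> dv; have /andP[s0 sk] := kv _ dv.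
  rewrite normrM ler_pM ?dnpdf_bound// ger0_norm ?exprn_ge0 ?(ltW s0)//.
  exact: kX.
have tzz v z h : d <= v -> 0 <= h ->
    `|heat_zz (v + h) z - heat_zz v z| <= 2 * B * k ^+ 4 * h.
  move=> dv h0.
  have dd u : u \in `]v, v + h[ -> is_derive u 1 (heat_zz ^~ z)
     (- (dnpdf (z * rsd u) + (z * rsd u) * ddnpdf (z * rsd u) / 2) / u ^+ 2).
    rewrite in_itv/= => /andP[vu _]; apply: is_derive_heat_zz.
    exact: lt_trans (lt_le_trans d0 dv) vu.
  have cc : {within `[v, v + h], continuous (heat_zz ^~ z)}.
    apply: derivable_within_continuous => u; rewrite in_itv/= => /andP[vu _].
    apply: ex_derive; apply: is_derive_heat_zz.
    exact: lt_le_trans (lt_le_trans d0 dv) vu.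
  have vh : v <= v + h by rewrite lerDl.
  have [u] := MVT_segment vh dd cc.
  rewrite in_itv/= [v + h - v](_ : _ = h); last by ring.
  move=> /andP[vu _] ->.
  rewrite normrM (ger0_norm h0) ler_wpM2r// normrM normrN.
  have du : d <= u := le_trans dv vu.
  have u0 : 0 < u := lt_le_trans d0 du.
  apply: ler_pM => //.
    apply: (le_trans (ler_normD _ _)).
    rewrite [X in _ + X]normrM (ger0_norm (_ : 0 <= 2^-1))//.
    by have := dnpdf_bound (z * rsd u); have := x_ddnpdf_bound (z * rsd u);
      rewrite -/B; lra.
  rewrite -exprVn -rsd_sqr// -exprM ger0_norm ?exprn_ge0 ?(ltW (rsd_gt0 u0))//.
  have /andP[s0 sk] := kv _ du.
  exact: kX.
exists C.
  by apply: le_trans le1; rewrite mulr_ge0// ltW.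
split.
- by move=> v z _; rewrite std_normal_cdf_ge0 std_normal_cdf_le1.
- move=> v z dv; have /andP[s0 sk] := kv _ dv.
  apply: le_trans le1; rewrite normrM ler_pM//; last by rewrite ger0_norm// ltW.
  by rewrite ger0_norm ?npdf_ge0.
- by move=> v z dv; apply: le_trans le2; exact: bzz.
- move=> v z h dv; have /andP[s0 sk] := kv _ dv.
  have := std_normal_cdf_taylor (z * rsd v) (- (h * rsd v)).
  rewrite /heat mulrBl => T; apply: le_trans (le_trans T _).
    rewrite le_eqVlt; apply/orP; left; apply/eqP; congr (`|_|).
    by rewrite /heat_z /heat_zz; field.
  rewrite normrN normrM exprMn mulrCA mulrC ler_wpM2r ?exprn_ge0//.
  apply: le_trans le3; rewrite ler_wpM2l//.
  by rewrite (ger0_norm (ltW s0)) kX.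
- move=> v z h dv h0.
  have dd u : u \in `]v, v + h[ -> is_derive u 1 (heat ^~ z) (heat_zz u z / 2).
    rewrite in_itv/= => /andP[vu _]; apply: is_derive_heat.
    exact: lt_trans (lt_le_trans d0 dv) vu.
  have cc : {within `[v, v + h], continuous (heat ^~ z)}.
    apply: derivable_within_continuous => u; rewrite in_itv/= => /andP[vu _].
    apply: ex_derive; apply: is_derive_heat.
    exact: lt_le_trans (lt_le_trans d0 dv) vu.
  have vh : v <= v + h by rewrite lerDl.
  have [u] := MVT_segment vh dd cc.
  rewrite in_itv/= [v + h - v](_ : _ = h); last by ring.
  move=> /andP[vu uvh] E.
  rewrite opprD addrA E -mulrBl -mulrBl !normrM (ger0_norm h0).
  rewrite (ger0_norm (_ : 0 <= 2^-1))// expr2 mulrA ler_wpM2r//.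
  have uv0 : 0 <= u - v by rewrite subr_ge0.
  have := tzz v z (u - v) dv uv0.
  rewrite [v + (u - v)](_ : _ = u); last by ring.
  have uvh' : u - v <= h by rewrite lerBlDl.
  have B4 : 0 <= 2 * B * k ^+ 4 by rewrite mulr_ge0 ?kn// mulr_ge0.
  move=> T; apply: le_trans (ler_pM B4 uv0 le4 uvh').
  by apply: le_trans T; rewrite ler_piMr// invf_le1// ler1n.
Qed.

End heat.

(** * Expectations over independent draws from a finite population *)

Section finite_sampling.
Context {R : realType} {n : nat}.
Variable q : 'I_n -> R.

Definition Esamp r (f : {ffun 'I_r -> 'I_n} -> R) : R :=
  \sum_(k : {ffun 'I_r -> 'I_n}) (\prod_j q (k j)) * f k.

Definition Psamp r (B : pred {ffun 'I_r -> 'I_n}) : R :=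
  Esamp (fun k => (B k)%:R).

Definition fcons r (i : 'I_n) (k : {ffun 'I_r -> 'I_n}) :
    {ffun 'I_r.+1 -> 'I_n} := [ffun j => oapp k i (unlift ord0 j)].

Lemma fcons0 r i (k : {ffun 'I_r -> 'I_n}) : fcons i k ord0 = i.
Proof. by rewrite ffunE unlift_none. Qed.

Lemma fconsS r i (k : {ffun 'I_r -> 'I_n}) j :
  fcons i k (lift ord0 j) = k j.
Proof. by rewrite ffunE liftK. Qed.

Lemma Esamp_rec r (f : {ffun 'I_r.+1 -> 'I_n} -> R) :
  Esamp f = \sum_i q i * Esamp (fun k => f (fcons i k)).
Proof.
rewrite /Esamp.
have bij : bijective (fun u : 'I_n * {ffun 'I_r -> 'I_n} => fcons u.1 u.2).
  pose h (k : {ffun 'I_r.+1 -> 'I_n}) : 'I_n * {ffun 'I_r -> 'I_n} :=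
    (k ord0, [ffun j => k (lift ord0 j)]).
  exists h.
    move=> [i k]; rewrite /h/= fcons0; congr pair.
    by apply/ffunP => j; rewrite ffunE fconsS.
  move=> k; apply/ffunP => j; rewrite ffunE/=.
  by case: unliftP => [j' ->|->]//=; rewrite ffunE.
rewrite (reindex _ (onW_bij _ bij))/=.
under [RHS]eq_bigr do rewrite big_distrr/=.
rewrite [RHS]pair_big/=; apply: eq_bigr => -[i k] _ /=.
rewrite big_ord_recl fcons0 mulrA; congr (_ * _ * _).
by apply: eq_bigr => j _; rewrite fconsS.
Qed.

Lemma eq_Esamp r (f g : {ffun 'I_r -> 'I_n} -> R) : f =1 g -> Esamp f = Esamp g.
Proof. by move=> fg; apply: eq_bigr => k _; rewrite fg. Qed.

Lemma EsampD r (f g : {ffun 'I_r -> 'I_n} -> R) :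
  Esamp (fun k => f k + g k) = Esamp f + Esamp g.
Proof. by rewrite /Esamp -big_split; apply: eq_bigr => k _; rewrite mulrDr. Qed.

Lemma EsampZ r a (f : {ffun 'I_r -> 'I_n} -> R) :
  Esamp (fun k => a * f k) = a * Esamp f.
Proof. by rewrite /Esamp big_distrr; apply: eq_bigr => k _; rewrite mulrCA. Qed.

Lemma Esamp_big r (I : Type) (s : seq I) (f : I -> {ffun 'I_r -> 'I_n} -> R) :
  Esamp (fun k => \sum_(i <- s) f i k) = \sum_(i <- s) Esamp (f i).
Proof.
rewrite /Esamp exchange_big; apply: eq_bigr => k _.
by rewrite big_distrr.
Qed.

(** Averaging over one draw at a time turns the expectation of a function of a sum
    into an iterated operator, so that two such expectations can be compared one
    step at a time. *)
Lemma Esamp_sum (V : zmodType) (z : 'I_n -> V) (F : V -> R) r x :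
  Esamp (fun k : {ffun 'I_r -> 'I_n} => F (x + \sum_j z (k j))) =
  iter r (fun G x => \sum_i q i * G (x + z i)) F x.
Proof.
elim: r x => [|r IH] x.
  pose k0 : {ffun 'I_0 -> 'I_n} := ffun0 (card_ord 0).
  rewrite /Esamp/= (big_pred1 k0).
    by rewrite !big_ord0 mul1r addr0.
  by move=> k; symmetry; apply/eqP/ffunP => -[].
rewrite Esamp_rec iterS; apply: eq_bigr => i _; congr (_ * _).
rewrite -IH; apply: eq_Esamp => k.
rewrite big_ord_recl fcons0 addrA; congr (F (_ + _)).
by apply: eq_bigr => j _; rewrite fconsS.
Qed.

Hypothesis q_ge0 : forall i, 0 <= q i.
Hypothesis q_sum1 : \sum_i q i = 1.

Lemma Esamp_cst r a : Esamp (fun _ : {ffun 'I_r -> 'I_n} => a) = a.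
Proof.
elim: r => [|r IH].
  have := Esamp_sum (fun=> 0 : R) (fun=> a) 0 0.
  exact.
by rewrite Esamp_rec; under eq_bigr do rewrite IH;
  rewrite -big_distrl/= q_sum1 mul1r.
Qed.

Lemma le_Esamp r (f g : {ffun 'I_r -> 'I_n} -> R) :
  (forall k, f k <= g k) -> Esamp f <= Esamp g.
Proof.
by move=> fg; apply: ler_sum => k _; rewrite ler_wpM2l// prodr_ge0.
Qed.

Lemma Esamp_ge0 r (f : {ffun 'I_r -> 'I_n} -> R) :
  (forall k, 0 <= f k) -> 0 <= Esamp f.
Proof. by move=> f0; apply: sumr_ge0 => k _; rewrite mulr_ge0// prodr_ge0. Qed.

Lemma Psamp_ge0 r (B : pred {ffun 'I_r -> 'I_n}) : 0 <= Psamp B.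
Proof. exact: Esamp_ge0. Qed.

Lemma Psamp_markov r (f : {ffun 'I_r -> 'I_n} -> R) a : 0 < a ->
  (forall k, 0 <= f k) -> Psamp (fun k => a <= f k) <= Esamp f / a.
Proof.
move=> a0 f0; rewrite mulrC -EsampZ; apply: le_Esamp => k.
have [afk|_] := boolP (a <= f k); last by rewrite mulr_ge0// invr_ge0 ltW.
by rewrite mulrC ler_pdivlMr// mul1r.
Qed.

Lemma Esamp_sqr_sum r (z : 'I_n -> R) : \sum_i q i * z i = 0 ->
  Esamp (fun k : {ffun 'I_r -> 'I_n} => (\sum_j z (k j)) ^+ 2) =
  r%:R * \sum_i q i * z i ^+ 2.
Proof.
move=> z0; set v := \sum_i _.
under eq_Esamp => k do rewrite -[\sum_(j < r) _]add0r.
rewrite (Esamp_sum z (fun x => x ^+ 2)).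
suff -> x : iter r (fun G x => \sum_i q i * G (x + z i)) (fun x => x ^+ 2) x =
    x ^+ 2 + r%:R * v by rewrite expr0n add0r.
elim: r x => [|r IH] x; first by rewrite mul0r addr0.
rewrite iterS; under eq_bigr do rewrite IH.
have -> : \sum_i q i * ((x + z i) ^+ 2 + r%:R * v) =
    \sum_i (q i * (x ^+ 2 + r%:R * v) + (q i * z i) * (2 * x) + q i * z i ^+ 2).
  by apply: eq_bigr => i _; ring.
rewrite 2!big_split/= -!big_distrl/= q_sum1 z0 -/v -natr1; ring.
Qed.

Lemma Esamp_sum_draws r (z : 'I_n -> R) :
  Esamp (fun k : {ffun 'I_r -> 'I_n} => \sum_j z (k j)) =
  r%:R * \sum_i q i * z i.
Proof.
under eq_Esamp => k do rewrite -[\sum_(j < r) _]add0r.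
rewrite (Esamp_sum z id).
suff -> x : iter r (fun G x => \sum_i q i * G (x + z i)) id x =
    x + r%:R * \sum_i q i * z i by rewrite add0r.
elim: r x => [|r IH] x; first by rewrite mul0r addr0.
rewrite iterS; under eq_bigr do rewrite IH.
have -> : \sum_i q i * (x + z i + r%:R * \sum_j q j * z j) =
    \sum_i (q i * (x + r%:R * \sum_j q j * z j) + q i * z i).
  by apply: eq_bigr => i _; ring.
rewrite big_split/= -big_distrl/= q_sum1 -natr1; ring.
Qed.

End finite_sampling.

(** * Entries and Euclidean norm *)

Section enorm_entries.
Context {R : realType} {p : nat}.
Implicit Types v w : 'cV[R]_p.

Lemma dotvE v w : dotv v w = \sum_j v j 0 * w j 0.
Proof. by rewrite /dotv mxE; apply: eq_bigr => j _; rewrite mxE. Qed.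

Lemma dotvv_ge0 v : 0 <= dotv v v.
Proof. by rewrite dotvE; apply: sumr_ge0 => j _; rewrite -expr2 sqr_ge0. Qed.

Lemma enorm_ge0 v : 0 <= enorm v. Proof. exact: sqrtr_ge0. Qed.

Lemma sqr_enorm v : enorm v ^+ 2 = dotv v v.
Proof. by rewrite sqr_sqrtr// dotvv_ge0. Qed.

Lemma entry_le_enorm v j : `|v j 0| <= enorm v.
Proof.
rewrite -(@ler_pXn2r _ 2) ?nnegrE ?enorm_ge0// sqr_enorm real_normK ?num_real//.
rewrite dotvE (bigD1 j)//= -expr2 lerDl.
by apply: sumr_ge0 => i _; rewrite -expr2 sqr_ge0.
Qed.

End enorm_entries.

(** * Second-order expansion of a product *)

Section jets.
Context {R : realType} {I : eqType}.
Variables (a b c : I -> R).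
Implicit Types (s : seq I) (z : I -> R).

(** Terms of order 0, 1 and 2 in [z] of the product over [s] of the
    [a j - b j * z j + c j / 2 * z j ^+ 2]. *)
Fixpoint jetA s : R := if s is j :: s' then a j * jetA s' else 1.
Fixpoint jetL s z : R :=
  if s is j :: s' then a j * jetL s' z - b j * z j * jetA s' else 0.
Fixpoint jetQ s z : R :=
  if s is j :: s' then
    a j * jetQ s' z - b j * z j * jetL s' z + c j / 2 * z j ^+ 2 * jetA s'
  else 0.

(** The trace of the second-order term: twice the heat operator applied to the
    product. *)
Fixpoint jetD s : R :=
  if s is j :: s' then a j * jetD s' + c j * jetA s' else 0.

(** Under an averaging for which the [z j] are centred, uncorrelated and of
    variance [h], the second-order term averages to [h / 2 * jetD s]. *)
Lemma jet_average n (q : 'I_n -> R) (z : 'I_n -> I -> R) (h : R) s : uniq s ->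
  (forall j, j \in s -> \sum_i q i * z i j = 0) ->
  (forall j k, j \in s -> k \in s ->
     \sum_i q i * (z i j * z i k) = (j == k)%:R * h) ->
  [/\ \sum_i q i * jetL s (z i) = 0,
      forall k, k \notin s ->
        (forall j, j \in s -> \sum_i q i * (z i k * z i j) = 0) ->
        \sum_i q i * (z i k * jetL s (z i)) = 0 &
      \sum_i q i * jetQ s (z i) = h / 2 * jetD s].
Proof.
elim: s => [|j s IH]/=.
  by move=> _ _ _; split=> [|k _ _|]; rewrite ?mulr0 ?big1// => i _; rewrite !mulr0.
move=> /andP[js us] m1 m2.
have [||L0 LX Q0] := IH us.
- by move=> k ks; apply: m1; rewrite inE ks orbT.
- by move=> k l ks ls; apply: m2; rewrite inE ?ks ?ls orbT.
have Lj : \sum_i q i * (z i j * jetL s (z i)) = 0.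
  apply: LX => // k ks; rewrite m2 ?inE ?eqxx ?ks ?orbT//.
  have [jk|_] := eqVneq j k; last by rewrite mul0r.
  by rewrite jk ks in js.
split.
- rewrite [LHS](_ : _ = a j * (\sum_i q i * jetL s (z i)) -
      b j * jetA s * (\sum_i q i * z i j)).
    by rewrite L0 m1 ?inE ?eqxx// !mulr0 subrr.
  by rewrite !big_distrr -sumrB/=; apply: eq_bigr => i _; ring.
- move=> k; rewrite inE negb_or => /andP[kj ks] kz.
  rewrite [LHS](_ : _ = a j * (\sum_i q i * (z i k * jetL s (z i))) -
      b j * jetA s * (\sum_i q i * (z i k * z i j))).
    rewrite LX ?kz ?inE ?eqxx// ?mulr0 ?subrr// => l ls.
    by rewrite kz// inE ls orbT.
  by rewrite !big_distrr -sumrB/=; apply: eq_bigr => i _; ring.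
- rewrite [LHS](_ : _ = a j * (\sum_i q i * jetQ s (z i)) -
      b j * (\sum_i q i * (z i j * jetL s (z i))) +
      c j / 2 * jetA s * (\sum_i q i * (z i j * z i j))).
    by rewrite Q0 Lj m2 ?inE ?eqxx// mul1r; ring.
  by rewrite !big_distrr -sumrB -big_split/=; apply: eq_bigr => i _; ring.
Qed.

End jets.

Section jet_bound.
Context {R : realType} {I : eqType}.

Lemma jet_bound (C : R) (s : seq I) : 0 <= C -> exists2 K : R, 0 <= K &
  forall a b c : I -> R,
    (forall j, 0 <= a j <= 1) -> (forall j, `|b j| <= C) ->
    (forall j, `|c j| <= C) ->
  [/\ `|jetA a s| <= 1,
      forall rho z, (forall j, `|z j| <= rho) -> `|jetL a b s z| <= K * rho,
      forall rho z, (forall j, `|z j| <= rho) ->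
        `|jetQ a b c s z| <= K * rho ^+ 2 &
      forall rho z F, 0 <= rho <= 1 -> (forall j, `|z j| <= rho) ->
        (forall j, `|F j - (a j - b j * z j + c j / 2 * z j ^+ 2)| <= C * rho ^+ 3) ->
        `|\prod_(j <- s) F j - (jetA a s + jetL a b s z + jetQ a b c s z)|
          <= K * rho ^+ 3].
Proof.
move=> C0; elim: s => [|j s [K K0 IH]].
  exists 0 => // a b c _ _ _; split; rewrite /= ?normr1//.
  - by move=> *; rewrite normr0 mul0r.
  - by move=> *; rewrite normr0 mul0r.
  - by move=> *; rewrite big_nil !addr0 subrr normr0 mul0r.
exists (3 * C * K + (1 + 2 * C) * K + C * (1 + 3 * K) + K + C).
  by rewrite !addr_ge0 ?mulr_ge0 ?addr_ge0 ?mulr_ge0.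
move=> a b c a01 bC cC; have [A1 LK QK FK] := IH a b c a01 bC cC.
have /andP[a0 a1] := a01 j.
have aj : `|a j| <= 1 by rewrite ger0_norm.
have lb rho z : (forall j, `|z j| <= rho) -> `|b j * z j| <= C * rho.
  by move=> zr; rewrite normrM ler_pM.
have qb rho z : (forall j, `|z j| <= rho) -> `|c j / 2 * z j ^+ 2| <= C * rho ^+ 2.
  move=> zr; rewrite normrM ler_pM//.
    rewrite normrM [`|2^-1|]ger0_norm//.
    by apply: le_trans (cC j); rewrite ler_piMr// invf_le1// ler1n.
  by rewrite normrX lerXn2r// nnegrE// (le_trans _ (zr j)).
split=> /=.
- by rewrite normrM -[leRHS]mulr1 ler_pM.
- move=> rho z zr; have r0 : 0 <= rho by apply: le_trans (zr j).
  apply: le_trans (ler_normB _ _) _; rewrite !normrM.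
  have h1 : `|a j| * `|jetL a b s z| <= 1 * (K * rho) by rewrite ler_pM// LK.
  have h2 : `|b j| * `|z j| * `|jetA a s| <= C * rho * 1.
    by rewrite -normrM ler_pM// lb.
  have h3 : 0 <= C * K * rho by rewrite !mulr_ge0.
  have h4 : 0 <= K * rho by rewrite mulr_ge0.
  have h5 : 0 <= C * rho by rewrite mulr_ge0.
  by nra.
- move=> rho z zr; have r0 : 0 <= rho by apply: le_trans (zr j).
  apply: le_trans (ler_normD _ _) _.
  apply: le_trans (lerD (ler_normB _ _) (lexx _)) _.
  have h1 : `|a j * jetQ a b c s z| <= 1 * (K * rho ^+ 2).
    by rewrite normrM ler_pM// QK.
  have h2 : `|b j * z j * jetL a b s z| <= C * rho * (K * rho).
    by rewrite normrM ler_pM// ?lb ?LK.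
  have h3 : `|c j / 2 * z j ^+ 2 * jetA a s| <= C * rho ^+ 2 * 1.
    by rewrite normrM ler_pM// qb.
  have h4 : 0 <= C * K * rho ^+ 2 by rewrite !mulr_ge0// exprn_ge0.
  have h5 : 0 <= K * rho ^+ 2 by rewrite mulr_ge0// exprn_ge0.
  have h6 : 0 <= C * rho ^+ 2 by rewrite mulr_ge0// exprn_ge0.
  apply: (le_trans (lerD (lerD h1 h2) h3)); rewrite [C * rho * _](_ : _ = C * K * rho ^+ 2); last by ring.
  by nra.
- move=> rho z F /andP[r0 r1] zr Fr; rewrite big_cons.
  have Gr := FK rho z F (introT andP (conj r0 r1)) zr Fr.
  set G := \prod_(j <- s) F j in Gr *.
  set A := jetA a s in A1 Gr *; set L := jetL a b s z in Gr *.
  set Q := jetQ a b c s z in Gr *.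
  have L1 : `|L| <= K * rho := LK _ _ zr.
  have Q1 : `|Q| <= K * rho ^+ 2 := QK _ _ zr.
  have l1 := lb _ _ zr; have q1 := qb _ _ zr.
  have rn n : rho ^+ n <= 1 by rewrite exprn_ile1.
  have Gb : `|G| <= 1 + 3 * K.
    have -> : G = (G - (A + L + Q)) + (A + L + Q) by ring.
    apply: le_trans (ler_normD _ _) _.
    have := ler_normD (A + L) Q; have := ler_normD A L.
    have : K * rho <= K by rewrite ler_piMr.
    have : K * rho ^+ 2 <= K by rewrite ler_piMr.
    have : K * rho ^+ 3 <= K by rewrite ler_piMr.
    move: A1 L1 Q1 Gr; clear; lra.
  set f := a j - b j * z j + c j / 2 * z j ^+ 2.
  have fb : `|f| <= 1 + 2 * C.
    have := ler_normD (a j - b j * z j) (c j / 2 * z j ^+ 2).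
    have := ler_normB (a j) (b j * z j).
    have : C * rho <= C by rewrite ler_piMr.
    have : C * rho ^+ 2 <= C by rewrite ler_piMr.
    move: aj l1 q1; rewrite -/f; clear; lra.
  have Fj := Fr j; rewrite -/f in Fj.
  have -> : F j * G - (a j * A + (a j * L - b j * z j * A) +
      (a j * Q - b j * z j * L + c j / 2 * z j ^+ 2 * A)) =
    - (b j * z j * Q) + c j / 2 * z j ^+ 2 * L + c j / 2 * z j ^+ 2 * Q +
    f * (G - (A + L + Q)) + (F j - f) * G by rewrite /f; ring.
  have h1 : `|- (b j * z j * Q)| <= C * rho * (K * rho ^+ 2).
    by rewrite normrN normrM ler_pM.
  have h2 : `|c j / 2 * z j ^+ 2 * L| <= C * rho ^+ 2 * (K * rho).
    by rewrite normrM ler_pM.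
  have h3 : `|c j / 2 * z j ^+ 2 * Q| <= C * rho ^+ 2 * (K * rho).
    rewrite normrM ler_pM//; apply: (le_trans Q1).
    by rewrite ler_wpM2l// expr2 ler_piMr.
  have h4 : `|f * (G - (A + L + Q))| <= (1 + 2 * C) * (K * rho ^+ 3).
    by rewrite normrM ler_pM.
  have h5 : `|(F j - f) * G| <= C * rho ^+ 3 * (1 + 3 * K).
    by rewrite normrM ler_pM.
  apply: le_trans (ler_normD _ _) _.
  apply: le_trans (lerD (ler_normD _ _) h5) _.
  apply: le_trans (lerD (lerD (ler_normD _ _) h4) (lexx _)) _.
  apply: le_trans (lerD (lerD (lerD (ler_normD _ _) h3) (lexx _)) (lexx _)) _.
  apply: le_trans
    (lerD (lerD (lerD (lerD h1 h2) (lexx _)) (lexx _)) (lexx _)) _.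
  have h6 : 0 <= K * rho ^+ 3 by rewrite mulr_ge0// exprn_ge0.
  have h7 : 0 <= C * rho ^+ 3 by rewrite mulr_ge0// exprn_ge0.
  rewrite -subr_ge0 (_ : _ - _ = K * rho ^+ 3 + C * rho ^+ 3) ?addr_ge0//.
  by ring.
Qed.

End jet_bound.

(** * A multivariate central limit theorem for draws from a finite population *)

Section lindeberg.
Context {R : realType} {p : nat}.

(** The minimum of [x ^+ 2] and [x ^+ 3] for [0 <= x]: the order of the Taylor
    remainder of a bounded function with bounded derivatives at an increment of
    size [x]. *)
Definition lmin (x : R) : R := if x <= 1 then x ^+ 3 else x ^+ 2.

Definition heat_prod (v : R) (t x : 'cV[R]_p) : R :=
  \prod_j heat v (t j 0 - x j 0).

(** Adding one centred draw of covariance [h] times the identity has the same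
    effect, up to a Taylor remainder, as running the heat flow for a time [h]: both
    change the value by [h / 2] times the Laplacian, which is [jetD]. *)
Lemma heat_prod_step (d : R) : 0 < d -> exists2 K : R, 0 <= K &
  forall n (q : 'I_n -> R) (z : 'I_n -> 'cV[R]_p) h v (t x : 'cV[R]_p),
    d <= v -> 0 <= h <= 1 ->
    (forall i, 0 <= q i) -> \sum_i q i = 1 ->
    (forall j, \sum_i q i * z i j 0 = 0) ->
    (forall j k, \sum_i q i * (z i j 0 * z i k 0) = (j == k)%:R * h) ->
    `|\sum_i q i * heat_prod v t (x + z i) - heat_prod (v + h) t x| <=
      K * (\sum_i q i * lmin (enorm (z i)) + Num.sqrt h ^+ 3).
Proof.
move=> d0; have [C C0 [H01 Hz Hzz Hsp Hti]] := heat_taylor d0.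
have [K K0 HK] := jet_bound (index_enum 'I_p) C0.
exists (2 + 2 * K); first by rewrite addr_ge0 ?mulr_ge0.
move=> n q z h v t x dv /andP[h0 h1] q0 q1 z1 z2.
pose a j := heat v (t j 0 - x j 0); pose b j := heat_z v (t j 0 - x j 0).
pose c j := heat_zz v (t j 0 - x j 0).
have a01 j : 0 <= a j <= 1 by exact: H01.
have bC j : `|b j| <= C by exact: Hz.
have cC j : `|c j| <= C by exact: Hzz.
have C00 : `|0 : R| <= C by rewrite normr0.
set s := index_enum 'I_p in HK.
(* the change of variance is an expansion of the same kind, with a space
   increment sqrt h and no linear term *)
have [_ _ _ time] := HK a (fun=> 0) c a01 (fun=> C00) cC.
have [A1 LK QK space] := HK a b c a01 bC cC.
have us : uniq s by exact: index_enum_uniq.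
pose zz i j := z i j 0.
have [L0 _ Q0] := @jet_average R 'I_p a b c n q zz h s us
  (fun j _ => z1 j) (fun j k _ _ => z2 j k).
set D := jetD a c s in Q0.
have s01 : 0 <= Num.sqrt h <= 1.
  by rewrite sqrtr_ge0 -[leRHS]sqrtr1 ler_wsqrtr.
have hs : Num.sqrt h ^+ 2 = h by rewrite sqr_sqrtr.
have {time} time : `|heat_prod (v + h) t x - (jetA a s + h / 2 * D)| <=
    K * Num.sqrt h ^+ 3.
  have := time (Num.sqrt h) (fun=> Num.sqrt h)
    (fun j => heat (v + h) (t j 0 - x j 0)) s01 => /(_ _ _)/wrap[].
    by move=> j; rewrite ger0_norm ?sqrtr_ge0.
    move=> j; have := Hti v (t j 0 - x j 0) h dv h0.
    have E : a j - 0 * Num.sqrt h + c j / 2 * Num.sqrt h ^+ 2 =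
        a j + c j / 2 * h by rewrite hs; ring.
    rewrite E => T; apply: le_trans T _.
    rewrite ler_wpM2l// -[in leLHS]hs -exprM -[(2 * 2)%N]/(3.+1) exprS.
    have /andP[s0 s1] := s01.
    by rewrite ler_piMl// exprn_ge0.
  have L00 u : jetL a (fun=> 0) s u = 0.
    by elim: (s) => //= j s' ->; rewrite mulr0 !mul0r subrr.
  rewrite L00 addr0 (_ : jetQ _ _ _ _ _ = h / 2 * D)//.
  rewrite /D; elim: (s) => /= [|j s' ->]; first by rewrite mulr0.
  by rewrite hs; ring.
have sp i : `|heat_prod v t (x + z i) -
    (jetA a s + jetL a b s (zz i) + jetQ a b c s (zz i))| <=
    (2 + 2 * K) * lmin (enorm (z i)).
  have ze j : `|zz i j| <= enorm (z i) by exact: entry_le_enorm.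
  have e0 := enorm_ge0 (z i).
  rewrite /lmin; case: ifPn => [e1|].
    have := space (enorm (z i)) (zz i) (fun j => heat v (t j 0 - (x + z i) j 0)) => /(_ _ _ _)/wrap[].
    by rewrite e0 e1.
    by [].
    move=> j; have T := Hsp v (t j 0 - x j 0) (zz i j) dv.
    have -> : t j 0 - (x + z i) j 0 = t j 0 - x j 0 - zz i j.
      by rewrite mxE opprD addrA.
    apply: (le_trans T).
    by rewrite ler_wpM2l// lerXn2r// nnegrE (le_trans _ (ze j)).
    move=> T; apply: (le_trans T); rewrite ler_wpM2r ?exprn_ge0//; lra.
  rewrite -ltNge => e1.
  have P1 : `|heat_prod v t (x + z i)| <= 1.
    have F01 j : 0 <= heat v (t j 0 - (x + z i) j 0) <= 1 by exact: H01.
    rewrite ger0_norm ?prodr_ile1//.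
    by apply: prodr_ge0 => j _; have /andP[] := F01 j.
  apply: le_trans (ler_normB _ _) _.
  apply: le_trans (lerD P1 (le_trans (ler_normD _ _) (lerD (ler_normD _ _) (lexx _)))) _.
  have := LK _ _ ze; have := QK _ _ ze.
  have : 1 <= enorm (z i) ^+ 2 by rewrite exprn_ege1// ltW.
  have : K * enorm (z i) <= K * enorm (z i) ^+ 2.
    by rewrite ler_wpM2l// expr2 ler_peMl// ltW.
  by move: A1; clear; lra.
have -> : \sum_i q i * heat_prod v t (x + z i) - heat_prod (v + h) t x =
  \sum_i q i * (heat_prod v t (x + z i) -
    (jetA a s + jetL a b s (zz i) + jetQ a b c s (zz i))) +
  - (heat_prod (v + h) t x - (jetA a s + h / 2 * D)).
  have -> : \sum_i q i * (heat_prod v t (x + z i) -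
    (jetA a s + jetL a b s (zz i) + jetQ a b c s (zz i))) =
    \sum_i q i * heat_prod v t (x + z i) - (\sum_i q i) * jetA a s -
    \sum_i q i * jetL a b s (zz i) - \sum_i q i * jetQ a b c s (zz i).
    rewrite big_distrl/= -!sumrB; apply: eq_bigr => i _; ring.
  by rewrite q1 L0 Q0; ring.
apply: le_trans (ler_normD _ _) _; rewrite normrN mulrDr; apply: lerD.
  apply: le_trans (ler_norm_sum _ _ _) _; rewrite big_distrr/=.
  apply: ler_sum => i _; rewrite normrM (ger0_norm (q0 i)) mulrCA.
  by rewrite ler_wpM2l.
apply: le_trans time _; rewrite ler_wpM2r ?exprn_ge0 ?sqrtr_ge0//; lra.
Qed.

(** Lindeberg's replacement argument in semigroup form: [r] averaging steps are
    compared with [r] heat steps of length [1 / r]. *)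
Lemma heat_prod_clt (d : R) : 0 < d -> exists2 K : R, 0 <= K &
  forall n (q : 'I_n -> R) (z : 'I_n -> 'cV[R]_p) r (t : 'cV[R]_p),
    (0 < r)%N ->
    (forall i, 0 <= q i) -> \sum_i q i = 1 ->
    (forall j, \sum_i q i * z i j 0 = 0) ->
    (forall j k, \sum_i q i * (z i j 0 * z i k 0) = (j == k)%:R / r%:R) ->
    `|Esamp q (fun k : {ffun 'I_r -> 'I_n} =>
         heat_prod d t (\sum_j z (k j))) - heat_prod (d + 1) t 0| <=
      K * (r%:R * (\sum_i q i * lmin (enorm (z i))) + (Num.sqrt r%:R)^-1).
Proof.
move=> d0; have [K K0 step] := heat_prod_step d0; exists K => //.
move=> n q z r t r_gt0 q0 q1 z1 z2.
have r0 : (0 : R) < r%:R by rewrite ltr0n.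
set h : R := r%:R^-1.
have h0 : 0 <= h by rewrite invr_ge0 ltW.
have h1 : h <= 1 by rewrite invf_le1// ler1n.
set S := \sum_i q i * lmin _.
set tau := K * (S + Num.sqrt h ^+ 3).
(* the errors of the successive steps add up, as averaging is a contraction *)
have main m x : `|iter m (fun G x => \sum_i q i * G (x + z i))
      (heat_prod d t) x - heat_prod (d + m%:R * h) t x| <= m%:R * tau.
  elim: m x => [|m IH] x; first by rewrite !mul0r addr0 subrr normr0.
  have dm : d <= d + m%:R * h by rewrite lerDl mulr_ge0.
  rewrite iterS -[m.+1%:R]natr1.
  have := step n q z h (d + m%:R * h) t x dm.
  rewrite h0 h1 => /(_ isT q0 q1 z1 z2) T.
  move: IH; set u := iter m _ _ => IH.
  have -> : \sum_i q i * u (x + z i) - heat_prod (d + (m%:R + 1) * h) t x =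
     \sum_i q i * (u (x + z i) - heat_prod (d + m%:R * h) t (x + z i)) +
     (\sum_i q i * heat_prod (d + m%:R * h) t (x + z i) -
      heat_prod (d + m%:R * h + h) t x).
    rewrite mulrDl mul1r addrA.
    have -> : \sum_i q i * (u (x + z i) - heat_prod (d + m%:R * h) t (x + z i))
      = \sum_i q i * u (x + z i) -
        \sum_i q i * heat_prod (d + m%:R * h) t (x + z i).
      by rewrite -sumrB; apply: eq_bigr => i _; rewrite mulrBr.
    by rewrite [RHS]addrA subrK.
  apply: le_trans (ler_normD _ _) _; rewrite mulrDl mul1r; apply: lerD => //.
  apply: le_trans (ler_norm_sum _ _ _) _.
  have -> : m%:R * tau = \sum_i q i * (m%:R * tau) by rewrite -big_distrl/= q1 mul1r.
  apply: ler_sum => i _; rewrite normrM (ger0_norm (q0 i)).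
  apply: ler_wpM2l; [exact: q0|exact: IH].
have := main r 0; rewrite -Esamp_sum -/h mulfV ?gt_eqF//.
have -> : Esamp q (fun k : {ffun 'I_r -> 'I_n} =>
    heat_prod d t (0 + \sum_j z (k j))) =
    Esamp q (fun k : {ffun 'I_r -> 'I_n} => heat_prod d t (\sum_j z (k j))).
  by apply: eq_Esamp => k; rewrite add0r.
move=> T; apply: (le_trans T); rewrite /tau mulrCA ler_wpM2l// mulrDr lerD2l.
rewrite exprS sqr_sqrtr// mulrCA mulfV ?gt_eqF// mulr1.
by rewrite /h sqrtrV ?ler0n.
Qed.

End lindeberg.

Section clt.
Context {R : realType} {p : nat}.

(** The smoothing of width [e] and the shift of the thresholds by [a * e] vanish
    together. *)
Lemma prod_cdf_perturb (t : 'cV[R]_p) (a : R) :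
  \prod_j heat (e ^+ 2 + 1) (t j 0 + a * e) @[e --> (0 : R)^'+] -->
  \prod_j std_normal_cdf (t j 0).
Proof.
apply: cvg_at_right_filter.
have E j : std_normal_cdf (t j 0) = heat (0 ^+ 2 + 1) (t j 0 + a * 0).
  by rewrite /heat /rsd expr0n add0r powR1 mulr1 mulr0 addr0.
have -> : \prod_j std_normal_cdf (t j 0) =
    \prod_j heat (0 ^+ 2 + 1) (t j 0 + a * 0) by apply: eq_bigr => j _.
apply: cvg_big => //.
  exact: mul_continuous.
move=> j _; rewrite /heat.
apply: continuous_cvg; first exact: continuous_std_normal_cdf.
apply: cvgM.
  by apply: cvgD; [exact: cvg_cst|apply: cvgM; [exact: cvg_cst|exact: cvg_id]].
apply: continuous_cvg.
  apply/differentiable_continuous/derivable1_diffP; apply: ex_derive.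
  by apply: is_derive_rsd; rewrite expr0n add0r.
apply: cvgD; last exact: cvg_cst.
exact: exprn_continuous.
Qed.

(** The smoothed indicator with a small variance [del ^+ 2], at thresholds moved up
    or down by a few multiples of [del], encloses the indicator up to [eps]. The
    margin of size [del] also absorbs the perturbation [Z] of the sum, so that the
    same argument gives the theorem for statistics that are only approximately
    sums of draws; [bad] is where the approximation fails. *)
Lemma sampling_clt (t : 'cV[R]_p) (eps : R) : 0 < eps -> exists2 tau : R, 0 < tau &
  forall n (q : 'I_n -> R) (z : 'I_n -> 'cV[R]_p) r
    (Z : {ffun 'I_r -> 'I_n} -> 'cV[R]_p) (bad : pred {ffun 'I_r -> 'I_n}),
    (0 < r)%N ->
    (forall i, 0 <= q i) -> \sum_i q i = 1 ->
    (forall j, \sum_i q i * z i j 0 = 0) ->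
    (forall j k, \sum_i q i * (z i j 0 * z i k 0) = (j == k)%:R / r%:R) ->
    r%:R * (\sum_i q i * lmin (enorm (z i))) <= tau ->
    (Num.sqrt r%:R)^-1 <= tau ->
    Psamp q bad <= eps ->
    (forall k, ~~ bad k -> forall j, `|Z k j 0 - (\sum_i z (k i)) j 0| <= tau) ->
    `|Psamp q (fun k => [forall j, Z k j 0 <= t j 0])
       - \prod_j std_normal_cdf (t j 0)| <= 4 * eps.
Proof.
move=> e0.
(* K0 is such that the smoothed indicator is within eps of the indicator at
   distance K0 standard deviations *)
have [K0 [K01 K0p K0n]] : exists K0 : R,
    [/\ 0 < K0, 1 - eps <= std_normal_cdf K0 ^+ p & std_normal_cdf (- K0) <= eps].
  have c1 : std_normal_cdf x ^+ p @[x --> +oo] --> (1 : R).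
    rewrite -[1 in X in _ --> X](expr1n R p).
    apply: (@continuous_cvg _ _ _ _ _ _ (fun x : R => x ^+ p)).
      exact: exprn_continuous.
    exact: cvg_std_normal_cdf_pinfty.
  have c2 : std_normal_cdf (- x) @[x --> +oo] --> (0 : R).
    have /cvgNy_compNP := @cvg_std_normal_cdf_ninfty R; exact.
  near (+oo : set_system R) => K0.
  exists K0; split; near: K0.
  - exact: nbhs_pinfty_gt.
  - by apply: (cvgr_ge 1 c1); rewrite ltrBlDr ltrDl.
  - exact: (cvgr_le 0 c2).
set a := K0 + 1.
set l := \prod_j _.
have [del [d0 dp dn]] : exists del : R, [/\ 0 < del,
    \prod_j heat (del ^+ 2 + 1) (t j 0 + a * del) <= l + eps &
    l - eps <= \prod_j heat (del ^+ 2 + 1) (t j 0 + (- a) * del)].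
  have lp : l < l + eps by rewrite ltrDl.
  have ln : l - eps < l by rewrite ltrBlDr ltrDl.
  have np := cvgr_le _ (@prod_cdf_perturb t a) _ lp.
  have nn := cvgr_ge _ (@prod_cdf_perturb t (- a)) _ ln.
  near ((0 : R)^'+) => del; exists del; split.
  - by near: del; exact: nbhs_right_gt.
  - by near: del; exact: np.
  - by near: del; exact: nn.
have d20 : 0 < del ^+ 2 by rewrite exprn_gt0.
have [K K00 HK] := @heat_prod_clt R p _ d20.
(* at most [del], to absorb the perturbation, and small enough for the error
   of the central limit theorem for the smoothed indicator *)
pose tau := Num.min del (eps / (2 * K + 1)).
have K1 : 0 < 2 * K + 1 by lra.
have tau0 : 0 < tau by rewrite lt_min d0 divr_gt0.
exists tau => // n q z r Z bad r0 q0 q1 z1 z2 h1 h2 hb hZ.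
have tK : K * (tau + tau) <= eps.
  have : tau <= eps / (2 * K + 1) by rewrite ge_min lexx orbT.
  rewrite ler_pdivlMr// => T; nra.
have td : tau <= del by rewrite ge_min lexx.
have rsdd : rsd (del ^+ 2) = del^-1.
  apply/eqP; rewrite -(@eqrXn2 _ 2) ?ltW ?rsd_gt0 ?invr_gt0//.
  by rewrite rsd_sqr// exprVn.
have heatd y : heat (del ^+ 2) y = std_normal_cdf (y / del) by rewrite /heat rsdd.
have h01 y : 0 <= heat (del ^+ 2) y <= 1.
  by rewrite heatd std_normal_cdf_ge0 std_normal_cdf_le1.
have smooth b : `|Esamp q (fun k : {ffun 'I_r -> 'I_n} =>
    heat_prod (del ^+ 2) (\col_j (t j 0 + b * del)) (\sum_j z (k j)))
    - \prod_j heat (del ^+ 2 + 1) (t j 0 + b * del)| <= eps.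
  have := HK n q z r (\col_j (t j 0 + b * del)) r0 q0 q1 z1 z2.
  have -> : heat_prod (del ^+ 2 + 1) (\col_j (t j 0 + b * del)) 0 =
      \prod_j heat (del ^+ 2 + 1) (t j 0 + b * del).
    by apply: eq_bigr => j _; rewrite !mxE subr0.
  move=> T; apply: (le_trans T); apply: le_trans tK.
  by rewrite ler_wpM2l// lerD.
have S : \prod_(j < p) std_normal_cdf K0 = std_normal_cdf K0 ^+ p :> R.
  by rewrite big_const_ord iter_mulr_1.
have up : Psamp q (fun k => [forall j, Z k j 0 <= t j 0]) <=
    Esamp q (fun k : {ffun 'I_r -> 'I_n} =>
    heat_prod (del ^+ 2) (\col_j (t j 0 + a * del)) (\sum_j z (k j))) + eps + eps.
  rewrite -[X in _ + X + _](Esamp_cst q1 r).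
  apply: le_trans (lerD (lexx _) hb); rewrite -!EsampD; apply: le_Esamp => // k.
  have hp0 : 0 <= heat_prod (del ^+ 2) (\col_j (t j 0 + a * del)) (\sum_j z (k j)).
    by apply: prodr_ge0 => j _; have /andP[] := h01 ((\col_j (t j 0 + a * del)) j 0 - (\sum_j z (k j)) j 0).
  have [bk|bk] := boolP (bad k).
    apply: (@le_trans _ _ 1); first by rewrite lern1 leq_b1.
    by rewrite lerDr addr_ge0// ltW.
  rewrite addr0; have [/forallP Zt|_] := boolP [forall j, Z k j 0 <= t j 0]; last first.
    by rewrite addr_ge0// ltW.
  rewrite -lerBlDr; apply: (le_trans K0p); rewrite -S.
  apply: ler_prod => j _; rewrite std_normal_cdf_ge0/= heatd.
  apply: std_normal_cdf_homo; rewrite ler_pdivlMr// mxE.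
  have := Zt j; have := hZ k bk j; rewrite ler_norml => /andP[].
  rewrite /a; nra.
have lo : Esamp q (fun k : {ffun 'I_r -> 'I_n} =>
    heat_prod (del ^+ 2) (\col_j (t j 0 + (- a) * del)) (\sum_j z (k j))) <=
    Psamp q (fun k => [forall j, Z k j 0 <= t j 0]) + eps + eps.
  rewrite -[X in _ + X + _](Esamp_cst q1 r).
  apply: le_trans (lerD (lexx _) hb); rewrite -!EsampD; apply: le_Esamp => // k.
  have hp1 j : 0 <= heat (del ^+ 2) ((\col_j (t j 0 + (- a) * del)) j 0 - (\sum_j z (k j)) j 0) <= 1 by exact: h01.
  have hp : heat_prod (del ^+ 2) (\col_j (t j 0 + (- a) * del)) (\sum_j z (k j)) <= 1.
    by apply: prodr_ile1.
  have [bk|bk] := boolP (bad k).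
    by rewrite (le_trans hp)// lerDr addr_ge0// ltW.
  rewrite addr0; have [_|] := boolP [forall j, Z k j 0 <= t j 0].
    by rewrite (le_trans hp)// lerDl ltW.
  rewrite negb_forall => /existsP[j]; rewrite -ltNge => tZ.
  rewrite add0r; apply: le_trans K0n.
  rewrite /heat_prod (bigD1 j)//=.
  apply: (@le_trans _ _ (heat (del ^+ 2) ((\col_j (t j 0 + (- a) * del)) j 0 - (\sum_j z (k j)) j 0))).
    by rewrite ler_piMr//; [have /andP[] := hp1 j|apply: prodr_ile1].
  rewrite heatd; apply: std_normal_cdf_homo; rewrite ler_pdivrMr// mxE.
  have := tZ; have := hZ k bk j; rewrite ler_norml => /andP[].
  rewrite /a; nra.
have := smooth a; have := smooth (- a); rewrite !ler_norml.
move=> /andP[s1 s2] /andP[s3 s4].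
by move: up lo dp dn s1 s2 s3 s4; clear; move=> *; apply/andP; split; lra.
Unshelve. all: by end_near. Qed.

End clt.

(** * Euclidean geometry of vectors and positive definite matrices *)

Section euclid.
Context {R : realType} {p : nat}.
Implicit Types (u v w : 'cV[R]_p) (A B S : 'M[R]_p) (a b c k : R).

Lemma dotvC u v : dotv u v = dotv v u.
Proof. by rewrite !dotvE; apply: eq_bigr => j _; rewrite mulrC. Qed.

Lemma dotvDr u v w : dotv u (v + w) = dotv u v + dotv u w.
Proof. by rewrite /dotv mulmxDr mxE. Qed.

Lemma dotvZr a u v : dotv u (a *: v) = a * dotv u v.
Proof. by rewrite /dotv -scalemxAr mxE. Qed.

Lemma dotvDl u v w : dotv (u + v) w = dotv u w + dotv v w.
Proof. by rewrite dotvC dotvDr !(dotvC w). Qed.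

Lemma dotvZl a u v : dotv (a *: u) v = a * dotv u v.
Proof. by rewrite dotvC dotvZr dotvC. Qed.

Lemma dotvNr u v : dotv u (- v) = - dotv u v.
Proof. by rewrite -scaleN1r dotvZr mulN1r. Qed.

Lemma dotvBr u v w : dotv u (v - w) = dotv u v - dotv u w.
Proof. by rewrite dotvDr dotvNr. Qed.

Lemma dotv_mulmx A u v : dotv u (A *m v) = dotv (A^T *m u) v.
Proof. by rewrite /dotv trmx_mul trmxK mulmxA. Qed.

Lemma quadformE A v : quadform A v = dotv v (A *m v).
Proof. by rewrite /quadform /dotv mulmxA. Qed.

Lemma quadform_sum A v : quadform A v = \sum_i \sum_j A i j * (v i 0 * v j 0).
Proof.
rewrite quadformE dotvE; apply: eq_bigr => i _; rewrite mxE big_distrr/=.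
by apply: eq_bigr => j _; ring.
Qed.

Lemma quadformD A B v : quadform (A + B) v = quadform A v + quadform B v.
Proof. by rewrite !quadformE mulmxDl dotvDr. Qed.

Lemma quadformB A B v : quadform (A - B) v = quadform A v - quadform B v.
Proof. by rewrite !quadformE mulmxBl dotvBr. Qed.

Lemma quadformZ a A v : quadform (a *: A) v = a * quadform A v.
Proof. by rewrite !quadformE -scalemxAl dotvZr. Qed.

Lemma quadform1 v : quadform 1%:M v = enorm v ^+ 2.
Proof. by rewrite quadformE mul1mx sqr_enorm. Qed.

Lemma quadform_outer w v : quadform (w *m w^T) v = dotv w v ^+ 2.
Proof.
rewrite quadformE -mulmxA -/(dotv w v) [w^T *m v]mx11_scalar mul_mx_scalar.
by rewrite dotvZr expr2 (dotvC v).
Qed.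

(** The form is nonnegative on every combination of [u] and [v]; the discriminant
    argument needs a separate case when [quadform A v] vanishes, as [A] may be
    singular. *)
Lemma quadform_CS A u v : A^T = A -> (forall w, 0 <= quadform A w) ->
  dotv u (A *m v) ^+ 2 <= quadform A u * quadform A v.
Proof.
move=> As A0; set b := dotv u (A *m v); set x := quadform A u; set y := quadform A v.
have key s t : 0 <= s ^+ 2 * x + 2 * s * t * b + t ^+ 2 * y.
  have := A0 (s *: u + t *: v); rewrite quadformE mulmxDr -!scalemxAr.
  rewrite !dotvDr !dotvDl !dotvZr !dotvZl.
  have -> : dotv v (A *m u) = b by rewrite dotv_mulmx As dotvC.
  rewrite -/b -!quadformE -/x -/y => T; apply: (le_trans T); nra.
have x0 : 0 <= x := A0 u; have y0 : 0 <= y := A0 v.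
have [y00|yn] := eqVneq y 0.
  have h1 := key 1 (- (x + 1) * b); have h2 := key b (- (x + 1)).
  rewrite y00 mulr0 addr0 in h1 h2 *.
  by rewrite expr1n in h1; nra.
have yp : 0 < y by rewrite lt_neqAle eq_sym yn.
have := key y (- b); rewrite sqrrN => T.
have : 0 <= y * (x * y - b ^+ 2) by apply: (le_trans T); nra.
by rewrite pmulr_rge0// subr_ge0.
Qed.

Lemma dotv_CS u v : `|dotv u v| <= enorm u * enorm v.
Proof.
have := @quadform_CS 1%:M u v (trmx1 _ _).
rewrite mul1mx !quadform1 => /(_ _)/wrap[w|].
  by rewrite quadform1 exprn_ge0// enorm_ge0.
rewrite -exprMn -[dotv u v ^+ 2]real_normK ?num_real//.
by rewrite ler_pXn2r// nnegrE mulr_ge0// enorm_ge0.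
Qed.

Lemma enormD u v : enorm (u + v) <= enorm u + enorm v.
Proof.
rewrite -(@ler_pXn2r _ 2) ?nnegrE ?addr_ge0 ?enorm_ge0//.
rewrite sqr_enorm dotvDl !dotvDr -!sqr_enorm (dotvC v u).
have := le_trans (ler_norm _) (dotv_CS u v); rewrite sqrrD; lra.
Qed.

Lemma enormZ a v : enorm (a *: v) = `|a| * enorm v.
Proof.
by rewrite /enorm dotvZl dotvZr mulrA -expr2 sqrtrM ?sqr_ge0// sqrtr_sqr.
Qed.

Lemma enormN v : enorm (- v) = enorm v.
Proof. by rewrite -scaleN1r enormZ normrN normr1 mul1r. Qed.

Lemma enormB u v : enorm (u - v) <= enorm u + enorm v.
Proof. by rewrite -[enorm v]enormN enormD. Qed.

Lemma enorm0 : enorm (0 : 'cV[R]_p) = 0.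
Proof. by rewrite -(scale0r 0) enormZ normr0 mul0r. Qed.

Lemma enorm_sum (I : Type) (s : seq I) (F : I -> 'cV[R]_p) :
  enorm (\sum_(i <- s) F i) <= \sum_(i <- s) enorm (F i).
Proof.
elim: s => [|i s IH]; first by rewrite !big_nil enorm0.
by rewrite !big_cons (le_trans (enormD _ _))// lerD2l.
Qed.

Lemma enorm_eq0 v : enorm v = 0 -> v = 0.
Proof.
move=> v0; apply/matrixP => j k; rewrite ord1 mxE; apply/eqP.
by rewrite -normr_le0 -v0 entry_le_enorm.
Qed.

Lemma enorm_gt0 v : v != 0 -> 0 < enorm v.
Proof.
move=> v0; rewrite lt_neqAle enorm_ge0 andbT eq_sym.
by apply: contra_neq v0; exact: enorm_eq0.
Qed.

Lemma enorm_le_sum v : enorm v <= \sum_j `|v j 0|.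
Proof.
have s0 : 0 <= \sum_j `|v j 0| by exact: sumr_ge0.
rewrite -(@ler_pXn2r _ 2) ?nnegrE ?enorm_ge0//.
rewrite sqr_enorm dotvE expr2 big_distrl/=; apply: ler_sum => j _.
rewrite -[v j 0 * _]ger0_norm -?expr2 ?sqr_ge0// normrX expr2 ler_wpM2l//.
by rewrite (bigD1 j)//= lerDl sumr_ge0.
Qed.

Lemma enorm_mulmx_entry A k v : (forall i j, `|A i j| <= k) ->
  enorm (A *m v) <= p%:R ^+ 2 * k * enorm v.
Proof.
move=> Ak; apply: le_trans (enorm_le_sum _) _.
have -> : p%:R ^+ 2 * k * enorm v = \sum_(i < p) \sum_(j < p) k * enorm v.
  have sc (x : R) : \sum_(i < p) x = p%:R * x.
    by rewrite sumr_const card_ord mulr_natl.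
  by rewrite !sc expr2 !mulrA.
apply: ler_sum => i _; rewrite mxE; apply: le_trans (ler_norm_sum _ _ _) _.
by apply: ler_sum => j _; rewrite normrM ler_pM// entry_le_enorm.
Qed.

Lemma quadform_entry A k v : (forall i j, `|A i j| <= k) ->
  `|quadform A v| <= p%:R ^+ 2 * k * enorm v ^+ 2.
Proof.
move=> Ak; rewrite quadformE; apply: le_trans (dotv_CS _ _) _.
by rewrite mulrC expr2 mulrA ler_wpM2r ?enorm_ge0// enorm_mulmx_entry.
Qed.

Lemma coercive_posdef A c : 0 < c -> A^T = A ->
  (forall v, c * enorm v ^+ 2 <= quadform A v) -> posdefmx A.
Proof.
move=> c0 As Ac; split=> // v v0; apply: lt_le_trans (Ac v).
by rewrite mulr_gt0// exprn_gt0// enorm_gt0.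
Qed.

Lemma posdef_unit A : posdefmx A -> A \in unitmx.
Proof.
move=> [As A0]; rewrite -row_free_unit -kermx_eq0; apply/rowV0P => u.
move=> /sub_kermxP uA; apply/eqP; apply: contraT => u0.
have /A0 : u^T != 0 by rewrite trmx_eq0.
by rewrite quadformE -As -trmx_mul uA trmx0 dotvC dotvE big1 ?ltxx// => j _;
  rewrite mxE mul0r.
Qed.

Lemma trmx_invmx A : A^T = A -> (invmx A)^T = invmx A.
Proof. by move=> As; rewrite trmx_inv As. Qed.

Lemma posdef_ge0 A v : posdefmx A -> 0 <= quadform A v.
Proof.
move=> [_ A0]; have [->|/A0/ltW//] := eqVneq v 0.
by rewrite quadformE mulmx0 dotvE big1// => j _; rewrite mxE mul0r.
Qed.

(** The constant is 1 / (1 + tr A^-1): each coordinate of [v] is the [A]-inner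
    product of [v] with a column of [A^-1]. *)
Lemma posdef_coercive A : posdefmx A ->
  let t := \sum_j invmx A j j in
  0 <= t /\ forall v, (1 + t)^-1 * enorm v ^+ 2 <= quadform A v.
Proof.
move=> pA t; have uA := posdef_unit pA; have [As _] := pA.
pose f j := invmx A *m (delta_mx j 0 : 'cV[R]_p).
have fq j : quadform A (f j) = invmx A j j.
  rewrite quadformE /f mulmxA mulmxV// mul1mx dotvE (bigD1 j)//= big1.
    by rewrite -colE !mxE !eqxx mulr1 addr0.
  by move=> i /negPf ij; rewrite !mxE ij/= mulr0.
have t0 : 0 <= t by apply: sumr_ge0 => j _; rewrite -fq posdef_ge0.
split=> // v.
have t1 : 0 < 1 + t by rewrite ltr_pwDl.
rewrite mulrC ler_pdivrMr// mulrDr mulr1.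
have q0 := posdef_ge0 v pA.
suff : enorm v ^+ 2 <= quadform A v * t by lra.
rewrite sqr_enorm dotvE /t mulrC big_distrl/=; apply: ler_sum => j _.
have := quadform_CS (f j) v As (fun w => posdef_ge0 w pA).
rewrite fq dotv_mulmx As /f mulmxA mulmxV// mul1mx => T.
apply: le_trans T; rewrite le_eqVlt; apply/orP; left; apply/eqP.
rewrite -expr2; congr (_ ^+ 2); rewrite dotvE (bigD1 j)//= big1.
  by rewrite mxE !eqxx mul1r addr0.
by move=> i /negPf ij; rewrite mxE ij mul0r.
Qed.

Lemma posdef_coercive_ex A : posdefmx A ->
  exists2 c : R, 0 < c & forall v, c * enorm v ^+ 2 <= quadform A v.
Proof.
move=> /posdef_coercive[t0 Hc]; eexists; last exact: Hc.
by rewrite invr_gt0 ltr_pwDl.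
Qed.

Lemma coercive_enorm A c v : 0 <= c ->
  (forall v, c * enorm v ^+ 2 <= quadform A v) -> c * enorm v <= enorm (A *m v).
Proof.
move=> c0 Ac; have [->|/enorm_gt0 v0] := eqVneq v 0.
  by rewrite enorm0 mulr0 enorm_ge0.
rewrite -(ler_pM2l v0); apply: le_trans (le_trans (ler_norm _) (dotv_CS _ _)).
by rewrite -quadformE; apply: le_trans (Ac v); rewrite expr2; nra.
Qed.

Lemma coercive_inv A c v : 0 < c -> A \in unitmx ->
  (forall v, c * enorm v ^+ 2 <= quadform A v) ->
  enorm (invmx A *m v) <= c^-1 * enorm v.
Proof.
move=> c0 uA Ac; have := coercive_enorm (invmx A *m v) (ltW c0) Ac.
rewrite mulmxA mulmxV// mul1mx => T.
by rewrite mulrC ler_pdivlMr// mulrC.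
Qed.

Lemma quadform_tr_mul A B v : quadform (B^T *m A *m B) v = quadform A (B *m v).
Proof.
by rewrite !quadformE -!mulmxA dotv_mulmx trmxK.
Qed.

Lemma posdef_congr A B : B \in unitmx -> posdefmx A -> posdefmx (B^T *m A *m B).
Proof.
move=> uB [As A0]; split; first by rewrite !trmx_mul trmxK As mulmxA.
move=> v v0; rewrite quadform_tr_mul; apply: A0; apply: contra_neq v0 => Bv.
by rewrite -[v]mul1mx -(mulVmx uB) -mulmxA Bv mulmx0.
Qed.

Lemma posdef_invmx A : posdefmx A -> posdefmx (invmx A).
Proof.
move=> pA; have uA := posdef_unit pA; have [As _] := pA.
have -> : invmx A = (invmx A)^T *m A *m invmx A.
  by rewrite trmx_invmx// mulVmx// mul1mx.
by apply: posdef_congr; rewrite ?unitmx_inv.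
Qed.

End euclid.

(** * The positive definite square root *)

Lemma cvg_sumr {R : realType} {I T : Type} (F : set_system T) (s : seq I)
    (f : I -> T -> R) (l : I -> R) : Filter F ->
  (forall i, f i x @[x --> F] --> l i) ->
  \sum_(i <- s) f i x @[x --> F] --> \sum_(i <- s) l i.
Proof.
by move=> FF fl; apply: cvg_big => //; exact: add_continuous.
Qed.

Section sqrtmx.
Context {R : realType} {p : nat}.
Implicit Types (u v w : 'cV[R]_p) (A B C S Y : 'M[R]_p) (c k rho : R).

Definition opbound A k := forall v, enorm (A *m v) <= k * enorm v.

Lemma opboundD A B a b : opbound A a -> opbound B b -> opbound (A + B) (a + b).
Proof.
move=> Aa Bb v; rewrite mulmxDl mulrDl.
by apply: le_trans (enormD _ _) _; rewrite lerD.
Qed.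

Lemma opboundM A B a b : 0 <= a -> opbound A a -> opbound B b ->
  opbound (A *m B) (a * b).
Proof.
move=> a0 Aa Bb v; rewrite -mulmxA; apply: le_trans (Aa _) _.
by rewrite -mulrA ler_wpM2l.
Qed.

Lemma opboundZ A a c : 0 <= c -> opbound A a -> opbound (c *: A) (c * a).
Proof.
by move=> c0 Aa v; rewrite -scalemxAl enormZ ger0_norm// -mulrA ler_wpM2l.
Qed.

Lemma opbound_entry A a i j : 0 <= a -> opbound A a -> `|A i j| <= a.
Proof.
move=> a0 Aa; pose e : 'cV[R]_p := delta_mx j 0.
have e1 : enorm e = 1.
  rewrite /enorm dotvE (bigD1 j)//= big1 ?addr0.
    by rewrite !mxE !eqxx mulr1 sqrtr1.
  by move=> k /negPf kj; rewrite !mxE kj mulr0.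
have := Aa e; rewrite e1 mulr1; apply: le_trans.
have -> : A i j = (A *m e) i 0 by rewrite -colE mxE.
exact: entry_le_enorm.
Qed.

(** With [D] the difference of the two roots, [D S'] is [- S D], so that the traces
    of [D S D] and [D S' D] are nonnegative and opposite; hence both vanish and
    so does [D]. *)
Lemma posdef_sqrt_unique S S' :
  posdefmx S -> posdefmx S' -> S *m S = S' *m S' -> S = S'.
Proof.
move=> pS pS' SS; have [Ss _] := pS; have [S's _] := pS'.
pose D := S - S'.
have Ds : D^T = D by rewrite /D linearB/= Ss S's.
have DE : D *m S' = - (S *m D).
  by apply/eqP; rewrite -addr_eq0 /D mulmxBl mulmxBr SS addrA subrK subrr.
have trE A : \tr (D *m A *m D) = \sum_j quadform A (D *m delta_mx j 0).
  apply: eq_bigr => j _; rewrite -quadform_tr_mul Ds quadformE -colE dotvE.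
  rewrite (bigD1 j)//= big1 ?addr0; first by rewrite !mxE !eqxx mul1r.
  by move=> k /negPf kj; rewrite !mxE kj mul0r.
have T : \tr (D *m S' *m D) = - \tr (D *m S *m D).
  by rewrite DE mulNmx linearN/= mxtrace_mulC mulmxA.
have T0 A : posdefmx A -> 0 <= \tr (D *m A *m D).
  by move=> pA; rewrite trE; apply: sumr_ge0 => j _; exact: posdef_ge0.
have {T} T : \tr (D *m S *m D) = 0.
  by have := T0 _ pS; have := T0 _ pS'; rewrite T; lra.
have De j : D *m (delta_mx j 0 : 'cV[R]_p) = 0.
  apply/eqP; apply: contraT => /(proj2 pS); rewrite ltNge => /negP[].
  rewrite -T trE (bigD1 j)//= lerDl.
  by apply: sumr_ge0 => k _; exact: posdef_ge0.
apply/eqP; rewrite -subr_eq0; apply/eqP/matrixP => i j.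
by have /matrixP/(_ i 0) := De j; rewrite -colE !mxE.
Qed.

(** Scaled so that [1 - B / tau] is a contraction, [sqrt (B / tau) = 1 - Y] where
    [Y] is the fixed point of [Y |-> (C + Y^2) / 2] with [C = 1 - B / tau]. *)
Definition sqrt_scale B : R := 1 + \sum_i \sum_j `|B i j|.
Definition sqrt_iter B n : 'M[R]_p :=
  iter n (fun Y => 2^-1 *: ((1%:M - (sqrt_scale B)^-1 *: B) + Y *m Y)) 0.
Definition sqrt_approx B n : 'M[R]_p :=
  Num.sqrt (sqrt_scale B) *: (1%:M - sqrt_iter B n).

Lemma sqrt_scale_ge1 B : 1 <= sqrt_scale B.
Proof. by rewrite lerDl; do 2! (apply: sumr_ge0 => ? _). Qed.

Lemma quadform_sqrt_scale B v :
  `|quadform B v| <= sqrt_scale B * enorm v ^+ 2.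
Proof.
rewrite quadform_sum; apply: le_trans (ler_norm_sum _ _ _) _.
rewrite /sqrt_scale mulrDl big_distrl/= -[leLHS]add0r.
apply: lerD; first by rewrite mul1r exprn_ge0// enorm_ge0.
apply: ler_sum => i _; apply: le_trans (ler_norm_sum _ _ _) _.
rewrite big_distrl/=; apply: ler_sum => j _.
by rewrite !normrM expr2 !ler_pM// entry_le_enorm.
Qed.

(** [quadform_CS] applied to [C *m v] and [v] bounds [enorm (C *m v)] without
    eigenvalues. *)
Lemma psd_opbound C rho : 0 <= rho -> C^T = C ->
  (forall v, 0 <= quadform C v <= rho * enorm v ^+ 2) -> opbound C rho.
Proof.
move=> r0 Cs Cr v; set x := enorm (C *m v).
have x0 : 0 <= x := enorm_ge0 _; have v0 := enorm_ge0 v.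
have C0 w : 0 <= quadform C w by have /andP[] := Cr w.
have Cu w : quadform C w <= rho * enorm w ^+ 2 by have /andP[] := Cr w.
have := quadform_CS (C *m v) v Cs C0; rewrite -sqr_enorm -/x => T.
have {}T : (x * x) ^+ 2 <= (x * (rho * enorm v)) ^+ 2.
  rewrite -expr2; apply: (le_trans T).
  have := ler_pM (C0 _) (C0 _) (Cu (C *m v)) (Cu v); rewrite -/x.
  by move=> T'; apply: (le_trans T'); rewrite !exprMn; lra.
have [->|xn] := eqVneq x 0; first by rewrite mulr_ge0.
have xp : 0 < x by rewrite lt_neqAle eq_sym xn.
move: T; rewrite ler_pXn2r// ?nnegrE ?mulr_ge0//.
by rewrite ler_pM2l.
Qed.

Lemma cvg_geometric_steps (u : nat -> R) rho : 0 <= rho < 1 ->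
  (forall n, `|u n.+1 - u n| <= rho ^+ n) -> cvgn u.
Proof.
move=> /andP[r0 r1] ur.
have c1 : cvgn (series (telescope u)).
  apply: normed_cvg; apply: (@series_le_cvg _ _ (geometric 1 rho)) => //=.
  - by move=> n; rewrite mul1r exprn_ge0.
  - by move=> n; rewrite mul1r; exact: ur.
  - by apply: is_cvg_geometric_series; rewrite ger0_norm.
have -> : u = (fun n => u 0%N + series (telescope u) n).
  by apply/funext => n; exact: eq_sum_telescope.
by apply: is_cvgD => //; exact: is_cvg_cst.
Qed.

(** The square root is built as a limit of matrices that are polynomial in [B]
    instead of by diagonalization, because measurability of the root is needed
    later and passes to limits. *)
Lemma posdef_sqrt B : posdefmx B -> exists S,
  [/\ posdefmx S, S *m S = B &
      forall i j, sqrt_approx B n i j @[n --> \oo] --> S i j].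
Proof.
move=> pB; have [Bs _] := pB; have [c c0 cB] := posdef_coercive_ex pB.
set tau := sqrt_scale B; have t1 : 1 <= tau := sqrt_scale_ge1 B.
have t0 : 0 < tau := lt_le_trans ltr01 t1.
(* at most 1, so that [rho] is nonnegative *)
pose c1 := Num.min c 1; have c10 : 0 < c1 by rewrite lt_min c0 ltr01.
have c11 : c1 <= 1 by rewrite ge_min lexx orbT.
pose rho := 1 - c1 / tau.
have ct : 0 < c1 / tau by rewrite divr_gt0.
have ct1 : c1 / tau <= 1 by rewrite ler_pdivrMr// mul1r (le_trans c11).
have r0 : 0 <= rho by rewrite subr_ge0.
have r1 : rho < 1 by rewrite ltrBlDr ltrDl.
pose C := 1%:M - tau^-1 *: B.
have Cs : C^T = C by rewrite /C linearB/= linearZ/= Bs trmx1.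
have Cq v : 0 <= quadform C v <= rho * enorm v ^+ 2.
  rewrite /C quadformB quadformZ quadform1.
  have v2 : 0 <= enorm v ^+ 2 by rewrite exprn_ge0// enorm_ge0.
  apply/andP; split.
    rewrite subr_ge0 mulrC ler_pdivrMr// mulrC.
    exact: le_trans (ler_norm _) (quadform_sqrt_scale B v).
  rewrite /rho mulrBl mul1r lerD2l lerN2 mulrAC mulrC ler_wpM2l ?invr_ge0 ?(ltW t0)//.
  by apply: le_trans (cB v); rewrite ler_wpM2r// ge_min lexx.
have Cr : opbound C rho by exact: psd_opbound.
pose Y := sqrt_iter B.
have YS n : Y n.+1 = 2^-1 *: (C + Y n *m Y n) by [].
have Ysym n : (Y n)^T = Y n.
  elim: n => [|n IH]; first by rewrite /Y /= trmx0.
  by rewrite YS linearZ/= linearD/= Cs trmx_mul IH.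
have Yr n : opbound (Y n) rho.
  elim: n => [|n IH] v.
    by rewrite /Y/= mul0mx enorm0 mulr_ge0// enorm_ge0.
  rewrite YS; have := opboundZ (_ : 0 <= 2^-1) (opboundD Cr (opboundM r0 IH IH)) v.
  move=> /(_ _)/wrap[|T]; first by rewrite invr_ge0.
  apply: (le_trans T); rewrite ler_wpM2r ?enorm_ge0//.
  have : rho * rho <= rho by rewrite ler_piMr// ltW.
  lra.
have Yd n : opbound (Y n.+1 - Y n) (rho ^+ n.+1).
  elim: n => [|n IH].
    rewrite expr1 YS /Y/= mul0mx addr0 subr0 => v.
    rewrite -scalemxAl enormZ ger0_norm ?invr_ge0//.
    apply: le_trans (Cr v); rewrite ler_piMl ?enorm_ge0//.
    by rewrite invf_le1// ler1n.
  have -> : Y n.+2 - Y n.+1 =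
      2^-1 *: (Y n.+1 *m (Y n.+1 - Y n) + (Y n.+1 - Y n) *m Y n).
    rewrite YS [Y n.+1 in X in _ - X]YS -scalerBr; congr (_ *: _).
    by rewrite mulmxBr mulmxBl addrA subrK opprD addrACA subrr add0r.
  have rn : 0 <= rho ^+ n.+1 by rewrite exprn_ge0.
  have H2 : (0 : R) <= 2^-1 by rewrite invr_ge0.
  have := opboundZ H2 (opboundD (opboundM r0 (Yr n.+1) IH) (opboundM rn IH (Yr n))).
  by congr (opbound _ _); rewrite [rho ^+ n.+2]exprS; field.
have Ycvg i j : cvgn (fun n => Y n i j).
  apply: (@cvg_geometric_steps _ rho); first by rewrite r0.
  move=> n; have := @opbound_entry _ _ i j (exprn_ge0 n.+1 r0) (Yd n).
  rewrite !mxE => T; apply: (le_trans T); rewrite exprS ler_piMl ?exprn_ge0//.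
  exact: ltW.
pose L : 'M[R]_p := \matrix_(i, j) limn (fun n => Y n i j).
have YL i j : Y n i j @[n --> \oo] --> L i j by rewrite mxE; exact: Ycvg.
have Ls : L^T = L.
  apply/matrixP => i j; rewrite !mxE; congr (limn _); apply/funext => n.
  by rewrite -[in LHS]Ysym mxE.
have LE : L = 2^-1 *: (C + L *m L).
  apply/matrixP => i j.
  apply: (@cvg_unique _ _ (Y n.+1 i j @[n --> \oo])) => //.
    by have := YL i j; rewrite -(cvg_shiftS (fun n => Y n i j)).
  have -> : (fun n => Y n.+1 i j) =
      (fun n => 2^-1 * (C i j + \sum_k Y n i k * Y n k j)).
    by apply/funext => n; rewrite YS !mxE.
  have -> : (2^-1 *: (C + L *m L)) i j =
      2^-1 * (C i j + \sum_k L i k * L k j) by rewrite !mxE.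
  apply: cvgMr; apply: cvgD; first exact: cvg_cst.
  by apply: cvg_sumr => k; exact: cvgM.
have Lr v : quadform L v <= rho * enorm v ^+ 2.
  have cq : quadform (Y n) v @[n --> \oo] --> quadform L v.
    have -> : (fun n => quadform (Y n) v) =
        (fun n => \sum_i \sum_j Y n i j * (v i 0 * v j 0)).
      by apply/funext => n; rewrite quadform_sum.
    rewrite quadform_sum; apply: cvg_sumr => i; apply: cvg_sumr => j.
    exact: cvgMl.
  apply: (@cvgr_to_le _ _ _ _ _ _ _ cq); near=> n.
  rewrite quadformE; apply: le_trans (le_trans (ler_norm _) (dotv_CS _ _)) _.
  rewrite mulrC expr2 mulrA ler_wpM2r ?enorm_ge0//; exact: Yr.
pose S := Num.sqrt tau *: (1%:M - L).
have st0 : 0 < Num.sqrt tau by rewrite sqrtr_gt0.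
exists S; split.
- apply: (@coercive_posdef _ _ _ (Num.sqrt tau * (1 - rho))).
  + by rewrite mulr_gt0// subr_gt0.
  + by rewrite /S linearZ/= linearB/= trmx1 Ls.
  + move=> v; rewrite /S quadformZ quadformB quadform1 -mulrA ler_wpM2l ?(ltW st0)//.
    by rewrite mulrBl mul1r lerD2l lerN2.
- rewrite /S -scalemxAl -scalemxAr scalerA -expr2 sqr_sqrtr ?(ltW t0)//.
  rewrite mulmxBl mulmxBr mul1mx mulmxBr mulmx1 mul1mx.
  have -> : L *m L = 2%:R *: L - C.
    by rewrite [in X in _ = _ *: X - _]LE scalerA divff// scale1r addrC addKr.
  have -> : 1%:M - L - (L - (2%:R *: L - C)) = tau^-1 *: B.
    by rewrite /C scaler_nat mulr2n; apply/matrixP => i j; rewrite !mxE; ring.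
  by rewrite scalerA divff ?scale1r// gt_eqF.
- move=> i j; rewrite /sqrt_approx /S !mxE.
  have -> : (fun n => (Num.sqrt (sqrt_scale B) *: (1%:M - sqrt_iter B n)) i j) =
     (fun n => Num.sqrt tau * ((i == j)%:R - Y n i j)).
    by apply/funext => n; rewrite !mxE.
  by apply: cvgMr; apply: cvgB; [exact: cvg_cst|have := YL i j; rewrite mxE].
Unshelve. all: by end_near. Qed.

(** This replaces the choice of a root in the definition by an explicit limit. *)
Lemma invsqrtmxP (V : 'M[R]_p) : posdefmx V ->
  [/\ posdefmx (invsqrtmx V), invsqrtmx V *m invsqrtmx V = invmx V &
      forall i j, sqrt_approx (invmx V) n i j @[n --> \oo] --> invsqrtmx V i j].
Proof.
move=> pV; have [S [pS SS cS]] := posdef_sqrt (posdef_invmx pV).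
rewrite /invsqrtmx; case: xgetP => [S' _ [pS' SS']|/(_ S)[]//].
by have -> : S' = S by apply: posdef_sqrt_unique; rewrite // SS SS'.
Qed.

(** A positive definite root [S] of [invmx V] would make [invmx V], hence [V],
    positive definite. *)
Lemma invsqrtmx_out (V : 'M[R]_p) : ~ posdefmx V -> invsqrtmx V = 0.
Proof.
move=> nV; rewrite /invsqrtmx; case: xgetP => // S _ [pS SS]; case: nV.
have [Ss _] := pS.
have pS2 : posdefmx (S *m S).
  have := posdef_congr (posdef_unit pS) (_ : posdefmx 1%:M).
  rewrite Ss mulmx1; apply.
  by apply: (@coercive_posdef _ _ _ 1); rewrite ?trmx1// => v; rewrite mul1r quadform1.
by rewrite -[V]invmxK -SS; exact: posdef_invmx.
Qed.

End sqrtmx.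

(** * Minimizers of the corrected least squares losses *)

Section estimators.
Context {R : realType} {p : nat}.
Implicit Types (u v b g : 'cV[R]_p) (A : 'M[R]_p).

(** The minimizer of a quadratic function with Hessian [A] and gradient [- g] at
    the origin, with the default value of [argmin] when there is none. *)
Definition solvemx A g : 'cV[R]_p := if `[< posdefmx A >] then invmx A *m g else 0.

(** A quadratic function has a strict minimizer only if its Hessian is positive
    definite, as [f (b + v) + f (b - v) - 2 * f b = quadform A v]. *)
Lemma argmin_quadratic (f : 'cV[R]_p -> R) A g k : A^T = A ->
  (forall b, f b = k - dotv g b + 2^-1 * quadform A b) ->
  argmin f = solvemx A g.
Proof.
move=> As fE; rewrite /argmin /solvemx.
have quadD b v : quadform A (b + v) =
    quadform A b + 2 * dotv (A *m b) v + quadform A v.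
  rewrite !quadformE mulmxDr dotvDl !dotvDr (dotvC v (A *m b)).
  by rewrite [dotv b (A *m v)]dotv_mulmx As; ring.
case: asboolP => pA; last first.
  case: xgetP => // b _ /= bmin; case: pA; split=> // v v0.
  have h1 := bmin (b + v); have h2 := bmin (b - v).
  rewrite -subr_eq0 addrAC subrr add0r in h1; have {}h1 := h1 v0.
  rewrite -subr_eq0 addrAC subrr add0r oppr_eq0 in h2; have {}h2 := h2 v0.
  have qN : quadform A (- v) = quadform A v.
    by rewrite !quadformE mulmxN dotvNr dotvC dotvNr opprK dotvC.
  by move: h1 h2; rewrite !fE !quadD !dotvDr !dotvNr qN; lra.
have uA := posdef_unit pA.
have minb b : b != invmx A *m g -> f (invmx A *m g) < f b.
  move=> bne; set b0 := invmx A *m g in bne *.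
  have -> : b = b0 + (b - b0) by rewrite addrC subrK.
  set v := b - b0; have v0 : v != 0 by rewrite subr_eq0.
  have Ab : A *m b0 = g by rewrite /b0 mulmxA mulmxV// mul1mx.
  rewrite !fE quadD Ab dotvDr; have := (proj2 pA) v v0; lra.
case: xgetP => [b _ /= bmin|/(_ (invmx A *m g))[]//].
apply/eqP; apply: contraT => bne.
have h := bmin (invmx A *m g); rewrite eq_sym in h.
by have := lt_trans (minb _ bne) (h bne); rewrite ltxx.
Qed.

Variable Sigma : 'M[R]_p.
Hypothesis Sigma_sym : Sigma^T = Sigma.

Section weighted.
Variables (n s : nat) (W : nat -> 'cV[R]_p) (y w : nat -> R).

(** The losses of the full-data, pilot and two-step estimators are all of this
    form. *)
Definition wloss b : R :=
  (2 * n%:R)^-1 * (\sum_(k < s) w k * resid W y b k ^+ 2)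
  - 2^-1 * quadform Sigma b.
Definition whess : 'M[R]_p :=
  n%:R^-1 *: (\sum_(k < s) w k *: (W k *m (W k)^T)) - Sigma.
Definition wgrad : 'cV[R]_p := n%:R^-1 *: (\sum_(k < s) (w k * y k) *: W k).

Lemma whess_sym : whess^T = whess.
Proof.
rewrite /whess linearB/= linearZ/= Sigma_sym linear_sum/=; congr (_ *: _ - _).
by apply: eq_bigr => k _; rewrite linearZ/= trmx_mul trmxK.
Qed.

Lemma quadform_suml (m : nat) (F : 'I_m -> 'M[R]_p) b :
  quadform (\sum_k F k) b = \sum_k quadform (F k) b.
Proof.
elim/big_rec2: _ => [|k x A _ <-]; last by rewrite quadformD.
by rewrite quadformE mul0mx dotvE big1// => j _; rewrite mxE mulr0.
Qed.

Lemma dotv_suml (m : nat) (F : 'I_m -> 'cV[R]_p) b :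
  dotv (\sum_k F k) b = \sum_k dotv (F k) b.
Proof.
elim/big_rec2: _ => [|k x A _ <-]; last by rewrite dotvDl.
by rewrite dotvE big1// => j _; rewrite mxE mul0r.
Qed.

Lemma argmin_wloss : argmin wloss = solvemx whess wgrad.
Proof.
apply: (@argmin_quadratic _ _ _
  ((2 * n%:R)^-1 * \sum_(k < s) w k * y k ^+ 2) whess_sym) => b.
rewrite /wloss /whess /wgrad quadformB quadformZ quadform_suml dotvZl dotv_suml.
have -> : \sum_(k < s) w k * resid W y b k ^+ 2 =
    \sum_(k < s) w k * y k ^+ 2 - 2 * (\sum_(k < s) dotv ((w k * y k) *: W k) b)
    + \sum_(k < s) quadform (w k *: (W k *m (W k)^T)) b.
  rewrite big_distrr/= -sumrB -big_split/=; apply: eq_bigr => k _.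
  by rewrite quadformZ quadform_outer dotvZl /resid; ring.
rewrite invfM; set N := n%:R^-1; set S1 := \sum_(k < s) _.
set S2 := \sum_(k < s) _; set S3 := \sum_(k < s) _; by field.
Qed.

Lemma wscore b : wgrad - whess *m b =
  n%:R^-1 *: (\sum_(k < s) (w k * resid W y b k) *: W k) + Sigma *m b.
Proof.
rewrite /whess mulmxBl opprB addrA addrAC /wgrad; congr (_ + _).
rewrite -scalemxAl -scalerBr mulmx_suml -sumrB; congr (_ *: _).
apply: eq_bigr => k _; rewrite -scalemxAl -mulmxA -scalerA -scalerBr -scalerA.
congr (_ *: _); rewrite [(W k)^T *m b]mx11_scalar mul_mx_scalar -scalerBl.
by [].
Qed.

(** The error of the estimator solves a linear equation; its right-hand side is
    the score at [b], computed by [wscore]. *)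
Lemma solve_wloss b : posdefmx whess ->
  whess *m (argmin wloss - b) = wgrad - whess *m b.
Proof.
move=> pA; rewrite argmin_wloss /solvemx asboolT// mulmxBr mulmxA.
by rewrite mulmxV ?mul1mx// posdef_unit.
Qed.

End weighted.

Lemma full_estimatorE n W y :
  full_estimator Sigma n W y = argmin (wloss n n W y (fun=> 1)).
Proof.
congr argmin; apply/funext => b; rewrite /full_loss /wloss; congr (_ * _ - _).
by apply: eq_bigr => k _; rewrite mul1r.
Qed.

Lemma subsample_estimatorE n s Ws ys pis :
  subsample_estimator Sigma n s Ws ys pis =
  argmin (wloss n s Ws ys (fun k => (s%:R * pis k)^-1)).
Proof. by []. Qed.

Lemma HWE n W : HW Sigma n W = whess n n W (fun=> 1).
Proof.
rewrite /HW /whess; congr (_ *: _ - _).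
by apply: eq_bigr => k _; rewrite scale1r.
Qed.

Lemma HW_sym n W : (HW Sigma n W)^T = HW Sigma n W.
Proof. by rewrite HWE whess_sym. Qed.

(** The first-order condition of the full-data estimator. It identifies the
    correction term [Sigma *m b] with minus the mean of the scores, which is why
    the second-step scores are centred once [Sigma *m b] is added. *)
Lemma full_score n W y : posdefmx (HW Sigma n W) ->
  let b := full_estimator Sigma n W y in
  Sigma *m b = - (n%:R^-1 *: \sum_(i < n) resid W y b i *: W i).
Proof.
rewrite HWE => pA b; apply/eqP; rewrite -addr_eq0 addrC.
have := solve_wloss y b pA; rewrite {1}/b full_estimatorE subrr mulmx0 wscore.
have -> : \sum_(i < n) resid W y b i *: W i =
    \sum_(i < n) (1 * resid W y b i) *: W i.
  by apply: eq_bigr => i _; rewrite mul1r.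
by move=> <-.
Qed.

End estimators.

(** * The combined sample and its score *)

Section combined.
Context {R : realType} {p : nat}.
Variable Sigma : 'M[R]_p.
Hypothesis Sigma_sym : Sigma^T = Sigma.
Variables (n r0 r : nat) (W : nat -> 'cV[R]_p) (y : nat -> R) (pi : nat -> R).
Implicit Types I J : nat -> nat.

Definition comb_index I J k := if (k < r0)%N then I k else J (k - r0)%N.
Definition comb_prob I J k : R :=
  if (k < r0)%N then n%:R^-1 else pi (J (k - r0)%N).
Definition comb_weight I J k : R := ((r0 + r)%:R * comb_prob I J k)^-1.
Definition comb_estimator I J : 'cV[R]_p :=
  subsample_estimator Sigma n (r0 + r)%N (W \o comb_index I J)
    (y \o comb_index I J) (comb_prob I J).
Definition comb_hess I J : 'M[R]_p :=
  whess Sigma n (r0 + r)%N (W \o comb_index I J) (comb_weight I J).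

(** The attached probabilities [1 / n] give weight 1 to a first-step point,
    whatever [n]. *)
Lemma comb_sum (V : lmodType R) (F : nat -> V) I J : (0 < n)%N ->
  n%:R^-1 *: (\sum_(k < r0 + r) comb_weight I J k *: F (comb_index I J k)) =
  (r0 + r)%:R^-1 *:
    (\sum_(k < r0) F (I k) + \sum_(j < r) (n%:R * pi (J j))^-1 *: F (J j)).
Proof.
move=> n0; have n1 : n%:R != 0 :> R by rewrite pnatr_eq0 -lt0n.
rewrite big_split_ord/= !scalerDr !scaler_sumr; congr (_ + _).
  apply: eq_bigr => k _; rewrite scalerA /comb_weight /comb_prob /comb_index/=.
  by rewrite ltn_ord invfM invrK mulrCA mulVf// mulr1.
apply: eq_bigr => j _; rewrite !scalerA /comb_weight /comb_prob /comb_index/=.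
by rewrite ltnNge leq_addr/= addKn !invfM mulrCA.
Qed.

Lemma comb_hessE I J : (0 < n)%N ->
  comb_hess I J = (r0 + r)%:R^-1 *:
    (\sum_(k < r0) W (I k) *m (W (I k))^T +
     \sum_(j < r) (n%:R * pi (J j))^-1 *: (W (J j) *m (W (J j))^T)) - Sigma.
Proof.
by move=> n0; rewrite -(comb_sum (fun i => W i *m (W i)^T)).
Qed.

Lemma comb_score I J b : (0 < n)%N -> posdefmx (comb_hess I J) ->
  comb_hess I J *m (comb_estimator I J - b) =
  (r0 + r)%:R^-1 *:
    (\sum_(k < r0) resid W y b (I k) *: W (I k) +
     \sum_(j < r) (n%:R * pi (J j))^-1 *: (resid W y b (J j) *: W (J j)))
  + Sigma *m b.
Proof.
move=> n0 pH; rewrite /comb_estimator subsample_estimatorE solve_wloss// wscore.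
rewrite -(comb_sum (fun i => resid W y b i *: W i))//.
by congr (_ *: _ + _); apply: eq_bigr => k _; rewrite scalerA.
Qed.

(** The covariance of one second-step score, drawn with the probabilities [pi];
    it is [r] times the matrix that the theorem calls [Vc_mx]. *)
Definition score_cov : 'M[R]_p :=
  let bhat := full_estimator Sigma n W y in
  (n%:R ^+ 2)^-1 *:
    (\sum_(i < n) (resid W y bhat i ^+ 2 / pi i) *: (W i *m (W i)^T))
  - (Sigma *m bhat) *m (Sigma *m bhat)^T.

(** A single quantity that dominates every product of [W i] and the residual used
    below. The summand 1 makes it also dominate the number of first-step draws. *)
Definition moment4 (b : 'cV[R]_p) i : R := 1 + enorm (W i) ^+ 4 + resid W y b i ^+ 4.

Lemma score_cov_sym : score_cov^T = score_cov.
Proof.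
rewrite /score_cov linearB/= linearZ/= linear_sum/= trmx_mul trmxK.
congr (_ *: _ - _); apply: eq_bigr => i _.
by rewrite linearZ/= trmx_mul trmxK.
Qed.

End combined.

(** * Inverse square root of a covariance *)

Section norming.
Context {R : realType} {p : nat}.
Implicit Types (u v : 'cV[R]_p) (A S Q : 'M[R]_p).

Lemma sqrt_inv_congr (V S : 'M[R]_p) : V \in unitmx -> S \in unitmx ->
  S *m S = invmx V -> S *m V *m S = 1%:M.
Proof.
move=> uV uS SS.
have h : S *m (S *m V *m S) = S by rewrite !mulmxA SS mulVmx// mul1mx.
by rewrite -[LHS]mul1mx -[in LHS](mulVmx uS) -(mulmxA (invmx S)) h mulVmx.
Qed.

Lemma invmx_sandwich (A Q : 'M[R]_p) (a : R) : A \in unitmx -> Q \in unitmx ->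
  a != 0 -> invmx (invmx A *m (a^-1 *: Q) *m invmx A) =
    a *: (A *m invmx Q *m A).
Proof.
move=> uA uQ a0.
have h : (invmx A *m (a^-1 *: Q) *m invmx A) *m (a *: (A *m invmx Q *m A))
    = 1%:M.
  rewrite -!scalemxAr -!scalemxAl scalerA divff// scale1r -!mulmxA mulKmx//.
  by rewrite mulKVmx// mulVmx.
have [uV _] := mulmx1_unit h.
by rewrite -[LHS]mulmx1 -h mulKmx.
Qed.

(** The last bound holds because [V^-1] is [r] times [A Q^-1 A] and [Q^-1] is at
    most [1 / c]. It controls the norming matrix by [A], for which the perturbation
    bounds are stated. *)
Lemma invsqrtmx_sandwich A Q r c : A^T = A -> A \in unitmx -> (0 < r)%N ->
  Q^T = Q -> 0 < c -> (forall v, c * enorm v ^+ 2 <= quadform Q v) ->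
  let V := invmx A *m (r%:R^-1 *: Q) *m invmx A in
  let S := invsqrtmx V in
  [/\ posdefmx V, S^T = S, S *m V *m S = 1%:M &
      forall u, enorm (S *m u) <= Num.sqrt (r%:R / c) * enorm (A *m u)].
Proof.
move=> As uA r0 Qs c0 Qc V S; have r1 : (0 : R) < r%:R by rewrite ltr0n.
have pQ : posdefmx Q by exact: coercive_posdef Qc.
have uQ := posdef_unit pQ.
have pV : posdefmx V.
  rewrite /V -{1}(trmx_invmx As); apply: posdef_congr.
    by rewrite unitmx_inv.
  split; first by rewrite linearZ/= Qs.
  by move=> v v0; rewrite quadformZ mulr_gt0 ?invr_gt0// (proj2 pQ).
have [pS SS _] := invsqrtmxP pV; have [Ss _] := pS.
have uV := posdef_unit pV; have uS := posdef_unit pS.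
split => //.
  exact: sqrt_inv_congr.
move=> u; have VE : invmx V = r%:R *: (A *m invmx Q *m A).
  by apply: invmx_sandwich; rewrite ?gt_eqF.
have s0 : 0 <= Num.sqrt (r%:R / c) * enorm (A *m u).
  by rewrite mulr_ge0 ?sqrtr_ge0 ?enorm_ge0.
rewrite -(@ler_pXn2r _ 2) ?nnegrE ?enorm_ge0// exprMn [Num.sqrt (_ / _) ^+ 2]sqr_sqrtr; last first.
  by rewrite divr_ge0 ?(ltW r1) ?(ltW c0).
rewrite sqr_enorm dotv_mulmx Ss mulmxA -/S SS dotvC -quadformE VE quadformZ.
rewrite -mulrA ler_wpM2l ?(ltW r1)//.
rewrite -{1}As quadform_tr_mul quadformE.
apply: le_trans (le_trans (ler_norm _) (dotv_CS _ _)) _.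
have := coercive_inv (A *m u) c0 uQ Qc; have := enorm_ge0 (A *m u).
by move=> h1 h2; rewrite expr2 mulrCA ler_wpM2l.
Qed.

End norming.

(** * Tails and variances *)

Section elementary.
Context {R : realType}.

Lemma lmin_sqr (x : R) : 0 <= x -> lmin x <= x ^+ 2.
Proof. by move=> x0; rewrite /lmin; case: ifPn => // x1; rewrite exprS ler_piMl ?exprn_ge0. Qed.

Lemma lmin_cube (x : R) : 0 <= x -> lmin x <= x ^+ 3.
Proof.
move=> x0; rewrite /lmin; case: ifPn => //; rewrite -ltNge => x1.
by rewrite [leRHS]exprS ler_peMl ?exprn_ge0// ltW.
Qed.

Lemma near0_mul (C tau : R) : 0 < tau -> \forall x \near (0 : R)^'+, C * x <= tau.
Proof.
move=> t0; have h : C * x @[x --> (0 : R)^'+] --> (0 : R).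
  apply: cvg_at_right_filter; rewrite -[X in _ --> X](mulr0 C).
  by apply: cvgM; [exact: cvg_cst|exact: cvg_id].
exact: (cvgr_le _ h).
Qed.

(** A moment of order larger than 2 makes the second moment of the large values
    negligible, which is the way Lyapunov's condition implies Lindeberg's. *)
Lemma powR_tail (dl kp : R) : 0 < dl -> 0 < kp -> exists2 L : R, 1 <= L &
  forall a, L < a -> a ^+ 2 <= kp * a `^ (2 + dl).
Proof.
move=> d0 k0; pose L := Num.max 1 ((kp^-1) `^ (dl^-1)).
exists L; first by rewrite le_max lexx.
move=> a La; have a0 : 0 < a by apply: lt_trans La; rewrite lt_max ltr01.
rewrite powRD; last by rewrite (gt_eqF a0) implybT.
rewrite (powR_mulrn 2 (ltW a0)) mulrCA ler_peMr ?exprn_ge0 ?(ltW a0)//.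
rewrite mulrC -ler_pdivrMr// div1r.
have -> : kp^-1 = ((kp^-1) `^ dl^-1) `^ dl.
  by rewrite -powRrM mulVf ?gt_eqF// powRr1// invr_ge0 ltW.
apply: ge0_ler_powR; rewrite ?nnegrE ?powR_ge0 ?(ltW d0) ?(ltW a0)//.
by apply: le_trans (ltW La); rewrite le_max lexx orbT.
Qed.

Lemma Psamp_or n (q : 'I_n -> R) r (B1 B2 : pred {ffun 'I_r -> 'I_n}) :
  (forall i, 0 <= q i) ->
  Psamp q (fun k => B1 k || B2 k) <= Psamp q B1 + Psamp q B2.
Proof.
move=> q0; rewrite -EsampD; apply: le_Esamp => // k.
by case: (B1 k); case: (B2 k); rewrite /= ?lerDl ?addr0 ?add0r ?ler01.
Qed.

Lemma Esamp_mean_sqr n (q : 'I_n -> R) r (x : 'I_n -> R) mu : (0 < r)%N ->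
  (forall i, 0 <= q i) -> \sum_i q i = 1 -> \sum_i q i * x i = mu ->
  Esamp q (fun k : {ffun 'I_r -> 'I_n} => (r%:R^-1 * \sum_j (x (k j) - mu)) ^+ 2)
    <= r%:R^-1 * \sum_i q i * x i ^+ 2.
Proof.
move=> r0 q0 q1 xm; have r1 : r%:R != 0 :> R by rewrite pnatr_eq0 -lt0n.
have z0 : \sum_i q i * (x i - mu) = 0.
  under eq_bigr do rewrite mulrBr.
  by rewrite sumrB xm -big_distrl/= q1 mul1r subrr.
have -> : Esamp q (fun k : {ffun 'I_r -> 'I_n} =>
    (r%:R^-1 * \sum_j (x (k j) - mu)) ^+ 2) =
    r%:R^-1 ^+ 2 * Esamp q (fun k : {ffun 'I_r -> 'I_n} =>
      (\sum_j (x (k j) - mu)) ^+ 2).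
  by rewrite -EsampZ; apply: eq_Esamp => k; rewrite exprMn.
rewrite (@Esamp_sqr_sum _ _ q q1 r (fun i => x i - mu))//.
rewrite expr2 -mulrA [r%:R^-1 * (r%:R * _)]mulKf//.
rewrite ler_wpM2l ?invr_ge0//.
have -> : \sum_i q i * (x i - mu) ^+ 2 = \sum_i q i * x i ^+ 2 - mu ^+ 2.
  have -> : \sum_i q i * (x i - mu) ^+ 2 =
     \sum_i (q i * x i ^+ 2 - 2 * mu * (q i * x i) + q i * mu ^+ 2).
    by apply: eq_bigr => i _; ring.
  by rewrite big_split/= sumrB -big_distrr/= xm -big_distrl/= q1; ring.
by rewrite gerDl oppr_le0 sqr_ge0.
Qed.

End elementary.

(** The estimators take sequences of indices; the value 0 past the last draw is
    never read. *)
Definition draw_index n r (k : {ffun 'I_r -> 'I_n}) (j : nat) : nat :=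
  oapp (fun j' : 'I_r => k j' : nat) 0%N (insub j).

Lemma draw_indexE n r (k : {ffun 'I_r -> 'I_n}) (j : 'I_r) :
  draw_index k j = k j.
Proof. by rewrite /draw_index valK. Qed.

(** * The two-step estimator for a fixed first step *)

Section fixed_data.
Context {R : realType} {p : nat}.
Variable Sigma : 'M[R]_p.
Hypothesis Sigma_sym : Sigma^T = Sigma.
Variables (n r0 r : nat) (W : nat -> 'cV[R]_p) (y : nat -> R) (pi : nat -> R).
Variable I : nat -> nat.
Hypotheses (n_gt0 : (0 < n)%N) (r_gt0 : (0 < r)%N).

Let A : 'M[R]_p := HW Sigma n W.
Let bh : 'cV[R]_p := full_estimator Sigma n W y.
Let e i : R := resid W y bh i.
Let b : 'cV[R]_p := Sigma *m bh.
Let m i : R := moment4 W y bh i.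
Let a i : R := `|e i| * enorm (W i).

Variables (cA M : R).
Hypotheses (cA_gt0 : 0 < cA) (A_coercive : forall v, cA * enorm v ^+ 2 <= quadform A v).
Hypothesis M_ge1 : 1 <= M.
Hypothesis mean_m : n%:R^-1 * \sum_(i < n) m i <= M.
Hypothesis pi_gt0 : forall i : 'I_n, 0 < pi i.
Hypothesis pi_sum1 : \sum_(i < n) pi i = 1.
Hypothesis pi_inv : forall i : 'I_n, (n%:R * pi i)^-1 <= M.

Let q (i : 'I_n) : R := pi i.
Let q_ge0 i : 0 <= q i. Proof. exact: ltW (pi_gt0 i). Qed.
Let M_ge0 : 0 <= M. Proof. exact: le_trans ler01 M_ge1. Qed.
Let n1 : (0 : R) < n%:R. Proof. by rewrite ltr0n. Qed.
Let r1 : (0 : R) < r%:R. Proof. by rewrite ltr0n. Qed.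
Let posA : posdefmx A.
Proof. by apply: coercive_posdef A_coercive => //; exact: HW_sym. Qed.

Lemma moment4_ge1 i : 1 <= m i.
Proof.
rewrite /m /moment4 -addrA lerDl addr_ge0 ?exprn_even_ge0//.
Qed.

Lemma resid_enorm_ge0 i : 0 <= a i. Proof. by rewrite mulr_ge0// enorm_ge0. Qed.

Lemma resid_enorm_le_moment4 i : a i <= m i /\ a i ^+ 2 <= m i.
Proof.
rewrite /a /m /moment4 -/(e i).
have -> : e i ^+ 4 = `|e i| ^+ 4 by rewrite -normrX ger0_norm// exprn_even_ge0.
have := normr_ge0 (e i); have := enorm_ge0 (W i).
set u := enorm (W i); set v := `|e i| => u0 v0.
have s1 := sqr_ge0 (u - v); have s2 := sqr_ge0 (u ^+ 2 - 1).
have s3 := sqr_ge0 (v ^+ 2 - 1); have s4 := sqr_ge0 (u ^+ 2 - v ^+ 2).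
have u4 : 0 <= u ^+ 4 by rewrite exprn_even_ge0.
have v4 : 0 <= v ^+ 4 by rewrite exprn_even_ge0.
by split; nra.
Qed.

Lemma outer_le_moment4 i j k : `|W i j 0 * W i k 0| <= m i /\ (W i j 0 * W i k 0) ^+ 2 <= m i.
Proof.
have w2 : `|W i j 0 * W i k 0| <= enorm (W i) ^+ 2.
  by rewrite normrM expr2 ler_pM// entry_le_enorm.
have e4 : 0 <= resid W y bh i ^+ 4 by rewrite exprn_even_ge0.
have u4 : 0 <= enorm (W i) ^+ 4 by rewrite exprn_even_ge0.
have s2 := sqr_ge0 (enorm (W i) ^+ 2 - 1).
split; first by apply: (le_trans w2); rewrite /m /moment4; nra.
rewrite -[leLHS]real_normK ?num_real//.
apply: (@le_trans _ _ (enorm (W i) ^+ 4)); last by rewrite /m /moment4; lra.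
by rewrite -[4%N]/(2 * 2)%N exprM lerXn2r// nnegrE sqr_ge0.
Qed.

Let qn i : q i * (n%:R * pi i)^-1 = n%:R^-1.
Proof. by rewrite /q invfM mulrCA divff ?mulr1// gt_eqF. Qed.

(** One of the two factors [(n * pi i)^-1] cancels against the probability [pi i]
    up to [1 / n], and the other is at most [M]. *)
Lemma second_moment (x : 'I_n -> R) : (forall i, x i ^+ 2 <= m i) ->
  \sum_i q i * ((n%:R * pi i)^-1 * x i) ^+ 2 <= M ^+ 2.
Proof.
move=> xm; apply: (@le_trans _ _ (M * (n%:R^-1 * \sum_(i < n) m i))).
  rewrite !big_distrr/=; apply: ler_sum => i _.
  rewrite [_ ^+ 2](_ : _ = (n%:R * pi i)^-1 * ((n%:R * pi i)^-1 * x i ^+ 2)).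
    rewrite [q i * _]mulrA qn [leRHS]mulrCA ler_wpM2l ?invr_ge0 ?(ltW n1)//.
    by rewrite ler_pM ?sqr_ge0 ?invr_ge0 ?mulr_ge0 ?(ltW n1) ?(ltW (pi_gt0 i)).
  by ring.
by rewrite expr2 ler_wpM2l.
Qed.

(** The summand contributed by a draw of [i] to the score of the second step.
    [cscore] is the same, centred. *)
Definition dscore (i : 'I_n) : 'cV[R]_p := (n%:R * pi i)^-1 *: (e i *: W i).
Definition cscore i : 'cV[R]_p := dscore i + b.

Lemma Sigma_bhatE : b = - (n%:R^-1 *: \sum_(i < n) e i *: W i).
Proof. exact: (full_score Sigma_sym y posA). Qed.

Lemma dscore_mean j : \sum_i q i * dscore i j 0 = - b j 0.
Proof.
rewrite Sigma_bhatE.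
rewrite mxE opprK mxE summxE big_distrr/=; apply: eq_bigr => i _.
by rewrite !mxE mulrA qn.
Qed.

Lemma cscore_mean j : \sum_i q i * cscore i j 0 = 0.
Proof.
have -> : \sum_i q i * cscore i j 0 = \sum_i (q i * dscore i j 0 + q i * b j 0).
  by apply: eq_bigr => i _; rewrite /cscore mxE mulrDr.
by rewrite big_split/= dscore_mean -big_distrl/= pi_sum1 mul1r addNr.
Qed.

Lemma Sigma_bhat_le : enorm b <= M.
Proof.
rewrite Sigma_bhatE.
rewrite enormN enormZ ger0_norm ?invr_ge0 ?(ltW n1)//.
apply: le_trans mean_m; rewrite ler_wpM2l ?invr_ge0 ?(ltW n1)//.
apply: le_trans (enorm_sum _ _) _; apply: ler_sum => i _.
by rewrite enormZ; have [] := resid_enorm_le_moment4 i.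
Qed.

Lemma enorm_dscore i : enorm (dscore i) = (n%:R * pi i)^-1 * a i.
Proof.
rewrite /dscore !enormZ ger0_norm//.
by rewrite invr_ge0 mulr_ge0 ?(ltW n1) ?(ltW (pi_gt0 i)).
Qed.

Lemma dscore_sqr : \sum_i q i * enorm (dscore i) ^+ 2 <= M ^+ 2.
Proof.
under eq_bigr do rewrite enorm_dscore.
by apply: (second_moment (x := fun i => a i)) => i; have [] := resid_enorm_le_moment4 i.
Qed.

Lemma cscore_cov j k :
  \sum_i q i * (cscore i j 0 * cscore i k 0) = score_cov Sigma n W y pi j k.
Proof.
have -> : \sum_i q i * (cscore i j 0 * cscore i k 0) =
  \sum_i (q i * (dscore i j 0 * dscore i k 0) + q i * dscore i j 0 * b k 0 +
          q i * dscore i k 0 * b j 0 + q i * (b j 0 * b k 0)).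
  by apply: eq_bigr => i _; rewrite /cscore !mxE; ring.
rewrite !big_split/= -!big_distrl/= !dscore_mean pi_sum1.
have -> : score_cov Sigma n W y pi j k = (n%:R ^+ 2)^-1 *
    \sum_(i < n) ((resid W y bh i ^+ 2 / pi i) *: (W i *m (W i)^T)) j k
    - b j 0 * b k 0.
  rewrite /score_cov -[Sigma *m _]/b mxE [X in X + _]mxE summxE; congr (_ + _).
  by rewrite mxE mxE big_ord1 [b^T _ _]mxE.
have -> : (n%:R ^+ 2)^-1 * \sum_(i < n) ((resid W y bh i ^+ 2 / pi i) *:
   (W i *m (W i)^T)) j k = \sum_i q i * (dscore i j 0 * dscore i k 0).
  rewrite big_distrr/=; apply: eq_bigr => i _.
  rewrite /dscore !mxE big_ord1 !mxE -/(e i) /q.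
  have pin : pi i != 0 by rewrite gt_eqF.
  have nn : n%:R != 0 :> R by rewrite gt_eqF.
  by field; rewrite nn pin.
ring.
Qed.

(** The leading term of the error of the two-step estimator. *)
Definition mean_score (k : {ffun 'I_r -> 'I_n}) : 'cV[R]_p :=
  r%:R^-1 *: \sum_j cscore (k j).

Lemma Esamp_mean_score : Esamp q (fun k => enorm (mean_score k) ^+ 2) <= r%:R^-1 * M ^+ 2.
Proof.
have -> : Esamp q (fun k => enorm (mean_score k) ^+ 2) =
    \sum_l Esamp q (fun k : {ffun 'I_r -> 'I_n} =>
      (r%:R^-1 * \sum_j (dscore (k j) l 0 - (- b l 0))) ^+ 2).
  rewrite -Esamp_big; apply: eq_Esamp => k.
  rewrite sqr_enorm dotvE; apply: eq_bigr => l _.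
  rewrite /mean_score mxE summxE -expr2; congr ((_ * _) ^+ 2).
  by apply: eq_bigr => j _; rewrite opprK mxE.
apply: (@le_trans _ _ (\sum_l r%:R^-1 * \sum_i q i * dscore i l 0 ^+ 2)).
  apply: ler_sum => l _; apply: Esamp_mean_sqr => //; exact: dscore_mean.
rewrite -big_distrr/= ler_wpM2l ?invr_ge0 ?(ltW r1)//.
apply: le_trans dscore_sqr; rewrite exchange_big/=; apply: ler_sum => i _.
rewrite sqr_enorm dotvE big_distrr/=; apply: ler_sum => l _.
by rewrite -expr2.
Qed.

Definition meanWW l l' : R := n%:R^-1 * \sum_(i < n) W i l 0 * W i l' 0.
Definition hess_dev (k : {ffun 'I_r -> 'I_n}) l l' : R :=
  r%:R^-1 * \sum_j ((n%:R * pi (k j))^-1 * (W (k j) l 0 * W (k j) l' 0)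
                    - meanWW l l').

Lemma Esamp_hess_dev l l' :
  Esamp q (fun k => hess_dev k l l' ^+ 2) <= r%:R^-1 * M ^+ 2.
Proof.
pose x (i : 'I_n) := (n%:R * pi i)^-1 * (W i l 0 * W i l' 0).
have xm : \sum_i q i * x i = meanWW l l'.
  by rewrite /meanWW big_distrr/=; apply: eq_bigr => i _; rewrite /x mulrA qn.
apply: le_trans (Esamp_mean_sqr r_gt0 q_ge0 pi_sum1 xm) _.
rewrite ler_wpM2l ?invr_ge0 ?(ltW r1)//.
by apply: second_moment => i; have [] := outer_le_moment4 i l l'.
Qed.

Lemma meanWW_le l l' : `|meanWW l l'| <= M.
Proof.
rewrite normrM ger0_norm ?invr_ge0 ?(ltW n1)//.
apply: le_trans mean_m; rewrite ler_wpM2l ?invr_ge0 ?(ltW n1)//.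
apply: le_trans (ler_norm_sum _ _ _) _; apply: ler_sum => i _.
by have [] := outer_le_moment4 i l l'.
Qed.

Let s : R := (r0 + r)%:R.
Let s1 : 0 < s. Proof. by rewrite ltr0n addn_gt0 r_gt0 orbT. Qed.
Let sE : s = r0%:R + r%:R. Proof. by rewrite /s natrD. Qed.

Let r0E : s^-1 * r0%:R = 1 - s^-1 * r%:R.
Proof.
have -> : r0%:R = s - r%:R by rewrite sE addrK.
by rewrite mulrBr mulVf// lt0r_neq0.
Qed.

(** Bounds every contribution of the first step to the combined sample. It is
    negligible against [1 / sqrt r] when [r0] is negligible against [sqrt r]. *)
Definition first_step_weight : R := r%:R^-1 * \sum_(k < r0) m (I k).

Let first_step_weight_ge0 : 0 <= first_step_weight.
Proof.
rewrite mulr_ge0 ?invr_ge0 ?(ltW r1)// sumr_ge0// => k _.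
exact: le_trans ler01 (moment4_ge1 _).
Qed.

Let first_step_le (V : R) : V <= \sum_(k < r0) m (I k) -> s^-1 * V <= first_step_weight.
Proof.
move=> Vm; have m0 : 0 <= \sum_(k < r0) m (I k).
  by rewrite sumr_ge0// => k _; exact: le_trans ler01 (moment4_ge1 _).
apply: (@le_trans _ _ (s^-1 * \sum_(k < r0) m (I k))).
  by rewrite ler_wpM2l// invr_ge0 ltW.
rewrite ler_wpM2r// lef_pV2 ?posrE//.
by rewrite sE lerDr.
Qed.

Let r0_le : s^-1 * r0%:R <= first_step_weight.
Proof.
apply: first_step_le; rewrite -[r0 in leLHS]card_ord -sumr_const.
by apply: ler_sum => k _; exact: moment4_ge1.
Qed.

Let sV1 (V : R) : 0 <= V -> s^-1 * r%:R * V <= V.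
Proof.
by move=> V0; rewrite ler_piMl// mulrC ler_pdivrMr// mul1r sE lerDr.
Qed.

(** The first-step points contribute [first_step_weight], and the second-step
    points deviate from their mean by [hess_dev]. *)
Lemma hess_perturb k th l l' : `|hess_dev k l l'| <= th ->
  `|(comb_hess Sigma n r0 r W pi I (draw_index k) - A) l l'|
    <= first_step_weight * (1 + M) + th.
Proof.
move=> Dth; set x := \sum_(k < r0) W (I k) l 0 * W (I k) l' 0.
have -> : (comb_hess Sigma n r0 r W pi I (draw_index k) - A) l l' =
    s^-1 * x + s^-1 * r%:R * hess_dev k l l' - s^-1 * r0%:R * meanWW l l'.
  rewrite comb_hessE// -/s /A /HW opprB addrA subrK !mxE !summxE.
  have -> : \sum_(i < r0) (W (I i) *m (W (I i))^T) l l' = x.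
    by apply: eq_bigr => i _; rewrite mxE big_ord1 mxE.
  have -> : \sum_(i < n) (W i *m (W i)^T) l l' = \sum_(i < n) W i l 0 * W i l' 0.
    by apply: eq_bigr => i _; rewrite mxE big_ord1 mxE.
  rewrite -/(meanWW l l').
  have -> : \sum_(i < r) ((n%:R * pi (draw_index k i))^-1 *:
      (W (draw_index k i) *m (W (draw_index k i))^T)) l l' =
      r%:R * hess_dev k l l' + r%:R * meanWW l l'.
    rewrite /hess_dev mulrA divff ?gt_eqF// mul1r sumrB sumr_const card_ord.
    rewrite -[meanWW l l' *+ r]mulr_natl subrK; apply: eq_bigr => i _.
    by rewrite draw_indexE !mxE big_ord1 mxE.
  rewrite r0E.
  ring.
apply: le_trans (ler_normB _ _) _.
apply: le_trans (lerD (ler_normD _ _) (lexx _)) _.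
rewrite mulrDr mulr1 addrAC; apply: lerD; first apply: lerD.
- rewrite normrM ger0_norm ?invr_ge0 ?(ltW s1)//; apply: first_step_le.
  apply: le_trans (ler_norm_sum _ _ _) _; apply: ler_sum => i _.
  by have [] := outer_le_moment4 (I i) l l'.
- rewrite normrM ger0_norm ?mulr_ge0 ?invr_ge0 ?(ltW s1)//.
  by rewrite ler_pM ?mulr_ge0 ?invr_ge0 ?(ltW s1)// meanWW_le.
- rewrite normrM ger0_norm ?mulr_ge0 ?invr_ge0 ?(ltW s1)//.
  by apply: le_trans (sV1 _) _.
Qed.

(** The score at the full-data estimator of the combined sample. *)
Definition full_cscore (k : {ffun 'I_r -> 'I_n}) : 'cV[R]_p := s^-1 *:
    (\sum_(i < r0) e (I i) *: W (I i) +
     \sum_(j < r) (n%:R * pi (draw_index k j))^-1 *: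
        (e (draw_index k j) *: W (draw_index k j))) + b.

Lemma score_perturb k :
  enorm (full_cscore k - mean_score k) <= first_step_weight * (1 + M + enorm (mean_score k)).
Proof.
have -> : full_cscore k - mean_score k =
    s^-1 *: (\sum_(k < r0) e (I k) *: W (I k)) +
    (s^-1 * r0%:R) *: (b - mean_score k).
  rewrite r0E.
  have h : \sum_(j < r) (n%:R * pi (draw_index k j))^-1 *:
        (e (draw_index k j) *: W (draw_index k j)) = r%:R *: (mean_score k - b).
    have -> : mean_score k - b = r%:R^-1 *: \sum_j dscore (k j).
      rewrite /mean_score big_split/= sumr_const card_ord scalerDr -[b *+ r]scaler_nat.
      by rewrite scalerA mulVf ?gt_eqF// scale1r addrK.
    rewrite scalerA divff ?gt_eqF// scale1r; apply: eq_bigr => j _.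
    by rewrite draw_indexE.
  rewrite /full_cscore h scalerDr scalerA scalerBl scale1r.
  by apply/matrixP => u v; rewrite !mxE; ring.
apply: le_trans (enormD _ _) _.
rewrite -addrA mulrDr mulr1; apply: lerD.
  rewrite enormZ ger0_norm ?invr_ge0 ?(ltW s1)//; apply: first_step_le.
  apply: le_trans (enorm_sum _ _) _; apply: ler_sum => i _.
  by rewrite enormZ; have [] := resid_enorm_le_moment4 (I i).
rewrite enormZ ger0_norm ?mulr_ge0 ?invr_ge0 ?(ltW s1)//.
rewrite ler_pM ?enorm_ge0 ?mulr_ge0 ?invr_ge0 ?(ltW s1)//.
by apply: le_trans (enormB _ _) _; rewrite lerD2r Sigma_bhat_le.
Qed.

(** The error [z] of the two-step estimator satisfies [Hc *m z = full_cscore k]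
    with [Hc] the Hessian of the combined sample. Hence [A *m z] is the mean of the
    second-step scores, up to the score of the first step and to [(A - Hc) *m z],
    which is a product of two small factors. *)
Lemma estimator_perturb k th : 0 <= th ->
  (forall l l', `|hess_dev k l l'| <= th) ->
  p%:R ^+ 2 * (first_step_weight * (1 + M) + th) <= cA / 2 ->
  enorm (A *m (comb_estimator Sigma n r0 r W y pi I (draw_index k) - bh)
         - mean_score k) <=
  p%:R ^+ 2 * (first_step_weight * (1 + M) + th) * (2 / cA) *
    (enorm (mean_score k) + first_step_weight * (1 + M + enorm (mean_score k))) +
  first_step_weight * (1 + M + enorm (mean_score k)).
Proof.
move=> th0 Dth; set Hc := comb_hess Sigma n r0 r W pi I (draw_index k).
set z := comb_estimator _ _ _ _ _ _ _ _ _ - bh.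
set del := first_step_weight * (1 + M) + th => small.
have HA l l' : `|(Hc - A) l l'| <= del by exact: hess_perturb.
have Hco v : cA / 2 * enorm v ^+ 2 <= quadform Hc v.
  have -> : Hc = A + (Hc - A) by rewrite addrC subrK.
  rewrite quadformD; have := A_coercive v; have := quadform_entry v HA.
  rewrite ler_norml => /andP[h _].
  have : p%:R ^+ 2 * del * enorm v ^+ 2 <= cA / 2 * enorm v ^+ 2.
    by rewrite ler_wpM2r// exprn_ge0// enorm_ge0.
  lra.
have c2 : 0 < cA / 2 by rewrite divr_gt0.
have pH : posdefmx Hc by apply: coercive_posdef Hco => //; exact: whess_sym.
have Hz : Hc *m z = full_cscore k by rewrite /z (comb_score Sigma_sym).
have zle := coercive_enorm z (ltW c2) Hco; rewrite Hz in zle.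
have gle : enorm (full_cscore k) <= enorm (mean_score k) + first_step_weight * (1 + M + enorm (mean_score k)).
  rewrite -[full_cscore k](addrNK (mean_score k)) addrC.
  by apply: le_trans (enormD _ _) _; rewrite lerD2l score_perturb.
have -> : A *m z - mean_score k = - ((Hc - A) *m z) + (full_cscore k - mean_score k).
  by rewrite [(Hc - A) *m z]mulmxBl Hz opprB addrA subrK.
apply: le_trans (enormD _ _) _; apply: lerD; last exact: score_perturb.
rewrite enormN; apply: le_trans (enorm_mulmx_entry _ HA) _.
have d0 : 0 <= del by rewrite addr_ge0// mulr_ge0// addr_ge0.
rewrite -[leRHS]mulrA ler_wpM2l ?mulr_ge0 ?exprn_ge0//.
rewrite -[2 / cA]invf_div ler_pdivlMl//; exact: le_trans gle.
Qed.

Variable c : R.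
Hypothesis c_gt0 : 0 < c.
Let Q : 'M[R]_p := score_cov Sigma n W y pi.
Hypothesis Q_coercive : forall v, c * enorm v ^+ 2 <= quadform Q v.

Definition norming : 'M[R]_p :=
  invsqrtmx (invmx A *m (r%:R^-1 *: Q) *m invmx A).
(** Scaled so that the sum over the draws, and not the mean, has the identity as
    its covariance. *)
Definition nscore i : 'cV[R]_p := norming *m (invmx A *m (r%:R^-1 *: cscore i)).

Let As : A^T = A. Proof. exact: HW_sym. Qed.
Let uA : A \in unitmx. Proof. exact: posdef_unit posA. Qed.

Let sandwich := invsqrtmx_sandwich As uA r_gt0 (score_cov_sym Sigma n W y pi)
  c_gt0 Q_coercive.

Let norming_sym : norming^T = norming. Proof. by have [] := sandwich. Qed.

Lemma norming_le u : enorm (norming *m u) <= Num.sqrt (r%:R / c) * enorm (A *m u).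
Proof. by have [_ _ _] := sandwich; exact. Qed.

Lemma nscore_sum (k : {ffun 'I_r -> 'I_n}) :
  \sum_j nscore (k j) = norming *m (invmx A *m mean_score k).
Proof. by rewrite /mean_score scaler_sumr !mulmx_sumr. Qed.

Lemma nscore_mean j : \sum_i q i * nscore i j 0 = 0.
Proof.
have h : \sum_i q i *: cscore i = 0.
  apply/matrixP => l l'; rewrite ord1 summxE [RHS]mxE -[RHS](cscore_mean l).
  by apply: eq_bigr => i _; rewrite mxE.
have : (\sum_i q i *: nscore i) j 0 = 0.
  have -> : \sum_i q i *: nscore i =
      norming *m (invmx A *m (r%:R^-1 *: \sum_i q i *: cscore i)).
    rewrite scaler_sumr !mulmx_sumr; apply: eq_bigr => i _.
    by rewrite /nscore -!scalemxAr !scalerA mulrC.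
  by rewrite h scaler0 !mulmx0 mxE.
by rewrite summxE => h0; rewrite -[RHS]h0; apply: eq_bigr => i _; rewrite [RHS]mxE.
Qed.

Lemma nscore_cov j l :
  \sum_i q i * (nscore i j 0 * nscore i l 0) = (j == l)%:R / r%:R.
Proof.
have h : \sum_i q i *: (cscore i *m (cscore i)^T) = Q.
  apply/matrixP => u v; rewrite summxE /Q -cscore_cov; apply: eq_bigr => i _.
  by rewrite mxE mxE big_ord1 [X in _ * (_ * X)]mxE.
have [_ _ SVS _] := sandwich.
have -> : \sum_i q i * (nscore i j 0 * nscore i l 0) =
    (\sum_i q i *: (nscore i *m (nscore i)^T)) j l.
  rewrite summxE; apply: eq_bigr => i _.
  by rewrite [RHS]mxE [X in _ = _ * X]mxE big_ord1 [_^T _ _]mxE.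
have -> : \sum_i q i *: (nscore i *m (nscore i)^T) = r%:R^-1 *: 1%:M.
  rewrite -SVS -/norming -[score_cov _ _ _ _ _]/Q -h.
  rewrite scaler_sumr mulmx_sumr mulmx_suml mulmx_sumr mulmx_suml scaler_sumr.
  apply: eq_bigr => i _.
  have -> : nscore i = r%:R^-1 *: (norming *m invmx A *m cscore i).
    by rewrite /nscore -!scalemxAr mulmxA.
  rewrite linearZ/= !trmx_mul norming_sym trmx_inv As.
  rewrite !(=^~ scalemxAl, =^~ scalemxAr, scalerA) !mulmxA.
  by congr (_ *: _); ring.
by rewrite !mxE mulrC.
Qed.

Let lam : R := (Num.sqrt r%:R)^-1 / Num.sqrt c.

Let lam_ge0 : 0 <= lam.
Proof. by rewrite mulr_ge0 ?invr_ge0 ?sqrtr_ge0. Qed.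

Let lam_sqr : r%:R * lam ^+ 2 = c^-1.
Proof.
rewrite /lam exprMn !exprVn !sqr_sqrtr ?(ltW r1) ?(ltW c_gt0)//.
by rewrite mulrA divff ?mul1r// gt_eqF.
Qed.

Lemma nscore_le i : enorm (nscore i) <= lam * enorm (cscore i).
Proof.
apply: le_trans (norming_le _) _.
rewrite mulmxA mulmxV// mul1mx enormZ ger0_norm ?invr_ge0 ?(ltW r1)//.
rewrite mulrA ler_wpM2r ?enorm_ge0// /lam sqrtrM ?(ltW r1)// sqrtrV ?(ltW c_gt0)//.
rewrite mulrAC ler_wpM2r ?invr_ge0 ?sqrtr_ge0//.
rewrite -[X in _ / X](sqr_sqrtr (ltW r1)) expr2 invfM mulrA divff ?mul1r//.
by rewrite gt_eqF// sqrtr_gt0.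
Qed.

Lemma estimator_norm_perturb k :
  enorm (norming *m (comb_estimator Sigma n r0 r W y pi I (draw_index k) - bh)
         - \sum_j nscore (k j)) <=
  Num.sqrt (r%:R / c) *
    enorm (A *m (comb_estimator Sigma n r0 r W y pi I (draw_index k) - bh)
         - mean_score k).
Proof.
rewrite nscore_sum -mulmxBr; apply: le_trans (norming_le _) _.
by rewrite mulmxBr mulmxA mulmxV// mul1mx.
Qed.

(** Scores of size at most [M * L] are of order [1 / sqrt r] after norming, where
    the cubic bound gains a factor [1 / sqrt r]; the quadratic bound on the larger
    ones is small because of the moment of order [2 + dl]. *)
Lemma nscore_lindeberg dl kap L : 1 <= L -> 0 <= kap ->
  (forall x, L < x -> x ^+ 2 <= kap * x `^ (2 + dl)) ->
  n%:R^-1 * \sum_(i < n) a i `^ (2 + dl) <= M ->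
  r%:R * (\sum_i q i * lmin (enorm (nscore i))) <=
    lam / c * (M * L + M) * (4 * M ^+ 2) + 4 / c * (M ^+ 2 * kap).
Proof.
move=> L1 kap0 tail mom.
pose x i := enorm (dscore i).
have x0 i : 0 <= x i by exact: enorm_ge0.
have xi i : enorm (cscore i) <= x i + M.
  by apply: le_trans (enormD _ _) _; rewrite lerD2l Sigma_bhat_le.
have L0 : 0 <= L by exact: le_trans ler01 L1.
have main i : q i * lmin (enorm (nscore i)) <=
    lam ^+ 3 * (M * L + M) * 2 * (q i * x i ^+ 2 + q i * M ^+ 2) +
    4 * lam ^+ 2 * (M * kap * (n%:R^-1 * a i `^ (2 + dl))).
  have zx : enorm (nscore i) <= lam * (x i + M).
    by apply: le_trans (nscore_le i) _; rewrite ler_wpM2l.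
  have z0 := enorm_ge0 (nscore i).
  have xM0 : 0 <= x i + M by rewrite addr_ge0.
  have sq : (x i + M) ^+ 2 <= 2 * (x i ^+ 2 + M ^+ 2).
    by have := sqr_ge0 (x i - M); nra.
  have T1 : 0 <= lam ^+ 3 * (M * L + M) * 2 * (q i * x i ^+ 2 + q i * M ^+ 2).
    by rewrite !mulr_ge0 ?exprn_ge0 ?addr_ge0 ?mulr_ge0 ?exprn_ge0.
  have T2 : 0 <= 4 * lam ^+ 2 * (M * kap * (n%:R^-1 * a i `^ (2 + dl))).
    by rewrite !mulr_ge0 ?exprn_ge0 ?invr_ge0 ?powR_ge0 ?(ltW n1).
  have [xL|xL] := leP (x i) (M * L).
    apply: le_trans (_ : _ <= lam ^+ 3 * (M * L + M) * 2 * (q i * x i ^+ 2 + q i * M ^+ 2)) _; last by rewrite lerDl.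
    apply: (@le_trans _ _ (q i * (lam ^+ 3 * ((M * L + M) * (2 * (x i ^+ 2 + M ^+ 2)))))).
      rewrite ler_wpM2l//; apply: le_trans (lmin_cube z0) _.
      apply: (@le_trans _ _ ((lam * (x i + M)) ^+ 3)).
        by rewrite lerXn2r// nnegrE// mulr_ge0.
      rewrite exprMn ler_wpM2l ?exprn_ge0// exprS ler_pM// ?exprn_ge0//.
      by rewrite lerD2r.
    by rewrite le_eqVlt; apply/orP; left; apply/eqP; ring.
  apply: le_trans (_ : _ <= 4 * lam ^+ 2 * (M * kap * (n%:R^-1 * a i `^ (2 + dl)))) _; last by rewrite lerDr.
  have Mx : M <= x i by apply: le_trans (ltW xL); rewrite ler_peMr.
  have xE : x i = (n%:R * pi i)^-1 * a i by exact: enorm_dscore.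
  have aL : L < a i.
    have : M * L < M * a i.
      by apply: lt_le_trans xL _; rewrite xE ler_wpM2r ?resid_enorm_ge0.
    by rewrite ltr_pM2l// (lt_le_trans ltr01).
  apply: (@le_trans _ _ (q i * (lam ^+ 2 * (4 * x i ^+ 2)))).
    rewrite ler_wpM2l//; apply: le_trans (lmin_sqr z0) _.
    apply: (@le_trans _ _ ((lam * (x i + M)) ^+ 2)).
      by rewrite lerXn2r// nnegrE// mulr_ge0.
    rewrite exprMn ler_wpM2l ?exprn_ge0//; nra.
  have -> : q i * (lam ^+ 2 * (4 * x i ^+ 2)) = 4 * lam ^+ 2 * (q i * x i ^+ 2) by ring.
  rewrite ler_wpM2l ?mulr_ge0 ?exprn_ge0//.
  have -> : q i * x i ^+ 2 = (q i * (n%:R * pi i)^-1) * ((n%:R * pi i)^-1 * a i ^+ 2).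
    by rewrite xE; ring.
  rewrite qn [leRHS]mulrCA ler_wpM2l ?invr_ge0 ?(ltW n1)// -mulrA.
  by rewrite ler_pM ?sqr_ge0 ?invr_ge0 ?mulr_ge0 ?(ltW n1) ?(ltW (pi_gt0 i)) ?tail.
apply: (@le_trans _ _ (r%:R * (lam ^+ 3 * (M * L + M) * 2 * (M ^+ 2 + M ^+ 2) +
    4 * lam ^+ 2 * (M * kap * M)))).
  rewrite ler_wpM2l ?(ltW r1)//.
  apply: le_trans (ler_sum _ (fun i _ => main i)) _.
  rewrite big_split/= -!big_distrr/= big_split/= -big_distrl/= pi_sum1 mul1r.
  apply: lerD.
    rewrite ler_wpM2l ?lerD2r ?dscore_sqr//.
    by rewrite !mulr_ge0 ?exprn_ge0 ?addr_ge0 ?mulr_ge0.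
  rewrite ler_wpM2l ?mulr_ge0 ?exprn_ge0//.
  by rewrite ler_wpM2l// mulr_ge0.
have -> : lam / c = lam * (r%:R * lam ^+ 2) by rewrite lam_sqr.
have -> : 4 / c = 4 * (r%:R * lam ^+ 2) by rewrite lam_sqr.
by rewrite le_eqVlt; apply/orP; left; apply/eqP; ring.
Qed.

End fixed_data.

Section fixed_data_clt.
Context {R : realType} {p : nat}.

(** The conclusion is uniform over sample sizes and data: [et] depends only on the
    constants in the bounds. Outside an event of small conditional probability,
    [mean_score] is of order [1 / sqrt r] and the Hessian of the combined sample is
    close to [A], by Chebyshev's inequality, so that [estimator_perturb] puts the
    normed error within [tau] of the sum of the [nscore], to which [sampling_clt]
    applies. *)
Lemma fixed_data_clt (Sigma H : 'M[R]_p) (c dl M eps : R) (t : 'cV[R]_p) :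
  Sigma^T = Sigma -> posdefmx H -> 0 < c -> 0 < dl -> 1 <= M -> 0 < eps ->
  exists2 et : R, 0 < et &
  forall (n r0 r : nat) (W : nat -> 'cV[R]_p) (y pi : nat -> R) (I : nat -> nat),
  let bh := full_estimator Sigma n W y in
  (0 < n)%N -> (0 < r)%N -> (Num.sqrt r%:R)^-1 <= et ->
  (forall i j, `|(HW Sigma n W - H) i j| <= et) ->
  n%:R^-1 * \sum_(i < n) moment4 W y bh i <= M ->
  (forall i : 'I_n, 0 < pi i) -> \sum_(i < n) pi i = 1 ->
  (forall i : 'I_n, (n%:R * pi i)^-1 <= M) ->
  n%:R^-1 * \sum_(i < n) (`|resid W y bh i| * enorm (W i)) `^ (2 + dl) <= M ->
  (forall v, c * enorm v ^+ 2 <= quadform (score_cov Sigma n W y pi) v) ->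
  \sum_(k < r0) moment4 W y bh (I k) <= et * Num.sqrt r%:R ->
  `|Psamp (fun i : 'I_n => pi i) (fun k : {ffun 'I_r -> 'I_n} =>
      [forall j, (norming Sigma n r W y pi *m
        (comb_estimator Sigma n r0 r W y pi I (draw_index k) - bh)) j 0 <= t j 0])
    - \prod_j std_normal_cdf (t j 0)| <= eps.
Proof.
move=> Sigma_sym pH c0 dl0 M1 eps0.
have [cH cH0 Hco] := posdef_coercive_ex pH.
pose cA := cH / 2; have cA0 : 0 < cA by rewrite divr_gt0.
have M0 : 0 <= M by exact: le_trans ler01 M1.
have sc0 : 0 < Num.sqrt c by rewrite sqrtr_gt0.
have e4 : 0 < eps / 4 by rewrite divr_gt0.
have [tau tau0 clt] := sampling_clt t e4.
(* K bounds sqrt r |mean_score| up to probability eps / 8 *)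
pose K := 1 + M ^+ 2 * (8 / eps).
have M2e : 0 <= M ^+ 2 * (8 / eps).
  by rewrite mulr_ge0 ?exprn_ge0// divr_ge0// ltW.
have K1 : 1 <= K by rewrite lerDl.
have K0 : 0 < K := lt_le_trans ltr01 K1.
have KM : M ^+ 2 / K ^+ 2 <= eps / 8.
  rewrite ler_pdivrMr ?exprn_gt0//.
  have : K <= K ^+ 2 by rewrite expr2 ler_peMr// ltW.
  have : eps / 8 * (M ^+ 2 * (8 / eps)) = M ^+ 2.
    by field; rewrite gt_eqF.
  move=> E T; rewrite -[leLHS]E ler_wpM2l ?divr_ge0 ?(ltW eps0)//.
  by apply: le_trans T; rewrite lerDr.
pose kap := tau * c / (8 * M ^+ 2).
have M20 : 0 < M ^+ 2 by rewrite exprn_gt0// (lt_le_trans ltr01).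
have kap0 : 0 < kap by apply: divr_gt0; apply: mulr_gt0.
have kapE : 4 / c * (M ^+ 2 * kap) = tau / 2.
  have M_neq0 : M != 0 by rewrite gt_eqF// (lt_le_trans ltr01).
  by rewrite /kap; field; rewrite M_neq0 gt_eqF.
have [L L1 tail] := powR_tail dl0 kap0.
have L0 : 0 <= L by exact: le_trans ler01 L1.
pose C1 := (p%:R ^+ 2 * (2 + M) * (2 / cA) * (K + (1 + M + K)) + (1 + M + K))
  / Num.sqrt c.
pose C2 := p%:R ^+ 2 * (2 + M).
have [th [th0 th1 thC1 thC2]] : exists th : R,
    [/\ 0 < th, th <= 1, C1 * th <= tau & C2 * th <= cA / 2].
  have n1 := near0_mul C1 tau0.
  have n2 := near0_mul C2 (_ : 0 < cA / 2); rewrite divr_gt0// in n2.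
  near ((0 : R)^'+) => th; exists th; split; near: th.
  - exact: nbhs_right_gt.
  - exact: nbhs_right_le.
  - exact: n1.
  - exact: n2.
(* the factors by which [et] enters the Lindeberg bound and the probability that
   the Hessian deviates by more than [th] *)
pose C3 := (Num.sqrt c)^-1 / c * (M * L + M) * (4 * M ^+ 2).
pose C4 := p%:R ^+ 2 * M ^+ 2 / th ^+ 2.
have [et [et0 et1 etth ettau [etC3 etC4 etH]]] : exists et : R,
    [/\ 0 < et, et <= 1, et <= th, et <= tau &
    [/\ C3 * et <= tau / 2, C4 * et <= eps / 8 & p%:R ^+ 2 * et <= cA]].
  have n1 := near0_mul C3 (_ : 0 < tau / 2); rewrite divr_gt0// in n1.
  have n2 := near0_mul C4 (_ : 0 < eps / 8); rewrite divr_gt0// in n2.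
  have n3 := near0_mul (p%:R ^+ 2) cA0.
  near ((0 : R)^'+) => et; exists et; split; [| | | |split]; near: et.
  - exact: nbhs_right_gt.
  - exact: nbhs_right_le.
  - exact: nbhs_right_le.
  - exact: nbhs_right_le.
  - exact: n1.
  - exact: n2.
  - exact: n3.
exists et => // n r0 r W y pi I bh n0 r_gt0 rle HWH mom pi0 pi1 piM lmom Qco fst.
set A := HW Sigma n W in HWH *.
have r1 : (0 : R) < r%:R by rewrite ltr0n.
have sr0 : 0 < Num.sqrt (r%:R : R) by rewrite sqrtr_gt0.
have sr1 : 1 <= Num.sqrt (r%:R : R) by rewrite -[leLHS]sqrtr1 ler_sqrt ?ler1n.
set rho := (Num.sqrt r%:R)^-1 in rle *.
have rho0 : 0 < rho by rewrite invr_gt0.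
have rV : r%:R^-1 = rho ^+ 2 by rewrite exprVn sqr_sqrtr ?ler0n.
have A_co v : cA * enorm v ^+ 2 <= quadform A v.
  have -> : A = H + (A - H) by rewrite addrC subrK.
  rewrite quadformD; have := Hco v; have := quadform_entry v HWH.
  rewrite ler_norml => /andP[h _].
  have : p%:R ^+ 2 * et * enorm v ^+ 2 <= cA * enorm v ^+ 2.
    by rewrite ler_wpM2r// exprn_ge0// enorm_ge0.
  have : cH = cA + cA by rewrite /cA; field.
  by move=> ->; rewrite mulrDl; lra.
pose q (i : 'I_n) := pi i.
have q0 i : 0 <= q i by exact: ltW (pi0 i).
pose et_ (k : {ffun 'I_r -> 'I_n}) := mean_score Sigma W y pi k.
pose dev (k : {ffun 'I_r -> 'I_n}) := \sum_l \sum_l' hess_dev W pi k l l' ^+ 2.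
pose bad (k : {ffun 'I_r -> 'I_n}) :=
  (K ^+ 2 / r%:R <= enorm (et_ k) ^+ 2) || (th ^+ 2 <= dev k).
have th2 : 0 < th ^+ 2 by rewrite exprn_gt0.
have Pbad : Psamp q bad <= eps / 4.
  apply: le_trans (Psamp_or _ _ q0) _.
  have -> : eps / 4 = eps / 8 + eps / 8 by field.
  apply: lerD.
    have Kr : 0 < K ^+ 2 / r%:R by rewrite divr_gt0 ?exprn_gt0.
    apply: le_trans (@Psamp_markov _ _ q q0 _
      (fun k => enorm (et_ k) ^+ 2) _ Kr _) _.
      by move=> k; rewrite exprn_ge0// enorm_ge0.
    apply: le_trans KM.
    have -> : M ^+ 2 / K ^+ 2 = r%:R^-1 * M ^+ 2 / (K ^+ 2 / r%:R).
      by field; rewrite !gt_eqF.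
    rewrite ler_wpM2r ?invr_ge0 ?(ltW Kr)//.
    exact: (Esamp_mean_score Sigma_sym n0 r_gt0 cA0 A_co M1 mom pi0 pi1 piM).
  apply: le_trans (@Psamp_markov _ _ q q0 _ dev _ th2 _) _.
    by move=> k; do 2! (apply: sumr_ge0 => ? _); rewrite sqr_ge0.
  apply: le_trans etC4; rewrite ler_pdivrMr// /C4.
  rewrite [leRHS](_ : _ = p%:R ^+ 2 * M ^+ 2 * et); last first.
    by field; rewrite gt_eqF.
  rewrite Esamp_big; under eq_bigr do rewrite Esamp_big.
  apply: (@le_trans _ _ (\sum_(l < p) \sum_(l' < p) r%:R^-1 * M ^+ 2)).
    apply: ler_sum => l _; apply: ler_sum => l' _.
    exact: (Esamp_hess_dev n0 r_gt0 M1 mom pi0 pi1 piM).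
  have sc (x : R) : \sum_(i < p) x = p%:R * x.
    by rewrite sumr_const card_ord mulr_natl.
  rewrite !sc [leLHS](_ : _ = p%:R ^+ 2 * M ^+ 2 * r%:R^-1); last by ring.
  rewrite ler_wpM2l ?mulr_ge0 ?exprn_ge0// rV expr2.
  by apply: (le_trans _ rle); rewrite ler_piMl ?(ltW rho0)// (le_trans rle).
have kap_le : first_step_weight Sigma n r0 r W y I * Num.sqrt r%:R <= et.
  rewrite /first_step_weight rV -ler_pdivlMr// -/rho expr2 -mulrA [et * _]mulrC.
  by rewrite ler_pM2l// mulrC ler_pdivrMr.
have kap_ge0 : 0 <= first_step_weight Sigma n r0 r W y I.
  rewrite mulr_ge0 ?invr_ge0 ?(ltW r1)// sumr_ge0// => k _.
  by rewrite !addr_ge0// ?exprn_even_ge0.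
set ka := first_step_weight Sigma n r0 r W y I in kap_le kap_ge0.
have ka_et : ka <= et by apply: le_trans kap_le; rewrite ler_peMr.
have -> : eps = 4 * (eps / 4) by field.
apply: (clt n q (nscore Sigma r W y pi) r _ bad) => //.
- exact: (nscore_mean Sigma_sym r y cA0 A_co pi0 pi1).
- exact: (nscore_cov Sigma_sym n0 r_gt0 cA0 A_co pi0 pi1 c0 Qco).
- apply: le_trans (nscore_lindeberg Sigma_sym n0 r_gt0 cA0 A_co M1 mom pi0 pi1
    piM c0 Qco L1 (ltW kap0) tail lmom) _.
  rewrite kapE [leRHS](_ : _ = tau / 2 + tau / 2); last by field.
  rewrite lerD2r; apply: le_trans etC3; rewrite /C3 -/rho.
  rewrite mulrC [leRHS](_ : _ = (4 * M ^+ 2) * (et / Num.sqrt c / c * (M * L + M))); last by ring.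
  rewrite ler_wpM2l ?mulr_ge0 ?exprn_ge0// ler_wpM2r ?addr_ge0 ?mulr_ge0//.
  by rewrite !ler_wpM2r ?invr_ge0 ?(ltW sc0) ?(ltW c0).
- exact: le_trans rle ettau.
move=> k; rewrite negb_or -!ltNge => /andP[k1 k2] j.
have etaK : enorm (et_ k) * Num.sqrt r%:R <= K.
  rewrite -(@ler_pXn2r _ 2) ?nnegrE ?mulr_ge0 ?enorm_ge0 ?(ltW sr0) ?(ltW K0)//.
  by rewrite exprMn [Num.sqrt _%:R ^+ 2]sqr_sqrtr ?ler0n// -ler_pdivlMr// ltW.
have devth l l' : `|hess_dev W pi k l l'| <= th.
  rewrite -(@ler_pXn2r _ 2) ?nnegrE ?(ltW th0)// real_normK ?num_real//.
  apply: le_trans (ltW k2); rewrite /dev (bigD1 l)//= (bigD1 l')//= -addrA lerDl.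
  by rewrite addr_ge0// sumr_ge0// => *; rewrite ?sumr_ge0// => *; rewrite sqr_ge0.
have small : p%:R ^+ 2 * (ka * (1 + M) + th) <= cA / 2.
  apply: le_trans thC2; rewrite /C2 -mulrA ler_wpM2l ?exprn_ge0//.
  have : ka * (1 + M) <= th * (1 + M).
    by rewrite ler_wpM2r ?addr_ge0// (le_trans ka_et).
  by lra.
have -> : (norming Sigma n r W y pi *m (comb_estimator Sigma n r0 r W y pi I
   (draw_index k) - bh)) j 0 - (\sum_i nscore Sigma r W y pi (k i)) j 0 =
  (norming Sigma n r W y pi *m (comb_estimator Sigma n r0 r W y pi I
   (draw_index k) - bh) - \sum_i nscore Sigma r W y pi (k i)) j 0.
  by rewrite [RHS]mxE [X in _ = _ + X]mxE.
apply: le_trans (entry_le_enorm _ _) _.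
apply: le_trans (estimator_norm_perturb Sigma_sym r0 I r_gt0 cA0 A_co c0 Qco k) _.
have T := estimator_perturb Sigma_sym n0 r_gt0 cA0 A_co M1 mom (ltW th0) devth small.
rewrite sqrtrM ?(ltW r1)// sqrtrV ?(ltW c0)//.
apply: (@le_trans _ _ (C1 * th)) => //.
rewrite /C1 [leLHS]mulrAC [leRHS]mulrAC.
rewrite ler_wpM2r ?invr_ge0 ?(ltW sc0)//.
apply: le_trans (ler_wpM2l (ltW sr0) T) _.
rewrite -/ka -/(et_ k); have et_0 := enorm_ge0 (et_ k).
set x := enorm (et_ k) in etaK et_0 *; set sr := Num.sqrt r%:R in sr0 sr1 kap_le etaK *.
have xK : x <= K by apply: le_trans etaK; rewrite ler_peMr.
have MK0 : 0 <= 1 + M + K by rewrite !addr_ge0// ltW.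
set Y := ka * (1 + M + x).
have Y1 : sr * Y <= th * (1 + M + K).
  rewrite /Y mulrA; apply: ler_pM.
  - by rewrite mulr_ge0// ltW.
  - by rewrite !addr_ge0.
  - by rewrite mulrC (le_trans kap_le).
  - by rewrite lerD2l.
have Y2 : sr * (x + Y) <= K + (1 + M + K).
  rewrite mulrDr [sr * x]mulrC; apply: lerD => //.
  by apply: (le_trans Y1); rewrite ler_piMl.
have G1 : ka * (1 + M) + th <= th * (2 + M).
  have : ka * (1 + M) <= th * (1 + M).
    by rewrite ler_wpM2r ?addr_ge0// (le_trans ka_et).
  by move=> G; rewrite (_ : th * (2 + M) = th * (1 + M) + th) ?lerD2r//; ring.
have Y0 : 0 <= Y by rewrite mulr_ge0// !addr_ge0.
have c20 : 0 <= 2 / cA by rewrite divr_ge0// ltW.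
rewrite [leLHS]mulrDr [leRHS]mulrDl; apply: lerD; last by rewrite [leRHS]mulrC.
rewrite [leLHS](_ : _ = p%:R ^+ 2 * (2 / cA) *
  ((ka * (1 + M) + th) * (sr * (x + Y)))); last by ring.
rewrite [leRHS](_ : _ = p%:R ^+ 2 * (2 / cA) *
  (th * (2 + M) * (K + (1 + M + K)))); last by ring.
have B0 : 0 <= p%:R ^+ 2 * (2 / cA) by apply: mulr_ge0 => //; rewrite exprn_ge0.
apply: ler_wpM2l => //; apply: ler_pM => //.
  by rewrite addr_ge0 ?(ltW th0)// mulr_ge0// addr_ge0.
by rewrite mulr_ge0 ?(ltW sr0)// addr_ge0.
Unshelve. all: by end_near. Qed.

End fixed_data_clt.

(** * Measurability of the estimators *)

Section measurability.
Context {d : measure_display} {T : measurableType d} {R : realType}.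

Lemma measurable_fun_invr (f : T -> R) : measurable_fun setT f ->
  measurable_fun setT (fun w => (f w)^-1).
Proof.
move=> mf; have -> : (fun w => (f w)^-1) = (fun w => f w * (f w ^+ 2) `^ (-1)).
  apply/funext => w; rewrite powR_inv1 ?sqr_ge0//.
  have [->|fw0] := eqVneq (f w) 0; first by rewrite invr0 mul0r.
  by field.
apply: measurable_funM => //.
apply: (@measurableT_comp _ _ _ _ _ _ (fun x : R => x `^ (-1))).
  exact: measurable_powR.
exact: measurable_funX.
Qed.

Lemma measurable_fun_sqrt (f : T -> R) : measurable_fun setT f ->
  measurable_fun setT (fun w => Num.sqrt (f w)).
Proof.
move=> mf; apply: (@measurableT_comp _ _ _ _ _ _ (fun x : R => Num.sqrt x)) => //.
by apply: continuous_measurable_fun; exact: sqrt_continuous.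
Qed.

Lemma measurable_bool_set (f : T -> bool) : measurable_fun setT f ->
  measurable [set w | f w].
Proof. by move=> /(_ measurableT [set true]); rewrite setTI; apply. Qed.

Lemma measurable_set_bool (f : T -> bool) : measurable [set w | f w] ->
  measurable_fun setT f.
Proof.
by move=> mf; apply: (measurable_fun_bool true); rewrite setTI.
Qed.

Lemma measurable_le_set (f g : T -> R) : measurable_fun setT f ->
  measurable_fun setT g -> measurable [set w | f w <= g w].
Proof.
by move=> mf mg; apply: measurable_bool_set; exact: measurable_fun_ler.
Qed.

Lemma measurable_lt_set (f g : T -> R) : measurable_fun setT f ->
  measurable_fun setT g -> measurable [set w | f w < g w].
Proof.
by move=> mf mg; apply: measurable_bool_set; exact: measurable_fun_ltr.
Qed.

(** Data are read at random indices throughout the sampling scheme. *)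
Lemma measurable_fun_index (F : nat -> T -> R) (N : T -> nat) :
  (forall i, measurable_fun setT (F i)) -> measurable_fun setT N ->
  measurable_fun setT (fun w => F (N w) w).
Proof.
move=> mF mN _ B mB; rewrite setTI.
have -> : (fun w => F (N w) w) @^-1` B =
    \bigcup_i (N @^-1` [set i] `&` F i @^-1` B).
  apply/seteqP; split => [w /= Bw|w [i _ /= [-> ]]]//.
  by exists (N w).
apply: bigcupT_measurable => i; apply: measurableI; rewrite -[_ @^-1` _]setTI.
  exact: mN.
exact: mF.
Qed.

Definition mmx m k (Z : T -> 'M[R]_(m, k)) : Prop :=
  forall i j, measurable_fun setT (fun w => Z w i j).

Lemma mmx_cst m k (A : 'M[R]_(m, k)) : mmx (fun=> A).
Proof. by move=> i j; exact: measurable_cst. Qed.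

Lemma mmxD m k (Y Z : T -> 'M[R]_(m, k)) : mmx Y -> mmx Z ->
  mmx (fun w => Y w + Z w).
Proof.
move=> mY mZ i j; under eq_fun do rewrite mxE.
exact: measurable_funD.
Qed.

Lemma mmxZ m k (f : T -> R) (Z : T -> 'M[R]_(m, k)) : measurable_fun setT f ->
  mmx Z -> mmx (fun w => f w *: Z w).
Proof.
move=> mf mZ i j; under eq_fun do rewrite mxE.
exact: measurable_funM.
Qed.

Lemma mmxN m k (Z : T -> 'M[R]_(m, k)) : mmx Z -> mmx (fun w => - Z w).
Proof.
move=> mZ; under eq_fun do rewrite -scaleN1r.
by apply: mmxZ => //; exact: measurable_cst.
Qed.

Lemma mmxB m k (Y Z : T -> 'M[R]_(m, k)) : mmx Y -> mmx Z ->
  mmx (fun w => Y w - Z w).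
Proof. by move=> mY mZ; apply: mmxD => //; exact: mmxN. Qed.

Lemma mmxM m k l (Y : T -> 'M[R]_(m, k)) (Z : T -> 'M[R]_(k, l)) :
  mmx Y -> mmx Z -> mmx (fun w => Y w *m Z w).
Proof.
move=> mY mZ i j; under eq_fun do rewrite mxE.
by apply: measurable_sum => u; exact: measurable_funM.
Qed.

Lemma mmx_tr m k (Z : T -> 'M[R]_(m, k)) : mmx Z -> mmx (fun w => (Z w)^T).
Proof. by move=> mZ i j; under eq_fun do rewrite mxE; exact: mZ. Qed.

Lemma mmx_sum m k (I : Type) (s : seq I) (Z : I -> T -> 'M[R]_(m, k)) :
  (forall i, mmx (Z i)) -> mmx (fun w => \sum_(i <- s) Z i w).
Proof.
move=> mZ i j; under eq_fun do rewrite summxE.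
by apply: measurable_sum => u; exact: mZ.
Qed.

Lemma measurable_det m (Z : T -> 'M[R]_m) : mmx Z ->
  measurable_fun setT (fun w => \det (Z w)).
Proof.
move=> mZ; apply: measurable_sum => s.
apply: measurable_funM; first exact: measurable_cst.
by apply: measurable_prod => i _; exact: mZ.
Qed.

Lemma mmx_invmx m (Z : T -> 'M[R]_m) : mmx Z -> mmx (fun w => invmx (Z w)).
Proof.
move=> mZ i j.
have -> : (fun w => invmx (Z w) i j) = (fun w => if \det (Z w) == 0 then Z w i j
    else (\det (Z w))^-1 * \adj (Z w) i j).
  apply/funext => w; rewrite /invmx unitmxE unitfE.
  by case: eqVneq => //= _; rewrite mxE.
apply: measurable_fun_ifT.
- by apply: measurable_fun_eqr; [exact: measurable_det|exact: measurable_cst].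
- exact: mZ.
- apply: measurable_funM; first by apply: measurable_fun_invr; exact: measurable_det.
  under eq_fun do rewrite mxE /cofactor.
  apply: measurable_funM; first exact: measurable_cst.
  apply: measurable_det => u v; under eq_fun do rewrite !mxE.
  exact: mZ.
Qed.

Variable p : nat.

Lemma measurable_dotv (X Y : T -> 'cV[R]_p) : mmx X -> mmx Y ->
  measurable_fun setT (fun w => dotv (X w) (Y w)).
Proof. by move=> mX mY; apply: mmxM => //; exact: mmx_tr. Qed.

Lemma measurable_enorm (X : T -> 'cV[R]_p) : mmx X ->
  measurable_fun setT (fun w => enorm (X w)).
Proof. by move=> mX; apply: measurable_fun_sqrt; exact: measurable_dotv. Qed.

Lemma measurable_quadform (A : T -> 'M[R]_p) (X : T -> 'cV[R]_p) :
  mmx A -> mmx X -> measurable_fun setT (fun w => quadform (A w) (X w)).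
Proof. by move=> mA mX; apply: mmxM => //; apply: mmxM => //; exact: mmx_tr. Qed.

(** By density of the rationals; it reduces the uncountably many conditions that
    define positive definiteness to countably many. *)
Lemma quadform_rational (A : 'M[R]_p) :
  (forall u : 'cV[rat]_p, 0 <= quadform A (map_mx ratr u)) ->
  forall v, 0 <= quadform A v.
Proof.
move=> Au v.
pose u (m : nat) : 'cV[rat]_p :=
  \col_j ((Num.floor (v j 0 * m.+1%:R))%:~R / m.+1%:R).
have cu j : ratr (u m j 0) @[m --> \oo] --> v j 0.
  have h1 m : v j 0 - m.+1%:R^-1 <= ratr (u m j 0) <= v j 0.
    rewrite mxE rmorphM/= fmorphV/= ratr_int ratr_nat.
    have m0 : (0 : R) < m.+1%:R by rewrite ltr0n.
    rewrite ler_pdivrMr// floor_le andbT ler_pdivlMr// mulrBl mulVf ?gt_eqF//.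
    by rewrite lerBlDr -intrD1 ltW// floorD1_gt.
  apply: (@squeeze_cvgr _ _ _ _ (fun m => v j 0 - m.+1%:R^-1) (fun=> v j 0)).
  - by near=> m; exact: h1.
  - rewrite -[X in _ --> X]subr0; apply: cvgB; first exact: cvg_cst.
    exact: cvg_harmonic.
  - exact: cvg_cst.
have cq : quadform A (map_mx ratr (u m)) @[m --> \oo] --> quadform A v.
  under eq_fun do rewrite quadform_sum.
  rewrite quadform_sum; apply: cvg_sumr => i; apply: cvg_sumr => j.
  apply: cvgMr; have E m l : (map_mx ratr (u m) : 'cV[R]_p) l 0 = ratr (u m l 0).
    by rewrite mxE.
  by under eq_fun do rewrite !E; exact: (cvgM (cu i) (cu j)).
by apply: (cvgr_to_ge cq); near=> m; exact: Au.
Unshelve. all: by end_near. Qed.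

Lemma measurable_coercive (A : T -> 'M[R]_p) (c : T -> R) : mmx A ->
  measurable_fun setT c ->
  measurable [set w | forall v, c w * enorm v ^+ 2 <= quadform (A w) v].
Proof.
move=> mA mc.
have -> : [set w | forall v, c w * enorm v ^+ 2 <= quadform (A w) v] =
    ~` \bigcup_(u : 'cV[rat]_p)
      [set w | quadform (A w) (map_mx ratr u) < c w * enorm (map_mx ratr u) ^+ 2].
  apply/seteqP; split => w /=.
    by move=> h [u _] /=; rewrite ltNge h.
  move=> h v; rewrite -subr_ge0 -quadform1 -quadformZ -quadformB.
  apply: quadform_rational => u; rewrite quadformB quadformZ quadform1 subr_ge0.
  by rewrite leNgt; apply/negP => hu; apply: h; exists u.
apply: measurableC; apply: countable_bigcupT_measurable.
  exact: countableP.
move=> u; apply: measurable_lt_set.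
  by apply: measurable_quadform => //; exact: mmx_cst.
by apply: measurable_funM => //; exact: measurable_cst.
Qed.

(** Positive definite means coercive with a constant [1 / k.+1] for some [k]. *)
Lemma measurable_posdef (A : T -> 'M[R]_p) : mmx A ->
  measurable [set w | posdefmx (A w)].
Proof.
move=> mA.
have -> : [set w | posdefmx (A w)] =
   [set w | (A w)^T = A w] `&` \bigcup_(k : nat)
     [set w | forall v, k.+1%:R^-1 * enorm v ^+ 2 <= quadform (A w) v].
  apply/seteqP; split => w /=.
    move=> pA; split; first by have [] := pA.
    have [c c0 Ac] := posdef_coercive_ex pA.
    have [k kc] : exists k : nat, k.+1%:R^-1 < c.
      exists (Num.truncn c^-1); rewrite invf_plt ?posrE ?ltr0n//.
      exact: truncnS_gt.
    exists k => // v; apply: le_trans (Ac v); rewrite ler_wpM2r ?exprn_ge0 ?enorm_ge0//.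
    exact: ltW.
  move=> [As [k _ Ak]]; apply: (@coercive_posdef _ _ _ k.+1%:R^-1).
  by rewrite invr_gt0 ltr0n.
  exact: As.
  exact: Ak.
apply: measurableI; last first.
  apply: bigcupT_measurable => k.
  exact: (@measurable_coercive A (fun=> k.+1%:R^-1) mA (measurable_cst _)).
have -> : [set w | (A w)^T = A w] =
    \bigcap_(ij : 'I_p * 'I_p) [set w | A w ij.1 ij.2 == A w ij.2 ij.1].
  apply/seteqP; split => w /=.
    by move=> As [i j] _ /=; rewrite -{1}As mxE.
  by move=> As; apply/matrixP => i j; rewrite mxE; apply/eqP; exact: (As (j, i)).
apply: fin_bigcap_measurable; first exact: finite_finset.
move=> ij _; apply: measurable_bool_set; apply: measurable_fun_eqr; exact: mA.
Qed.

End measurability.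

Section estimators_measurability.
Context {d : measure_display} {T : measurableType d} {R : realType} {p : nat}.

Lemma measurable_normr (f : T -> R) : measurable_fun setT f ->
  measurable_fun setT (fun w => `|f w|).
Proof. by move=> mf; apply: measurableT_comp => //; exact: normr_measurable. Qed.

Lemma mmx_if_posdef m k (V : T -> 'M[R]_p) (Z : T -> 'M[R]_(m, k)) :
  mmx V -> mmx Z -> mmx (fun w => if `[< posdefmx (V w) >] then Z w else 0).
Proof.
move=> mV mZ i j.
have -> : (fun w => (if `[< posdefmx (V w) >] then Z w else 0) i j) =
    (fun w => if `[< posdefmx (V w) >] then Z w i j else 0).
  by apply/funext => w; case: ifP => // _; rewrite mxE.
apply: measurable_fun_ifT; [|exact: mZ|exact: measurable_cst].
apply: measurable_set_bool.
have -> : [set w | `[< posdefmx (V w) >]] = [set w | posdefmx (V w)].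
  by apply/seteqP; split => w /= /asboolP.
exact: measurable_posdef.
Qed.

Lemma mmx_solvemx (A : T -> 'M[R]_p) (g : T -> 'cV[R]_p) : mmx A -> mmx g ->
  mmx (fun w => solvemx (A w) (g w)).
Proof.
move=> mA mg; apply: mmx_if_posdef => //.
by apply: mmxM => //; exact: mmx_invmx.
Qed.

Lemma mmx_sqrt_approx (B : T -> 'M[R]_p) n : mmx B ->
  mmx (fun w => sqrt_approx (B w) n).
Proof.
move=> mB; have ms : measurable_fun setT (fun w => sqrt_scale (B w)).
  apply: measurable_funD; first exact: measurable_cst.
  apply: measurable_sum => i; apply: measurable_sum => j.
  exact: measurable_normr.
apply: mmxZ; first exact: measurable_fun_sqrt.
apply: mmxB; first exact: mmx_cst.
elim: n => [|n IH]; first exact: mmx_cst.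
apply: mmxZ; first exact: measurable_cst.
apply: mmxD; last exact: mmxM.
apply: mmxB; first exact: mmx_cst.
by apply: mmxZ => //; exact: measurable_fun_invr.
Qed.

Lemma mmx_invsqrtmx (V : T -> 'M[R]_p) : mmx V -> mmx (fun w => invsqrtmx (V w)).
Proof.
move=> mV i j.
pose f n w := (if `[< posdefmx (V w) >] then sqrt_approx (invmx (V w)) n else 0) i j.
apply: (@measurable_fun_cvg _ _ _ setT f).
  move=> n; apply: mmx_if_posdef => //.
  by apply: mmx_sqrt_approx; exact: mmx_invmx.
move=> w _; rewrite /f; case: asboolP => pV.
  by have [_ _] := invsqrtmxP pV; exact.
by rewrite invsqrtmx_out//; exact: cvg_cst.
Qed.

Variable Sigma : 'M[R]_p.
Hypothesis Sigma_sym : Sigma^T = Sigma.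

Lemma mmx_whess n s (W : nat -> T -> 'cV[R]_p) (v : nat -> T -> R) :
  (forall k, mmx (W k)) -> (forall k, measurable_fun setT (v k)) ->
  mmx (fun w => whess Sigma n s (W ^~ w) (v ^~ w)).
Proof.
move=> mW mv; apply: mmxB; last exact: mmx_cst.
apply: mmxZ; first exact: measurable_cst.
apply: mmx_sum => k; apply: mmxZ => //.
by apply: mmxM => //; exact: mmx_tr.
Qed.

(** The minimizer has a closed form, and the default value is taken on the
    measurable event where the Hessian is not positive definite. *)
Lemma mmx_argmin_wloss n s (W : nat -> T -> 'cV[R]_p) (y v : nat -> T -> R) :
  (forall k, mmx (W k)) -> (forall k, measurable_fun setT (y k)) ->
  (forall k, measurable_fun setT (v k)) ->
  mmx (fun w => argmin (wloss Sigma n s (W ^~ w) (y ^~ w) (v ^~ w))).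
Proof.
move=> mW my mv; under eq_fun do rewrite argmin_wloss//.
apply: mmx_solvemx; first exact: mmx_whess.
apply: mmxZ; first exact: measurable_cst.
by apply: mmx_sum => k; apply: mmxZ => //; exact: measurable_funM.
Qed.

Variables (W : nat -> T -> 'cV[R]_p) (y : nat -> T -> R).
Hypothesis mW : forall i, mmx (W i).
Hypothesis my : forall i, measurable_fun setT (y i).

Lemma mmx_full_estimator n :
  mmx (fun w => full_estimator Sigma n (W ^~ w) (y ^~ w)).
Proof.
under eq_fun do rewrite full_estimatorE.
by apply: mmx_argmin_wloss => // k; exact: measurable_cst.
Qed.

Lemma mmx_HW n : mmx (fun w => HW Sigma n (W ^~ w)).
Proof.
under eq_fun do rewrite HWE.
by apply: mmx_whess => // k; exact: measurable_cst.
Qed.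

Lemma measurable_resid (b : T -> 'cV[R]_p) i : mmx b ->
  measurable_fun setT (fun w => resid (W ^~ w) (y ^~ w) (b w) i).
Proof.
by move=> mb; apply: measurable_funB => //; exact: measurable_dotv.
Qed.

Lemma measurable_moment4 (b : T -> 'cV[R]_p) i : mmx b ->
  measurable_fun setT (fun w => moment4 (W ^~ w) (y ^~ w) (b w) i).
Proof.
move=> mb; apply: measurable_funD.
  apply: measurable_funD; first exact: measurable_cst.
  by apply: measurable_funX; exact: measurable_enorm.
by apply: measurable_funX; exact: measurable_resid.
Qed.

Lemma mmx_index (N : T -> nat) : measurable_fun setT N ->
  mmx (fun w => W (N w) w).
Proof.
move=> mN i j; apply: (measurable_fun_index (F := fun k w => W k w i j)) => // k.
exact: mW.
Qed.

Variables (c : criterion) (n r0 r : nat) (I J : T -> nat -> nat).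
Hypothesis mI : forall k, measurable_fun setT (I ^~ k).
Hypothesis mJ : forall k, measurable_fun setT (J ^~ k).

Lemma mmx_pilot : mmx (fun w => pilot Sigma n r0 (W ^~ w) (y ^~ w) (I w)).
Proof.
apply: (@mmx_argmin_wloss n r0 (fun k w => W (I w k) w) (fun k w => y (I w k) w)
  (fun=> fun=> (r0%:R * n%:R^-1)^-1)).
- by move=> k; exact: mmx_index.
- by move=> k; exact: measurable_fun_index.
- by move=> k; exact: measurable_cst.
Qed.

Lemma measurable_pilot_subprob i : measurable_fun setT
  (fun w => pilot_subprob Sigma c n r0 (W ^~ w) (y ^~ w) (I w) i).
Proof.
have mp := mmx_pilot.
have mw k : measurable_fun setT (fun w => prob_weight Sigma c n (W ^~ w) (y ^~ w)
    (pilot Sigma n r0 (W ^~ w) (y ^~ w) (I w)) k).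
  apply: measurable_funM; first by apply: measurable_normr; exact: measurable_resid.
  case: c; apply: measurable_enorm => //.
  by apply: mmxM => //; apply: mmx_invmx; exact: mmx_HW.
apply: measurable_funM => //; apply: measurable_fun_invr.
by apply: measurable_sum => k; exact: mw.
Qed.

Lemma mmx_two_step_estimator : mmx (fun w =>
  two_step_estimator Sigma c n r0 r (W ^~ w) (y ^~ w) (I w) (J w)).
Proof.
pose K k w := if (k < r0)%N then I w k else J w (k - r0)%N.
pose pis k w := if (k < r0)%N then n%:R^-1
  else pilot_subprob Sigma c n r0 (W ^~ w) (y ^~ w) (I w) (J w (k - r0)%N).
have mK k : measurable_fun setT (K k) by rewrite /K; case: (k < r0)%N.
apply: (@mmx_argmin_wloss n (r0 + r)%N (fun k w => W (K k w) w)
  (fun k w => y (K k w) w) (fun k w => ((r0 + r)%:R * pis k w)^-1)).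
- by move=> k; exact: mmx_index.
- by move=> k; exact: measurable_fun_index.
- move=> k; apply: measurable_fun_invr; apply: measurable_funM.
    exact: measurable_cst.
  rewrite /pis; case: (k < r0)%N; first exact: measurable_cst.
  apply: (measurable_fun_index (F := fun i w =>
    pilot_subprob Sigma c n r0 (W ^~ w) (y ^~ w) (I w) i)) => // i.
  exact: measurable_pilot_subprob.
Qed.

Lemma mmx_Vc_mx : mmx (fun w => Vc_mx Sigma c n r0 r (W ^~ w) (y ^~ w) (I w)).
Proof.
have mb := mmx_full_estimator n.
apply: mmxB.
  apply: mmxZ; first exact: measurable_cst.
  apply: mmx_sum => i; apply: mmxZ.
    apply: measurable_funM.
      by apply: measurable_funX; exact: measurable_resid.
    by apply: measurable_fun_invr; exact: measurable_pilot_subprob.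
  by apply: mmxM => //; exact: mmx_tr.
apply: mmxZ; first exact: measurable_cst.
have mS : mmx (fun w => Sigma *m full_estimator Sigma n (W ^~ w) (y ^~ w)).
  by apply: mmxM => //; exact: mmx_cst.
by apply: mmxM => //; exact: mmx_tr.
Qed.

Lemma mmx_standardized_error : mmx (fun w =>
  standardized_error Sigma c n r0 r (W ^~ w) (y ^~ w) (I w) (J w)).
Proof.
have mH : mmx (fun w => invmx (HW Sigma n (W ^~ w))).
  by apply: mmx_invmx; exact: mmx_HW.
apply: mmxM.
  apply: mmx_invsqrtmx; apply: mmxM => //; apply: mmxM => //.
  exact: mmx_Vc_mx.
by apply: mmxB; [exact: mmx_two_step_estimator|exact: mmx_full_estimator].
Qed.

Lemma measurable_error_event (t : 'cV[R]_p) : measurable [set w | forall j,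
  standardized_error Sigma c n r0 r (W ^~ w) (y ^~ w) (I w) (J w) j 0 <= t j 0].
Proof.
rewrite [X in measurable X](_ : _ = \bigcap_(j : 'I_p) [set w |
  standardized_error Sigma c n r0 r (W ^~ w) (y ^~ w) (I w) (J w) j 0 <= t j 0]).
  apply: fin_bigcap_measurable; first exact: finite_finset.
  move=> j _; apply: measurable_le_set; last exact: measurable_cst.
  exact: mmx_standardized_error.
by apply/seteqP; split => w /= h j; [move=> _|]; exact: h.
Qed.

End estimators_measurability.

(** * Conditioning on the data and on the first step *)

Section draws.
Context {d : measure_display} {T : measurableType d} {R : realType}.
Variable P : probability T R.

Lemma sigma_gen_sub (I : Type) (f : I -> T -> R) :
  (forall i, measurable_fun setT (f i)) -> sigma_gen f `<=` measurable.
Proof.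
move=> mf; apply: smallest_sub; first exact: sigma_algebra_measurable.
move=> A [i _ [B mB <-]]; exact: mf.
Qed.

Definition draw_event n s (K : T -> nat -> nat) (k : {ffun 'I_s -> 'I_n}) : set T :=
  [set w | forall j : 'I_s, K w j = k j].

Lemma measurable_draw_event n s K (k : {ffun 'I_s -> 'I_n}) :
  (forall j, measurable_fun setT (K ^~ j)) -> measurable (draw_event K k).
Proof.
move=> mK; have -> : draw_event K k =
    \bigcap_(j : 'I_s) (K ^~ j) @^-1` [set (k j : nat)].
  by apply/seteqP; split => w /= h j; [move=> _|]; exact: h.
apply: fin_bigcap_measurable; first exact: finite_finset.
by move=> j _; rewrite -[_ @^-1` _]setTI; exact: mK.
Qed.

Lemma draw_event_inj n s K w (k k' : {ffun 'I_s -> 'I_n}) :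
  draw_event K k w -> draw_event K k' w -> k = k'.
Proof. by move=> h h'; apply/ffunP => j; apply/val_inj; rewrite /= -h -h'. Qed.

Lemma measure_draws n s K (D : set T) (mK : forall j, measurable_fun setT (K ^~ j))
    (mD : measurable D) (l : seq {ffun 'I_s -> 'I_n}) : uniq l ->
  P (D `&` [set w | exists2 k, k \in l & draw_event K k w]) =
  (\sum_(k <- l) P (D `&` draw_event K k))%E.
Proof.
elim: l => [|k l IH]/=.
  move=> _; rewrite big_nil (_ : _ `&` _ = set0) ?measure0//.
  by apply/seteqP; split => w// [_ []].
move=> /andP[kl ul]; rewrite big_cons -IH//.
have mE : measurable [set w | exists2 k', k' \in l & draw_event K k' w].
  have -> : [set w | exists2 k', k' \in l & draw_event K k' w] =
     \bigcup_(k' in [set` l]) draw_event K k'.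
    by apply/seteqP; split => w [k' h1 h2]; exists k'.
  apply: fin_bigcup_measurable; first exact: finite_seq.
  by move=> k' _; exact: measurable_draw_event.
rewrite -measureU; [|by apply: measurableI => //; exact: measurable_draw_event
  |exact: measurableI|].
- congr (P _); rewrite -setIUr; congr (_ `&` _); apply/seteqP; split => w /=.
    move=> [k']; rewrite inE => /orP[/eqP ->|k'l]; first by left.
    by right; exists k'.
  by move=> [kw|[k' k'l k'w]]; [exists k|exists k']; rewrite ?inE ?eqxx ?k'l ?orbT.
- apply/seteqP; split => w// [[_ kw] [_ [k' k'l k'w]]].
  by rewrite (draw_event_inj kw k'w) k'l in kl.
Qed.

Variables (F : set (set T)) (n s : nat) (q : T -> nat -> R) (K : T -> nat -> nat).
Hypothesis F_sigma : sigma_algebra setT F.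
Hypothesis F_sub : F `<=` measurable.
Hypothesis mK : forall j, measurable_fun setT (K ^~ j).
Hypothesis mq : forall i, measurable_fun setT (fun w => q w i).
Hypothesis draws : draws_given P F n s q K.

Lemma sigma_algebra_setI A B : F A -> F B -> F (A `&` B).
Proof.
move=> FA FB; have [F0 FC FU] := F_sigma.
have -> : A `&` B = setT `\` (setT `\` A `|` setT `\` B).
  by rewrite !setTD setCU !setCK.
apply: (FC); rewrite -bigcup2E; apply: FU => -[|[|i]] //=; exact: FC.
Qed.

(** The draws take finitely many values, so that [E] splits along them, and on each
    piece [E] agrees with the [F]-measurable event [B k], to which the assumption on
    the draws applies. In other words, given [F] the draws are averaged with what is
    [F]-measurable held constant. *)
Lemma draws_cond_prob A (E : set T) (B : {ffun 'I_s -> 'I_n} -> set T) :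
  F A ->
  (forall w, A w -> (forall i : 'I_n, 0 <= q w i) /\ \sum_(i < n) q w i = 1) ->
  measurable E -> (forall k, F (B k)) ->
  (forall k w, A w -> draw_event K k w -> E w <-> B k w) ->
  P (A `&` E) =
  (\int[P]_(w in A)
     (Psamp (fun i : 'I_n => q w i) (fun k => `[< B k w >]))%:E)%E.
Proof.
move=> FA Aq mE FB EB; have mA := F_sub FA.
pose S := [set w | exists2 k : {ffun 'I_s -> 'I_n},
   k \in index_enum {ffun 'I_s -> 'I_n} & draw_event K k w].
have mprod (k : {ffun 'I_s -> 'I_n}) :
    measurable_fun setT (fun w => (\prod_j q w (k j))%:E).
  by apply/measurable_EFinP; apply: measurable_prod => j _; exact: mq.
have split_draws D : measurable D ->
    P (D `&` S) = (\sum_(k : {ffun 'I_s -> 'I_n}) P (D `&` draw_event K k))%E.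
  by move=> mD; apply: measure_draws => //; exact: index_enum_uniq.
have prod0 (k : {ffun 'I_s -> 'I_n}) w : A w -> (0 <= (\prod_j q w (k j))%:E)%E.
  by move=> /Aq[q0 _]; rewrite lee_fin prodr_ge0.
have mS : measurable S.
  have -> : S = \bigcup_(k in [set` index_enum {ffun 'I_s -> 'I_n}]) draw_event K k.
    by apply/seteqP; split => w [k' h1 h2]; exists k'.
  apply: fin_bigcup_measurable; first exact: finite_seq.
  by move=> k' _; exact: measurable_draw_event.
(* the events on which the draws take given values exhaust [A], since their
   probabilities add up to that of [A] *)
have AS : P (A `&` S) = P A.
  rewrite split_draws//.
  under eq_bigr do rewrite draws//.
  rewrite -ge0_integral_sum//; last first.
    by move=> k; apply: measurable_funS (mprod k).
  rewrite -[RHS]mul1e -integral_cst//; apply: eq_integral => w.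
  rewrite inE => Aw; have [q0 q1] := Aq w Aw.
  rewrite sumEFin /=; congr EFin.
  apply: etrans (@Esamp_cst _ _ (fun i : 'I_n => q w i) q1 s 1).
  by apply: eq_bigr => k _; rewrite mulr1.
have mAS : measurable (A `\` S) by exact: measurableD.
have ASC : P (A `\` S) = 0%E.
  have h : (P A = P (A `\` S) + P (A `&` S))%E by exact: measureDI.
  rewrite AS in h; have fA : P A \is a fin_num by exact: fin_num_measure.
  by rewrite -[LHS](addeK _ fA) -h subee.
have -> : P (A `&` E) = P (A `&` E `&` S).
  have mAE : measurable (A `&` E) by exact: measurableI.
  have h : (P (A `&` E) = P (A `&` E `\` S) + P (A `&` E `&` S))%E.
    exact: measureDI.
  rewrite h (_ : P (A `&` E `\` S) = 0%E) ?add0e//.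
  apply: subset_measure0 ASC => //; first exact: measurableD.
  by move=> w [[]].
rewrite split_draws; last exact: measurableI.
have -> : (\sum_(k : {ffun 'I_s -> 'I_n}) P (A `&` E `&` draw_event K k) =
    \sum_(k : {ffun 'I_s -> 'I_n})
      \int[P]_(w in A) ((\prod_j q w (k j)) * `[< B k w >]%:R)%:E)%E.
  apply: eq_bigr => k _.
  have -> : A `&` E `&` draw_event K k = (A `&` B k) `&` draw_event K k.
    apply/seteqP; split => w [[Aw h] kw]; (split; [split|]) => //.
      by apply/(EB k w Aw kw).
    by apply/(EB k w Aw kw).
  rewrite draws; [|exact: sigma_algebra_setI|by move=> w [/Aq]].
  rewrite integral_mkcondr; apply: eq_integral => w _.
  rewrite patchE; case: asboolP => Bw; first by rewrite mem_set// mulr1.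
  by rewrite memNset// mulr0.
rewrite -ge0_integral_sum//.
- by apply: eq_integral => w _; rewrite sumEFin.
- move=> k; apply/measurable_EFinP; apply: measurable_funM.
    by apply: measurable_prod => j _; exact: measurable_funTS.
  have mB := F_sub (FB k).
  apply: measurable_funTS.
  have -> : (fun w => `[< B k w >]%:R : R) = \1_(B k).
    by apply/funext => w; rewrite indicE.
  exact: measurable_indic.
- by move=> k w Aw; rewrite lee_fin mulr_ge0//; have := prod0 k w Aw; rewrite lee_fin.
Qed.

(** Integrates bounds on the average over the draws that hold throughout [A]. *)
Lemma draws_bounds A (E : set T) (B : {ffun 'I_s -> 'I_n} -> set T) (lo hi : R) :
  F A ->
  (forall w, A w -> (forall i : 'I_n, 0 <= q w i) /\ \sum_(i < n) q w i = 1) ->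
  measurable E -> (forall k, F (B k)) ->
  (forall k w, A w -> draw_event K k w -> E w <-> B k w) ->
  0 <= lo ->
  (forall w, A w ->
     lo <= Psamp (fun i : 'I_n => q w i) (fun k => `[< B k w >]) <= hi) ->
  (lo%:E * P A <= P (A `&` E))%E /\ (P (A `&` E) <= hi%:E * P A)%E.
Proof.
move=> FA Aq mE FB EB lo0 lohi; have mA := F_sub FA.
rewrite (draws_cond_prob FA Aq mE FB EB) -!integral_cst//.
have mx : measurable_fun A (fun w =>
    (Psamp (fun i : 'I_n => q w i) (fun k => `[< B k w >]))%:E).
  apply/measurable_EFinP; apply: measurable_funTS.
  apply: measurable_sum => k; apply: measurable_funM.
    by apply: measurable_prod => j _; exact: mq.
  have -> : (fun w => `[< B k w >]%:R : R) = \1_(B k).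
    by apply/funext => w; rewrite indicE.
  by apply: measurable_indic; exact: F_sub.
by split; apply: ge0_le_integral => // w Aw; rewrite lee_fin;
  have /andP[h1 h2] := lohi w Aw => //; exact: le_trans h1.
Qed.

End draws.

(** * Dependence on the sampled data only *)

Section congruence.
Context {R : realType} {p : nat}.
Variables (Sigma : 'M[R]_p) (c : criterion) (n r0 r : nat).
Variables (W W' : nat -> 'cV[R]_p) (y y' : nat -> R) (I I' J J' : nat -> nat).
Hypothesis WE : forall i, (i < n)%N -> W i = W' i /\ y i = y' i.
Hypothesis IE : forall k, (k < r0)%N -> I k = I' k /\ (I k < n)%N.
Hypothesis JE : forall k, (k < r)%N -> J k = J' k /\ (J k < n)%N.

Lemma eq_resid b i : (i < n)%N -> resid W y b i = resid W' y' b i.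
Proof. by move=> /WE[w yi]; rewrite /resid w yi. Qed.

Lemma eq_HW : HW Sigma n W = HW Sigma n W'.
Proof.
rewrite /HW; congr (_ *: _ - _).
by apply: eq_bigr => i _; have [-> _] := WE (ltn_ord i).
Qed.

Lemma eq_full_estimator : full_estimator Sigma n W y = full_estimator Sigma n W' y'.
Proof.
congr argmin; apply/funext => b; rewrite /full_loss; congr (_ * _ - _).
by apply: eq_bigr => i _; rewrite eq_resid.
Qed.

Lemma eq_subsample_estimator s (Ws Ws' : nat -> 'cV[R]_p) (ys ys' pis pis' : nat -> R) :
  (forall k, (k < s)%N -> [/\ Ws k = Ws' k, ys k = ys' k & pis k = pis' k]) ->
  subsample_estimator Sigma n s Ws ys pis = subsample_estimator Sigma n s Ws' ys' pis'.
Proof.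
move=> h; congr argmin; apply/funext => b; rewrite /subsample_loss; congr (_ * _ - _).
by apply: eq_bigr => k _; rewrite /resid; have [-> -> ->] := h k (ltn_ord k).
Qed.

Lemma eq_pilot : pilot Sigma n r0 W y I = pilot Sigma n r0 W' y' I'.
Proof.
apply: eq_subsample_estimator => k /IE[IE1 In] /=.
by have [-> ->] := WE In; rewrite IE1.
Qed.

Lemma eq_pilot_subprob i : (i < n)%N ->
  pilot_subprob Sigma c n r0 W y I i = pilot_subprob Sigma c n r0 W' y' I' i.
Proof.
move=> i_n; rewrite /pilot_subprob eq_pilot /subprob.
have pw k : (k < n)%N -> prob_weight Sigma c n W y (pilot Sigma n r0 W' y' I') k =
    prob_weight Sigma c n W' y' (pilot Sigma n r0 W' y' I') k.
  by move=> kn; rewrite /prob_weight eq_resid// eq_HW; have [-> _] := WE kn.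
by rewrite pw//; congr (_ / _); apply: eq_bigr => k _; rewrite pw.
Qed.

Lemma eq_Vc_mx : Vc_mx Sigma c n r0 r W y I = Vc_mx Sigma c n r0 r W' y' I'.
Proof.
rewrite /Vc_mx eq_full_estimator; congr (_ *: _ - _).
apply: eq_bigr => i _; have [-> _] := WE (ltn_ord i).
by rewrite eq_resid// eq_pilot_subprob.
Qed.

Lemma eq_moment4 b i : (i < n)%N -> moment4 W y b i = moment4 W' y' b i.
Proof. by move=> i_n; rewrite /moment4 eq_resid//; have [-> _] := WE i_n. Qed.

Lemma eq_two_step_estimator :
  two_step_estimator Sigma c n r0 r W y I J =
  two_step_estimator Sigma c n r0 r W' y' I' J'.
Proof.
apply: eq_subsample_estimator => k ks /=.
case: ifP => kr0.
  have [IE1 In] := IE kr0; have [-> ->] := WE In.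
  by rewrite IE1.
have kr : (k - r0 < r)%N by rewrite ltn_subLR// leqNgt kr0.
have [JE1 Jn] := JE kr; have [-> ->] := WE Jn.
by rewrite eq_pilot_subprob// JE1.
Qed.

Lemma eq_standardized_error :
  standardized_error Sigma c n r0 r W y I J =
  standardized_error Sigma c n r0 r W' y' I' J'.
Proof.
rewrite /standardized_error /V_mx eq_Vc_mx eq_HW eq_full_estimator.
by rewrite eq_two_step_estimator.
Qed.

End congruence.

(** * Data for which the normal approximation holds *)

Section good_data.
Context {R : realType} {p : nat}.
Variables (Sigma H : 'M[R]_p) (c : criterion) (n r0 r : nat) (cV dl M et : R).
Implicit Types (W : nat -> 'cV[R]_p) (y : nat -> R) (I : nat -> nat).

(** The conditions under which [fixed_data_clt] applies, with the pilot
    probabilities for [pi]. They are stated one by one because each follows from a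
    different assumption of the theorem. *)
Definition good_HW W := forall i j, `|(HW Sigma n W - H) i j| <= et.
Definition good_moment W y :=
  n%:R^-1 * \sum_(i < n) moment4 W y (full_estimator Sigma n W y) i <= M.
Definition good_prob W y I := forall i : 'I_n,
  0 < pilot_subprob Sigma c n r0 W y I i /\
  (n%:R * pilot_subprob Sigma c n r0 W y I i)^-1 <= M.
Definition good_tail W y := n%:R^-1 * \sum_(i < n)
  (`|resid W y (full_estimator Sigma n W y) i| * enorm (W i)) `^ (2 + dl) <= M.
Definition good_cov W y I := forall v,
  cV * enorm v ^+ 2 <= quadform (r%:R *: Vc_mx Sigma c n r0 r W y I) v.
Definition good_first W y I :=
  \sum_(k < r0) moment4 W y (full_estimator Sigma n W y) (I k) <=
  et * Num.sqrt r%:R.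
Definition good_data W y I :=
  [/\ good_HW W, good_moment W y, good_prob W y I &
      [/\ good_tail W y, good_cov W y I & good_first W y I]].

Lemma eq_good_moment W W' y y' :
  (forall i, (i < n)%N -> W i = W' i /\ y i = y' i) ->
  good_moment W y -> good_moment W' y'.
Proof.
move=> WE g2; have E2 := eq_full_estimator Sigma WE.
have E : \sum_(i < n) moment4 W y (full_estimator Sigma n W y) i =
    \sum_(i < n) moment4 W' y' (full_estimator Sigma n W y) i.
  by apply: eq_bigr => i _; exact: (eq_moment4 WE).
by rewrite /good_moment -E2 -E; exact: g2.
Qed.

Lemma eq_good_data W W' y y' I I' :
  (forall i, (i < n)%N -> W i = W' i /\ y i = y' i) ->
  (forall k, (k < r0)%N -> I k = I' k /\ (I k < n)%N) ->
  good_data W y I -> good_data W' y' I'.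
Proof.
move=> WE IE.
have E1 := eq_HW Sigma WE; have E2 := eq_full_estimator Sigma WE.
have E3 := eq_pilot_subprob Sigma c WE IE.
have E4 := eq_Vc_mx Sigma c r WE IE.
move=> [g1 g2 g3 [g4 g5 g6]]; split; last split.
- by rewrite /good_HW -E1.
- exact: eq_good_moment g2.
- by move=> i; rewrite -E3.
- pose f (W : nat -> 'cV[R]_p) (y : nat -> R) (i : nat) :=
    `|resid W y (full_estimator Sigma n W y) i| * enorm (W i).
  have E i : (i < n)%N -> f W y i = f W' y' i.
    move=> i_n; rewrite /f -E2 (eq_resid WE _ i_n).
    by have [-> _] := WE i i_n.
  have {}E : \sum_(i < n) f W y i `^ (2 + dl) = \sum_(i < n) f W' y' i `^ (2 + dl).
    by apply: eq_bigr => i _; rewrite E.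
  by rewrite /good_tail -[X in _ * X <= _]E; exact: g4.
- by rewrite /good_cov -E4.
- rewrite /good_first -E2; apply: le_trans g6; rewrite le_eqVlt; apply/orP; left.
  apply/eqP; apply: eq_bigr => k _; have [<- In] := IE k (ltn_ord k).
  by rewrite (eq_moment4 WE).
Qed.

Lemma scale_Vc_mx W y I : (0 < r)%N ->
  r%:R *: Vc_mx Sigma c n r0 r W y I =
  score_cov Sigma n W y (pilot_subprob Sigma c n r0 W y I).
Proof.
move=> r_gt0; have r1 : r%:R != 0 :> R by rewrite pnatr_eq0 -lt0n.
rewrite /Vc_mx /score_cov scalerBr !scalerA divff// scale1r; congr (_ *: _ - _).
by rewrite invfM mulrA divff// mul1r.
Qed.

Lemma standardized_errorE W y I J : (0 < r)%N ->
  standardized_error Sigma c n r0 r W y I J =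
  norming Sigma n r W y (pilot_subprob Sigma c n r0 W y I) *m
  (comb_estimator Sigma n r0 r W y (pilot_subprob Sigma c n r0 W y I) I J -
   full_estimator Sigma n W y).
Proof.
move=> r_gt0; rewrite /standardized_error /norming /V_mx -scale_Vc_mx// scalerA.
by rewrite mulVf ?scale1r// pnatr_eq0 -lt0n.
Qed.

Lemma pilot_subprob_ge0 W y I i : 0 <= pilot_subprob Sigma c n r0 W y I i.
Proof.
have pw b k : 0 <= prob_weight Sigma c n W y b k.
  by rewrite mulr_ge0//; case: c; exact: enorm_ge0.
by rewrite mulr_ge0// invr_ge0; apply: sumr_ge0.
Qed.

(** If all weights vanished, the ratios would be 0 by the convention on division
    by 0, and not positive. *)
Lemma pilot_subprob_sum1 W y I : (0 < n)%N -> good_prob W y I ->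
  \sum_(i < n) pilot_subprob Sigma c n r0 W y I i = 1.
Proof.
move=> n0 /(_ (Ordinal n0))[+ _]; rewrite /pilot_subprob /subprob.
set D := \sum_(j < n) _ => h.
have D0 : D != 0 by apply: contraTneq h => ->; rewrite invr0 mulr0 ltxx.
by rewrite -big_distrl/= divff.
Qed.

Section measurable_good.
Context {d : measure_display} {T : measurableType d}.
Hypothesis Sigma_sym : Sigma^T = Sigma.
Variables (W : nat -> T -> 'cV[R]_p) (y : nat -> T -> R) (I : T -> nat -> nat).
Hypothesis mW : forall i, mmx (W i).
Hypothesis my : forall i, measurable_fun setT (y i).
Hypothesis mI : forall k, measurable_fun setT (I ^~ k).

Lemma measurable_forall (K : finType) (Q : K -> T -> Prop) :
  (forall i, measurable [set w | Q i w]) -> measurable [set w | forall i, Q i w].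
Proof.
move=> mQ; have -> : [set w | forall i, Q i w] = \bigcap_(i : K) [set w | Q i w].
  by apply/seteqP; split => w /= h i; [move=> _|]; exact: h.
by apply: fin_bigcap_measurable => //; exact: finite_finset.
Qed.

Lemma measurable_good_HW : measurable [set w | good_HW (W ^~ w)].
Proof.
apply: measurable_forall => i; apply: measurable_forall => j.
apply: measurable_le_set; last exact: measurable_cst.
apply: measurable_normr; apply: (mmxB (Z := fun=> H)); last exact: mmx_cst.
exact: mmx_HW.
Qed.

Lemma measurable_good_moment : measurable [set w | good_moment (W ^~ w) (y ^~ w)].
Proof.
apply: measurable_le_set; last exact: measurable_cst.
apply: measurable_funM; first exact: measurable_cst.
apply: measurable_sum => i; apply: measurable_moment4 => //.
exact: mmx_full_estimator.
Qed.

Lemma measurable_good_prob : measurable [set w | good_prob (W ^~ w) (y ^~ w) (I w)].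
Proof.
have mp i : measurable_fun setT
    (fun w => pilot_subprob Sigma c n r0 (W ^~ w) (y ^~ w) (I w) i).
  exact: measurable_pilot_subprob.
apply: measurable_forall => i; apply: measurableI.
  by apply: measurable_lt_set => //; exact: measurable_cst.
apply: measurable_le_set; last exact: measurable_cst.
apply: measurable_fun_invr; apply: measurable_funM => //; exact: measurable_cst.
Qed.

Lemma measurable_good_tail : measurable [set w | good_tail (W ^~ w) (y ^~ w)].
Proof.
apply: measurable_le_set; last exact: measurable_cst.
apply: measurable_funM; first exact: measurable_cst.
apply: measurable_sum => i.
apply: (@measurableT_comp _ _ _ _ _ _ (fun x : R => x `^ (2 + dl))).
  exact: measurable_powR.
apply: measurable_funM; last exact: measurable_enorm.
apply: measurable_normr; apply: measurable_resid => //.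
exact: mmx_full_estimator.
Qed.

Lemma measurable_good_cov : measurable [set w | good_cov (W ^~ w) (y ^~ w) (I w)].
Proof.
apply: (measurable_coercive (c := fun=> cV)); last exact: measurable_cst.
apply: mmxZ; first exact: measurable_cst.
exact: mmx_Vc_mx.
Qed.

Lemma measurable_good_first : measurable [set w | good_first (W ^~ w) (y ^~ w) (I w)].
Proof.
apply: measurable_le_set; last exact: measurable_cst.
apply: measurable_sum => k.
apply: (measurable_fun_index (F := fun i w => moment4 (W ^~ w) (y ^~ w)
  (full_estimator Sigma n (W ^~ w) (y ^~ w)) i)) => // i.
by apply: measurable_moment4 => //; exact: mmx_full_estimator.
Qed.

Lemma measurable_good_data : measurable [set w | good_data (W ^~ w) (y ^~ w) (I w)].
Proof.
have -> : [set w | good_data (W ^~ w) (y ^~ w) (I w)] =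
  [set w | good_HW (W ^~ w)] `&` [set w | good_moment (W ^~ w) (y ^~ w)] `&`
  [set w | good_prob (W ^~ w) (y ^~ w) (I w)] `&`
  [set w | good_tail (W ^~ w) (y ^~ w)] `&`
  [set w | good_cov (W ^~ w) (y ^~ w) (I w)] `&`
  [set w | good_first (W ^~ w) (y ^~ w) (I w)].
  by apply/seteqP; split => w /= [] => [? ? ? []|[[[[]]]]]//; split.
apply: measurableI; last exact: measurable_good_first.
apply: measurableI; last exact: measurable_good_cov.
apply: measurableI; last exact: measurable_good_tail.
apply: measurableI; last exact: measurable_good_prob.
by apply: measurableI; [exact: measurable_good_HW|exact: measurable_good_moment].
Qed.

End measurable_good.
End good_data.

(** * From events to conditional probabilities *)

Section conditional_probability.
Context {d : measure_display} {T : measurableType d} {R : realType}.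
Variable P : probability T R.

Let pr (A : set T) : R := fine (P A).

Lemma prE A : measurable A -> P A = (pr A)%:E.
Proof. by move=> mA; rewrite fineK// fin_num_measure. Qed.

Lemma pr_ge0 A : 0 <= pr A. Proof. by rewrite fine_ge0. Qed.

Lemma pr_split A B : measurable A -> measurable B ->
  pr A = pr (A `&` B) + pr (A `\` B).
Proof.
move=> mA mB; apply: EFin_inj; rewrite EFinD.
have mI : measurable (A `&` B) by exact: measurableI.
have mD : measurable (A `\` B) by exact: measurableD.
by rewrite -!prE// [RHS]addeC; exact: measureDI.
Qed.

Lemma pr_le A B : measurable A -> measurable B -> A `<=` B -> pr A <= pr B.
Proof.
move=> mA mB AB; rewrite -lee_fin -!prE//.
by apply: le_measure; rewrite ?inE.
Qed.

(** Restricting to the good event changes both probabilities by at most the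
    probability of its complement. *)
Lemma pr_good_event A D E (l e : R) :
  measurable A -> measurable D -> measurable E -> 0 <= l <= 1 ->
  pr (~` D) <= e ->
  `|pr (A `&` D `&` E) - l * pr (A `&` D)| <= e ->
  `|pr (A `&` E) - l * pr A| <= 2 * e.
Proof.
move=> mA mD mE /andP[l0 l1] De.
have mAE : measurable (A `&` E) by exact: measurableI.
rewrite (pr_split mAE mD) (pr_split mA mD) setIAC.
have mDc : measurable (~` D) by exact: measurableC.
have h1 : pr (A `&` E `\` D) <= e.
  by apply: le_trans De; apply: pr_le => //; exact: measurableD.
have h2 : pr (A `\` D) <= e.
  by apply: le_trans De; apply: pr_le => //; exact: measurableD.
have h3 := pr_ge0 (A `&` E `\` D); have h4 := pr_ge0 (A `\` D).
rewrite !ler_norml => /andP[h5 h6].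
by apply/andP; split; nra.
Qed.

(** The events [l + a < g] and [g < l - a] belong to [F], and on them the integral
    of [g] differs from that of [l] by at least [a] times the probability. This turns
    an estimate in the mean over events of [F] into convergence in probability,
    without a limit theorem for conditional expectations. *)
Lemma cond_prob_deviation (F : set (set T)) (E : set T) (g : T -> R) (l e a : R) :
  F `<=` measurable -> measurable E -> is_cond_prob P F E g -> 0 < a ->
  (forall A, F A -> `|pr (A `&` E) - l * pr A| <= e) ->
  (P [set w | (a < `|g w - l|)%R] <= (2 * e / a)%:E)%E.
Proof.
move=> Fsub mE [Fg intg gE] a0 FE.
have Fset (B : set R) : measurable B -> F (g @^-1` B) by exact: Fg.
have key A : F A -> a * pr A <= e -> pr A <= e / a.
  by move=> _; rewrite ler_pdivlMr// mulrC.
pose A1 := g @^-1` `]l + a, +oo[; pose A2 := g @^-1` `]-oo, l - a[.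
have F1 : F A1 by apply: Fset; exact: measurable_itv.
have F2 : F A2 by apply: Fset; exact: measurable_itv.
have m1 := Fsub _ F1; have m2 := Fsub _ F2.
have int_A A : measurable A -> P.-integrable A (EFin \o g).
  by move=> mA; apply: integrableS intg.
have int_c A (x : R) : measurable A -> P.-integrable A (cst x%:E).
  move=> mA; apply: (@integrableS _ _ _ P setT) => //.
  exact: finite_measure_integrable_cst.
have p1 : pr A1 <= e / a.
  apply: (key _ F1); have := FE _ F1; rewrite ler_norml => /andP[_].
  have : (((l + a) * pr A1)%:E <= (pr (A1 `&` E))%:E)%E.
    rewrite -prE; last exact: measurableI.
    rewrite -gE// EFinM -prE// -integral_cst//.
    apply: le_integral; [exact: m1|exact: int_c|exact: int_A|].
    by move=> w; rewrite inE /A1/= in_itv/= andbT lee_fin => /ltW.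
  rewrite lee_fin; lra.
have p2 : pr A2 <= e / a.
  apply: (key _ F2); have := FE _ F2; rewrite ler_norml => /andP[+ _].
  have : ((pr (A2 `&` E))%:E <= ((l - a) * pr A2)%:E)%E.
    rewrite -prE; last exact: measurableI.
    rewrite -gE// EFinM -prE// -integral_cst//.
    apply: le_integral; [exact: m2|exact: int_A|exact: int_c|].
    by move=> w; rewrite inE /A2/= in_itv/= lee_fin => /ltW.
  rewrite lee_fin; lra.
have -> : [set w | a < `|g w - l|] = A1 `|` A2.
  apply/seteqP; split => w /=; rewrite /A1 /A2/= !in_itv/= andbT.
    by rewrite ltr_normr => /orP[h|h]; [left|right]; lra.
  by rewrite ltr_normr => -[h|h]; apply/orP; [left|right]; lra.
have h : (P A1 + P A2 <= (2 * e / a)%:E)%E.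
  rewrite (prE m1) (prE m2) -EFinD lee_fin -mulrA mulr_natl mulr2n.
  exact: lerD.
exact: le_trans (measureU2 P m1 m2) h.
Qed.

Lemma le_measureU A B (x y : R) : measurable A -> measurable B ->
  (P A <= x%:E)%E -> (P B <= y%:E)%E -> (P (A `|` B) <= (x + y)%:E)%E.
Proof.
move=> mA mB Ax By; have h : (P A + P B <= (x + y)%:E)%E by rewrite EFinD leeD.
exact: le_trans (measureU2 P mA mB) h.
Qed.

End conditional_probability.

(** * Measurability with respect to the data *)

Section truncation.
Context {d : measure_display} {T : measurableType d} {R : realType} {p : nat}.
Variables (W : nat -> T -> 'cV[R]_p) (y : nat -> T -> R) (I : T -> nat -> nat).
Variables (n r0 : nat).

(** The data beyond the sample and the draws beyond the first step are replaced
    by constants, which makes the sequences measurable with respect to the data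
    and the first step. *)
Definition trunc_W i w : 'cV[R]_p := if (i < n)%N then W i w else 0.
Definition trunc_y i w : R := if (i < n)%N then y i w else 0.
Definition trunc_I w k : nat := if (k < r0)%N then I w k else 0.

Variable G : set (set T).
Let TG := g_sigma_algebraType G.
Hypothesis G_W : forall (i : 'I_n) j, measurable_fun setT (coords (W i) j : TG -> R).
Hypothesis G_y : forall i : 'I_n, measurable_fun setT (y i : TG -> R).

Lemma mmx_trunc_W i : mmx (trunc_W i : TG -> 'cV[R]_p).
Proof.
rewrite /trunc_W; case: ltnP => i_n; last exact: mmx_cst.
move=> j k; rewrite ord1.
exact: (G_W (Ordinal i_n)).
Qed.

Lemma measurable_trunc_y i : measurable_fun setT (trunc_y i : TG -> R).
Proof.
rewrite /trunc_y; case: ltnP => i_n; last exact: measurable_cst.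
exact: (G_y (Ordinal i_n)).
Qed.

Hypothesis G_I : forall k : 'I_r0, measurable_fun setT ((fun w => (I w k)%:R) : TG -> R).

Lemma measurable_trunc_I k : measurable_fun setT (trunc_I ^~ k : TG -> nat).
Proof.
rewrite /trunc_I; case: ltnP => k_r0; last exact: measurable_cst.
move=> _ B _; rewrite setTI.
have := G_I (Ordinal k_r0) measurableT.
move=> /(_ [set x | exists2 m, B m & x = m%:R :> R]); rewrite setTI.
set S := [set x | _]; have mS : measurable S.
  have -> : S = \bigcup_(m in B) [set m%:R].
    by apply/seteqP; split => x [m Bm xm]; exists m.
  by apply: bigcup_measurable => m _; exact: measurable_set1.
move=> /(_ mS); congr (measurable _); apply/seteqP; split => w /=.
  by move=> [m Bm /eqP]; rewrite eqr_nat => /eqP ->.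
by move=> Bw; exists (I w k).
Qed.

End truncation.

(** * Normal approximation on the good event *)

Section good_clt.
Context {R : realType} {p : nat}.

(** [fixed_data_clt] in terms of the standardized error of the two-step
    estimator. *)
Lemma good_data_clt (Sigma H : 'M[R]_p) (c : criterion) (cV dl M eps : R)
    (t : 'cV[R]_p) :
  Sigma^T = Sigma -> posdefmx H -> 0 < cV -> 0 < dl -> 1 <= M -> 0 < eps ->
  exists2 et : R, 0 < et &
  forall (n r0 r : nat) (W : nat -> 'cV[R]_p) (y : nat -> R) (I : nat -> nat),
  (0 < n)%N -> (0 < r)%N -> (Num.sqrt r%:R)^-1 <= et ->
  good_data Sigma H c n r0 r cV dl M et W y I ->
  `|Psamp (fun i : 'I_n => pilot_subprob Sigma c n r0 W y I i)
      (fun k : {ffun 'I_r -> 'I_n} => `[< forall j,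
        standardized_error Sigma c n r0 r W y I (draw_index k) j 0 <= t j 0 >])
    - \prod_j std_normal_cdf (t j 0)| <= eps.
Proof.
move=> Ss pH c0 dl0 M1 eps0.
have [et et0 clt] := fixed_data_clt t Ss pH c0 dl0 M1 eps0.
exists et => // n r0 r W y I n0 r_gt0 ret gd.
have [gH gm gp [gt gc gf]] := gd.
have pi1 := pilot_subprob_sum1 n0 gp.
have -> : (fun k : {ffun 'I_r -> 'I_n} => `[< forall j,
        standardized_error Sigma c n r0 r W y I (draw_index k) j 0 <= t j 0 >]) =
  (fun k : {ffun 'I_r -> 'I_n} => [forall j,
     (norming Sigma n r W y (pilot_subprob Sigma c n r0 W y I) *m
      (comb_estimator Sigma n r0 r W y (pilot_subprob Sigma c n r0 W y I) I
         (draw_index k) - full_estimator Sigma n W y)) j 0 <= t j 0]).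
  apply/funext => k; rewrite standardized_errorE//.
  by apply/asboolP/forallP.
apply: clt => //.
- by move=> i; have [] := gp i.
- by move=> i; have [] := gp i.
- by move=> v; rewrite -(scale_Vc_mx _ _ _ _ _ _ _ r_gt0).
Qed.

End good_clt.

Section fixed_size.
Context {d : measure_display} {T : measurableType d} {R : realType} {p : nat}.
Variable P : probability T R.
Variables (Sigma : 'M[R]_p) (W : nat -> T -> 'cV[R]_p) (y : nat -> T -> R).
Variables (c : criterion) (n r0 r : nat) (I J : T -> nat -> nat).
Hypothesis Sigma_sym : Sigma^T = Sigma.
Hypothesis mW : forall i, mmx (W i).
Hypothesis my : forall i, measurable_fun setT (y i).
Hypothesis sampling : two_step_sampling P Sigma W y c n r0 r I J.
Hypotheses (n_gt0 : (0 < n)%N) (r_gt0 : (0 < r)%N).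

Let mI := measurable_I sampling.
Let mJ := measurable_J sampling.

(** [sigma_gen f] is the sigma-algebra generated by this family. *)
Definition generators (K : Type) (f : K -> T -> R) : set (set T) :=
  \bigcup_(i in [set: K]) preimage_set_system setT (f i) measurable.

Lemma measurable_generators (K : Type) (f : K -> T -> R) i :
  measurable_fun setT (f i : g_sigma_algebraType (generators f) -> R).
Proof.
by move=> _ B mB; apply: sub_gen_smallest; exists i => //; exists B.
Qed.

Let fF (k : 'I_n * option 'I_p) := if k.2 is Some j then coords (W k.1) j else y k.1.
Let fG (k : ('I_n * option 'I_p) + 'I_r0) :=
    match k with
    | inl k => if k.2 is Some j then coords (W k.1) j else y k.1
    | inr k => fun w => (I w k)%:R
    end.

Let mfF k : measurable_fun setT (fF k).
Proof. by case: k => i [j|]; rewrite /fF/=; [exact: mW|exact: my]. Qed.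

Let mfG k : measurable_fun setT (fG k).
Proof.
case: k => [k|k]; first exact: mfF.
by apply: (@measurableT_comp _ _ _ _ _ _ (fun m : nat => m%:R : R)).
Qed.

Lemma sigma_data_sub : sigma_data W y n `<=` measurable.
Proof. exact: (sigma_gen_sub mfF). Qed.

Lemma sigma_data_pilot_sub : sigma_data_pilot W y n r0 I `<=` measurable.
Proof. exact: (sigma_gen_sub mfG). Qed.

Lemma sigma_data_le_pilot : sigma_data W y n `<=` sigma_data_pilot W y n r0 I.
Proof.
apply: smallest_sub; first exact: smallest_sigma_algebra.
by move=> A [k _ Ak]; apply: sub_gen_smallest; exists (inl k).
Qed.

Let W' := trunc_W W n.
Let y' := trunc_y y n.
Let I' := trunc_I I r0.

Let WE w i : (i < n)%N -> W i w = W' i w /\ y i w = y' i w.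
Proof. by move=> i_n; rewrite /W' /y' /trunc_W /trunc_y i_n. Qed.

Let IE0 w k : (k < r0)%N -> I w k = I' w k.
Proof. by move=> k0; rewrite /I' /trunc_I k0. Qed.

(** Membership of the drawn indices in the sample is guaranteed only up to a null
    set, by the law of the draws. *)
Definition in_range : set T := [set w | forall k : 'I_r0, (I w k < n)%N].

Lemma measurable_in_range : measurable in_range.
Proof.
apply: measurable_forall => k; rewrite -[X in measurable X]setTI.
exact: (mI k measurableT (Y := [set m | (m < n)%N])).
Qed.

Let uniform : (forall i : 'I_n, 0 <= n%:R^-1 :> R) /\ \sum_(i < n) n%:R^-1 = 1 :> R.
Proof.
split=> [_|]; first by rewrite invr_ge0.
by rewrite sumr_const card_ord -[LHS]mulr_natl divff// pnatr_eq0 -lt0n.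
Qed.

Let F_sigma : sigma_algebra setT (sigma_data W y n) := @smallest_sigma_algebra _ _ _.
Let G_sigma : sigma_algebra setT (sigma_data_pilot W y n r0 I) :=
  @smallest_sigma_algebra _ _ _.

Lemma first_step_in_range : P (~` in_range) = 0%E.
Proof.
have mE : measurable (~` in_range) by apply: measurableC; exact: measurable_in_range.
have -> : ~` in_range = setT `&` ~` in_range by rewrite setTI.
have [_ h] : (0%:E * P setT <= P (setT `&` ~` in_range))%E /\
    (P (setT `&` ~` in_range) <= 0%:E * P setT)%E.
  apply: (draws_bounds F_sigma sigma_data_sub mI _ (first_step sampling)
    (B := fun=> set0)) => //.
  - by have [F0 FC _] := F_sigma; rewrite -(setD0 setT); exact: FC.
  - by move=> k; have [] := F_sigma.
  - move=> k w _ kw; split => //= h; apply: h => j; rewrite kw; exact: ltn_ord.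
  - move=> w _; rewrite /Psamp.
    have -> : (fun k : {ffun 'I_r0 -> 'I_n} => (`[< set0 w >])%:R : R) = fun=> 0.
      by apply/funext => k; case: asboolP.
    by rewrite (Esamp_cst (proj2 uniform)) lexx.
by apply/eqP; rewrite eq_le measure_ge0 andbT; rewrite mul0e in h.
Qed.

Variables (H : 'M[R]_p) (cV dl M et : R).
Hypotheses (et_gt0 : 0 < et) (M_ge0 : 0 <= M).

(** Markov's inequality: given the data, the expectation of the sum over the first
    step is [r0] times the mean of the [moment4]. *)
Lemma first_step_good :
  (P ([set w | good_moment Sigma n M (W ^~ w) (y ^~ w)] `&`
     [set w | ~ good_first Sigma n r0 r et (W ^~ w) (y ^~ w) (I w)])
   <= (r0%:R * M / (et * Num.sqrt r%:R))%:E)%E.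
Proof.
pose m w i := moment4 (W' ^~ w) (y' ^~ w)
  (full_estimator Sigma n (W' ^~ w) (y' ^~ w)) i.
have b0 : 0 < et * Num.sqrt r%:R by rewrite mulr_gt0// sqrtr_gt0 ltr0n.
set A := [set w | good_moment _ _ _ _ _]; set E := [set w | ~ _].
set b := et * _ in b0 *.
have mWF i := @mmx_trunc_W d T R p W n (generators fF)
  (fun i j => measurable_generators (f := fF) (i, Some j)) i.
have myF i := @measurable_trunc_y d T R y n (generators fF)
  (fun i => measurable_generators (f := fF) (i, None)) i.
have FA : sigma_data W y n A.
  have -> : A = [set w | good_moment Sigma n M (W' ^~ w) (y' ^~ w)].
    apply/seteqP; split => w /=; apply: eq_good_moment => i i_n //.
      exact: WE.
    by have [-> ->] := WE w i_n.
  have h := @measurable_good_moment _ _ Sigma n M _ (g_sigma_algebraType (generators fF)) Sigma_sym W' y' mWF myF.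
  exact h.
have mm i : measurable_fun setT (m^~ i : g_sigma_algebraType (generators fF) -> R).
  by apply: measurable_moment4 => //; exact: mmx_full_estimator.
have [_ h] : (0%:E * P A <= P (A `&` E))%E /\
    (P (A `&` E) <= (r0%:R * M / b)%:E * P A)%E.
  apply: (draws_bounds F_sigma sigma_data_sub mI _ (first_step sampling)
    (B := fun k : {ffun 'I_r0 -> 'I_n} => [set w | b < \sum_j m w (k j)])) => //.
  - by apply: measurableC; exact: measurable_good_first.
  - move=> k; apply: (@measurable_lt_set _ (g_sigma_algebraType (generators fF)) R
      (fun=> b)); first exact: measurable_cst.
    by apply: measurable_sum.
  - move=> k w _ kw; rewrite /E /good_first /=.
    have -> : \sum_(k < r0) moment4 (W ^~ w) (y ^~ w)
        (full_estimator Sigma n (W ^~ w) (y ^~ w)) (I w k) = \sum_j m w (k j).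
      rewrite (eq_full_estimator Sigma (WE w)); apply: eq_bigr => j _.
      by rewrite kw (eq_moment4 (WE w)).
    by rewrite real_ltNge ?num_real//; split => /negP.
  - move=> w Aw; apply/andP; split.
      by apply: Psamp_ge0 => _; have [] := uniform.
    apply: (@le_trans _ _ (Psamp (fun=> n%:R^-1)
       (fun k : {ffun 'I_r0 -> 'I_n} => b <= \sum_j m w (k j)))).
      apply: le_Esamp => [_|k]; first by have [] := uniform.
      by case: asboolP => [/= /ltW ->//|_]; case: (b <= _).
    apply: le_trans (Psamp_markov _ b0 _) _ => //.
    + move=> k; apply: sumr_ge0 => j _.
      by rewrite !addr_ge0// exprn_even_ge0.
    rewrite ler_wpM2r ?invr_ge0 ?(ltW b0)//.
    rewrite (@Esamp_sum_draws _ _ _ (proj2 uniform) r0 (fun i => m w i)) ler_wpM2l//.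
    by rewrite -big_distrr/=; exact: (eq_good_moment (WE w) Aw).
apply: (le_trans h); rewrite -[leRHS]mule1 lee_wpmul2l ?probability_le1//.
  by rewrite lee_fin divr_ge0 ?mulr_ge0// ltW.
exact: sigma_data_sub.
Qed.

Variables (t : 'cV[R]_p) (l eps : R).
Hypothesis eps_ge0 : 0 <= eps.
Hypothesis clt_on_good_data : forall w,
  good_data Sigma H c n r0 r cV dl M et (W' ^~ w) (y' ^~ w) (I' w) ->
  `|Psamp (fun i : 'I_n => pilot_subprob Sigma c n r0 (W' ^~ w) (y' ^~ w) (I' w) i)
      (fun k : {ffun 'I_r -> 'I_n} => `[< forall j,
        standardized_error Sigma c n r0 r (W' ^~ w) (y' ^~ w) (I' w)
          (draw_index k) j 0 <= t j 0 >]) - l| <= eps.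

Definition good_event : set T :=
  in_range `&` [set w | good_data Sigma H c n r0 r cV dl M et (W ^~ w) (y ^~ w) (I w)].
Definition error_event : set T := [set w | forall j,
  standardized_error Sigma c n r0 r (W ^~ w) (y ^~ w) (I w) (J w) j 0 <= t j 0].

(** On the good event the conditional probability given the data and the first
    step is the probability over the second-step draws, which is within [eps] of
    [l]. The data are replaced by their truncations to see that the events are
    measurable with respect to [sigma_data_pilot]. *)
Lemma cond_prob_error_event A : sigma_data_pilot W y n r0 I A ->
  `|fine (P (A `&` good_event `&` error_event)) - l * fine (P (A `&` good_event))|
    <= eps.
Proof.
move=> GA.
have mWG i := @mmx_trunc_W d T R p W n (generators fG)
  (fun i j => measurable_generators (f := fG) (inl (i, Some j))) i.
have myG i := @measurable_trunc_y d T R y n (generators fG)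
  (fun i => measurable_generators (f := fG) (inl (i, None))) i.
have mIG k := @measurable_trunc_I d T R I r0 (generators fG)
  (fun k => measurable_generators (f := fG) (inr k)) k.
have IE w k : in_range w -> (k < r0)%N -> I w k = I' w k /\ (I w k < n)%N.
  by move=> h k0; split; [exact: IE0|exact: (h (Ordinal k0))].
have goodE : good_event = in_range `&`
    [set w | good_data Sigma H c n r0 r cV dl M et (W' ^~ w) (y' ^~ w) (I' w)].
  apply/seteqP; split => w [h g]; (split; first exact: h).
    exact: (eq_good_data (WE w) (fun k => @IE w k h) g).
  have WE' i : (i < n)%N -> W' i w = W i w /\ y' i w = y i w.
    by move=> i_n; have [-> ->] := WE w i_n.
  have IE' k : (k < r0)%N -> I' w k = I w k /\ (I' w k < n)%N.
    by move=> k0; have [<- ?] := IE w k h k0.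
  exact: (eq_good_data WE' IE' g).
have Gin : sigma_data_pilot W y n r0 I in_range.
  have h : measurable ([set w | forall k : 'I_r0, (I' w k < n)%N] :
      set (g_sigma_algebraType (generators fG))).
    apply: measurable_forall => k.
    have h1 := mIG k measurableT [set m | (m < n)%N].
    by rewrite setTI in h1; exact: h1.
  have -> : in_range = [set w | forall k : 'I_r0, (I' w k < n)%N].
    by apply/seteqP; split => w /= h' k; have := h' k; rewrite (IE0 w (ltn_ord k)).
  exact h.
have Ggood : sigma_data_pilot W y n r0 I good_event.
  have h := @measurable_good_data _ _ Sigma H c n r0 r cV dl M et _
    (g_sigma_algebraType (generators fG)) Sigma_sym W' y' I' mWG myG mIG.
  rewrite goodE; apply: (sigma_algebra_setI G_sigma) => //; exact h.
have GA' := sigma_algebra_setI G_sigma GA Ggood.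
set D := A `&` good_event in GA' *.
have mD : measurable D := sigma_data_pilot_sub GA'.
have mE : measurable error_event by exact: measurable_error_event.
pose B (k : {ffun 'I_r -> 'I_n}) : set T := [set w | forall j,
  standardized_error Sigma c n r0 r (W' ^~ w) (y' ^~ w) (I' w)
    (draw_index k) j 0 <= t j 0].
have q_prob w : D w ->
    (forall i : 'I_n, 0 <= pilot_subprob Sigma c n r0 (W ^~ w) (y ^~ w) (I w) i) /\
    \sum_(i < n) pilot_subprob Sigma c n r0 (W ^~ w) (y ^~ w) (I w) i = 1.
  move=> [_ [_ [_ _ gp _]]]; split=> [i|]; first exact: pilot_subprob_ge0.
  exact: pilot_subprob_sum1 gp.
have GB k : sigma_data_pilot W y n r0 I (B k).
  have h := @measurable_error_event _ (g_sigma_algebraType (generators fG)) R p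
    Sigma Sigma_sym W' y' mWG myG c n r0 r I' (fun=> draw_index k) mIG
    (fun=> measurable_cst _) t.
  exact h.
have EB k w : D w -> draw_event J k w -> error_event w <-> B k w.
  move=> [_ [h _]] kw; rewrite /error_event /B /=.
  have JE j : (j < r)%N -> J w j = draw_index k j /\ (J w j < n)%N.
    move=> j_r; have := kw (Ordinal j_r) => /= Jj.
    by rewrite Jj ltn_ord -(draw_indexE k (Ordinal j_r)).
  by rewrite (eq_standardized_error Sigma c (WE w) (fun k => @IE w k h) JE).
have mq i : measurable_fun setT
    (fun w => pilot_subprob Sigma c n r0 (W ^~ w) (y ^~ w) (I w) i).
  exact: measurable_pilot_subprob.
have Pq w : D w -> `|Psamp (fun i : 'I_n =>
    pilot_subprob Sigma c n r0 (W ^~ w) (y ^~ w) (I w) i)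
    (fun k => `[< B k w >]) - l| <= eps.
  move=> [_ Dw]; have [h _] := Dw.
  have -> : (fun i : 'I_n => pilot_subprob Sigma c n r0 (W ^~ w) (y ^~ w) (I w) i) =
    (fun i : 'I_n => pilot_subprob Sigma c n r0 (W' ^~ w) (y' ^~ w) (I' w) i).
    apply/funext => i.
    by rewrite (eq_pilot_subprob Sigma c (WE w) (fun k => @IE w k h)).
  by apply: clt_on_good_data; move: Dw; rewrite goodE => -[].
have le0 : 0 <= Num.max 0 (l - eps) by rewrite le_max lexx.
have [] := @draws_bounds _ _ _ P _ n r _ J G_sigma sigma_data_pilot_sub mJ mq
  (second_step sampling) D error_event B (Num.max 0 (l - eps)) (l + eps)
  GA' q_prob mE GB EB le0.
  move=> w Dw; have [q0 _] := q_prob w Dw.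
  have := Pq w Dw; rewrite ler_norml => /andP[h1 h2].
  rewrite ge_max Psamp_ge0//=; apply/andP; split; lra.
have mDE : measurable (D `&` error_event) by exact: measurableI.
have D1 : fine (P D) <= 1.
  by rewrite -lee_fin -prE// probability_le1.
have D0 := pr_ge0 P D.
rewrite (prE P mD) (prE P mDE) -!EFinM !lee_fin => lo hi.
have lo' : (l - eps) * fine (P D) <= Num.max 0 (l - eps) * fine (P D).
  by rewrite ler_wpM2r// le_max lexx orbT.
have eD : eps * fine (P D) <= eps by rewrite ler_piMr.
by rewrite ler_norml; apply/andP; split; lra.
Qed.

End fixed_size.

(** * Events of small probability *)

Section small_probability.
Context {d : measure_display} {T : measurableType d} {R : realType}.
Variable P : probability T R.

Lemma le_measure_subset (A B : set T) (x : R) : measurable A -> measurable B ->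
  A `<=` B -> (P B <= x%:E)%E -> (P A <= x%:E)%E.
Proof.
move=> mA mB AB; apply: le_trans; apply: le_measure; rewrite ?inE //.
Qed.

Lemma le_measure_exists (K : finType) (A : K -> set T) (x : R) :
  (forall k, measurable (A k)) -> (forall k, (P (A k) <= x%:E)%E) ->
  (P [set w | exists k, A k w] <= (#|K|%:R * x)%:E)%E.
Proof.
move=> mA Ax.
have key (s : seq K) : measurable [set w | exists2 k, k \in s & A k w] /\
    (P [set w | exists2 k, k \in s & A k w] <= ((size s)%:R * x)%:E)%E.
  elim: s => [|k s [ms IH]].
    rewrite (_ : [set w | _] = set0); last by apply/seteqP; split => w// [].
    by rewrite measure0 mul0r.
  rewrite (_ : [set w | _] = A k `|` [set w | exists2 k, k \in s & A k w]).
    split; first exact: measurableU.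
    by rewrite /= -[in leRHS]addn1 natrD addrC mulrDl mul1r; exact: le_measureU.
  apply/seteqP; split => w /=.
    move=> [k']; rewrite inE => /orP[/eqP ->|k's]; first by left.
    by right; exists k'.
  by move=> [kw|[k' k's k'w]]; [exists k|exists k']; rewrite ?inE ?eqxx ?k's ?orbT.
rewrite cardE; have [_] := key (enum K); congr (P _ <= _)%E.
by apply/seteqP; split => w /= [k]; [move=> _; exists k|exists k => //; rewrite mem_enum].
Qed.

Lemma cvg_in_prob_near (Z : nat -> T -> R) (l a e : R) : cvg_in_prob P Z l ->
  0 < a -> 0 < e ->
  \forall n \near \oo, (P [set w | (a < `|Z n w - l|)%R] <= e%:E)%E.
Proof.
move=> Zl a0 e0; have e0' : (0 < e%:E)%E by rewrite lte_fin.
have := Zl a a0 [set u : \bar R | (u < e%:E)%E] (open_ereal_lt' e0').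
rewrite /nbhs/= => h.
by apply: filterS h => n /= /ltW.
Qed.

Lemma near_cvg_in_prob (Z : nat -> T -> R) (l : R) :
  (forall a e, 0 < a -> 0 < e ->
    \forall n \near \oo, (P [set w | (a < `|Z n w - l|)%R] <= e%:E)%E) ->
  cvg_in_prob P Z l.
Proof.
move=> h a a0; apply/fine_cvgP; split.
  have := h a 1 a0 ltr01; apply: filterS => n hn.
  by rewrite ge0_fin_numE//; exact: le_lt_trans hn (ltry _).
apply/cvgrPdist_le => e e0; have := h a e a0 e0; apply: filterS => n hn /=.
rewrite sub0r normrN ger0_norm ?fine_ge0//.
by rewrite -lee_fin fineK// ge0_fin_numE//; exact: le_lt_trans hn (ltry _).
Qed.

End small_probability.

(** * The good event has probability close to 1 *)

Section conditions_in_probability.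
Context {d : measure_display} {T : measurableType d} {R : realType} {p : nat}.
Variable P : probability T R.
Variables (Sigma : 'M[R]_p) (W : nat -> T -> 'cV[R]_p) (y : nat -> T -> R).
Variables (c : criterion).
Hypothesis Sigma_sym : Sigma^T = Sigma.
Hypothesis mW : forall i, mmx (W i).
Hypothesis my : forall i, measurable_fun setT (y i).

Lemma near_good_HW (H : 'M[R]_p) (et e : R) : 0 < et -> 0 < e ->
  mx_cvg_in_prob P (fun n w => HW Sigma n (W ^~ w)) H ->
  \forall n \near \oo, (P [set w | ~ good_HW Sigma H n et (W ^~ w)] <= e%:E)%E.
Proof.
move=> et0 e0 cH; pose K : finType := ('I_p * 'I_p)%type.
pose N : R := #|K|%:R + 1.
have N0 : 0 < N by rewrite ltr_wpDl.
have : \forall n \near \oo, forall k : K,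
    (P [set w | (et < `|HW Sigma n (W ^~ w) k.1 k.2 - H k.1 k.2|)%R] <= (e / N)%:E)%E.
  apply: filter_forall => k.
  by apply: (cvg_in_prob_near (cH k.1 k.2)) => //; rewrite divr_gt0.
apply: filterS => n hn.
have mB (k : K) : measurable [set w | et < `|HW Sigma n (W ^~ w) k.1 k.2 - H k.1 k.2|].
  apply: measurable_lt_set; first exact: measurable_cst.
  apply: measurable_normr; apply: measurable_funB; last exact: measurable_cst.
  exact: mmx_HW.
have -> : [set w | ~ good_HW Sigma H n et (W ^~ w)] =
   [set w | exists k : K, et < `|HW Sigma n (W ^~ w) k.1 k.2 - H k.1 k.2|].
  apply/seteqP; split => w /=.
    move=> /existsNP[i /existsNP[j /negP]]; rewrite -ltNge => h.
    by exists (i, j); rewrite !mxE in h *.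
  move=> [[i j] /= h] /(_ i j); rewrite leNgt => /negP; apply.
  by rewrite !mxE in h *.
apply: (le_trans (le_measure_exists mB hn)); rewrite lee_fin.
by rewrite mulrCA ger_pMr// ler_pdivrMr// mul1r lerDl.
Qed.

(** The threshold [M1] depends on [e] only and can be raised, which allows a common
    bound [M] for several conditions. *)
Lemma near_good_moment (e : R) : 0 < e ->
  bigO_P P (fun n w => (n%:R^-1 * \sum_(i < n) enorm (W i w) ^+ 4)%:E) ->
  bigO_P P (fun n w => (n%:R^-1 * \sum_(i < n)
       resid (W ^~ w) (y ^~ w) (full_estimator Sigma n (W ^~ w) (y ^~ w)) i
         ^+ 4)%:E) ->
  exists M1 : R, forall M, M1 <= M -> \forall n \near \oo,
    (P [set w | ~ good_moment Sigma n M (W ^~ w) (y ^~ w)] <= e%:E)%E.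
Proof.
move=> e0 O1 O2; have e2 : 0 < e / 2 by rewrite divr_gt0.
have [A hA] := O1 _ e2; have [B hB] := O2 _ e2.
exists (1 + A + B) => M MAB.
near=> n; have n0 : (0 < n)%N by near: n; exact: nbhs_infty_gt.
have mf := mmx_full_estimator Sigma_sym mW my n.
have -> : e = e / 2 + e / 2 by field.
have m1 : measurable [set w |
    (A%:E < `|(n%:R^-1 * \sum_(i < n) enorm (W i w) ^+ 4)%:E|)%E].
  apply: measurable_lt_set; first exact: measurable_cst.
  apply: measurable_normr; apply: measurable_funM; first exact: measurable_cst.
  by apply: measurable_sum => i; apply: measurable_funX; exact: measurable_enorm.
have m2 : measurable [set w | (B%:E < `|(n%:R^-1 * \sum_(i < n)
       resid (W ^~ w) (y ^~ w) (full_estimator Sigma n (W ^~ w) (y ^~ w)) i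
         ^+ 4)%:E|)%E].
  apply: measurable_lt_set; first exact: measurable_cst.
  apply: measurable_normr; apply: measurable_funM; first exact: measurable_cst.
  by apply: measurable_sum => i; apply: measurable_funX; exact: measurable_resid.
apply: (le_measure_subset _ (measurableU _ _ m1 m2) _ (le_measureU m1 m2 _ _)).
- by apply: measurableC; exact: measurable_good_moment.
- move=> w /= /negP; rewrite -ltNge !lte_fin => h.
  have n1 : n%:R != 0 :> R by rewrite pnatr_eq0 -lt0n.
  move: h; rewrite /moment4 !big_split/= sumr_const card_ord !mulrDr.
  rewrite -[1 *+ n]/(n%:R : R) mulVf// => h.
  set u := n%:R^-1 * _ in h *; set v := _ + n%:R^-1 * _ in h *.
  apply/orP; rewrite -[X in X || _]negbK -[X in _ || X]negbK -negb_and -!leNgt.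
  apply/negP => /andP[h1 h2].
  have := ler_norm u; have := le_trans (ler_norm _) h2; rewrite /v in h *.
  lra.
- by near: n.
- by near: n.
Unshelve. all: by end_near. Qed.

(** As the inverse of 0 is [+oo], a finite bound on the maximum forces all the
    probabilities to be positive. *)
Lemma near_good_prob (r0 : nat -> nat) (I : nat -> T -> nat -> nat) (e : R) : 0 < e ->
  (forall n k, measurable_fun setT ((I n) ^~ k)) ->
  bigO_P P (fun n w =>
    \big[maxe/-oo%E]_(i < n)
      ((n%:R * pilot_subprob Sigma c n (r0 n) (W ^~ w) (y ^~ w) (I n w) i)%:E)^-1%E) ->
  exists M1 : R, forall M, M1 <= M -> \forall n \near \oo,
    (P [set w | ~ good_prob Sigma c n (r0 n) M (W ^~ w) (y ^~ w) (I n w)] <= e%:E)%E.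
Proof.
move=> e0 mI O1; have [A hA] := O1 _ e0; exists A => M AM.
near=> n; have n0 : (0 < n)%N by near: n; exact: nbhs_infty_gt.
have n1 : (0 : R) < n%:R by rewrite ltr0n.
apply: (@le_measure_subset _ _ _ _ _
    [set w | ~ good_prob Sigma c n (r0 n) A (W ^~ w) (y ^~ w) (I n w)]).
- by apply: measurableC; exact: measurable_good_prob.
- by apply: measurableC; exact: measurable_good_prob.
- move=> w /= h g; apply: h => i; have [g1 g2] := g i.
  by split => //; exact: le_trans AM.
- suff -> : [set w | ~ good_prob Sigma c n (r0 n) A (W ^~ w) (y ^~ w) (I n w)] =
    [set w | (A%:E < `|\big[maxe/-oo%E]_(i < n) ((n%:R * pilot_subprob Sigma c n
       (r0 n) (W ^~ w) (y ^~ w) (I n w) i)%:E)^-1|)%E].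
    by near: n.
  apply/seteqP; split => w /=; pose x (i : 'I_n) := n%:R * pilot_subprob Sigma c n
       (r0 n) (W ^~ w) (y ^~ w) (I n w) i.
    apply: contra_notT; rewrite -leNgt => h i.
    have xA : ((x i)%:E^-1 <= A%:E)%E.
      apply: (le_trans _ (le_trans (lee_abs _) h)).
      exact: (le_bigmax -oo%E (fun i => (x i)%:E^-1)%E).
    have p0 := pilot_subprob_ge0 Sigma c n (r0 n) (W ^~ w) (y ^~ w) (I n w) i.
    move: xA; rewrite inver /x; case: eqP => [//|/eqP x0].
    rewrite lee_fin => xA; split => //.
    by rewrite lt_neqAle p0 andbT; apply: contraNneq x0 => <-; rewrite mulr0.
  apply: contraPnot => g; apply/negP; rewrite -leNgt.
  have xE i : ((x i)%:E^-1 = (x i)^-1%:E)%E.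
    have [g1 _] := g i; rewrite inver ifF//; apply/negbTE.
    by rewrite mulf_neq0 ?gt_eqF.
  rewrite gee0_abs; last first.
    apply: le_trans (le_bigmax -oo%E (fun i => (x i)%:E^-1)%E (Ordinal n0)).
    rewrite xE lee_fin invr_ge0 mulr_ge0// ?(ltW n1)//.
    exact: pilot_subprob_ge0.
  apply: bigmax_le; first exact: leNye.
  by move=> i _; rewrite xE lee_fin; have [_] := g i.
Unshelve. all: by end_near. Qed.

Lemma near_good_tail (dl e : R) : 0 < e ->
  bigO_P P (fun n w => (n%:R^-1 * \sum_(i < n)
    `|resid (W ^~ w) (y ^~ w) (full_estimator Sigma n (W ^~ w) (y ^~ w)) i|
       `^ (2 + dl) * enorm (W i w) `^ (2 + dl))%:E) ->
  exists M1 : R, forall M, M1 <= M -> \forall n \near \oo,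
    (P [set w | ~ good_tail Sigma n dl M (W ^~ w) (y ^~ w)] <= e%:E)%E.
Proof.
move=> e0 O1; have [A hA] := O1 _ e0; exists A => M AM.
apply: filterS hA => n hA.
pose f w i := `|resid (W ^~ w) (y ^~ w) (full_estimator Sigma n (W ^~ w) (y ^~ w)) i|.
have fE w : \sum_(i < n) f w i `^ (2 + dl) * enorm (W i w) `^ (2 + dl) =
    \sum_(i < n) (f w i * enorm (W i w)) `^ (2 + dl).
  by apply: eq_bigr => i _; rewrite powRM ?enorm_ge0// normr_ge0.
have sub B : A <= B -> [set w | ~ good_tail Sigma n dl B (W ^~ w) (y ^~ w)] `<=`
  [set w | (A%:E < `|(n%:R^-1 * \sum_(i < n)
    `|resid (W ^~ w) (y ^~ w) (full_estimator Sigma n (W ^~ w) (y ^~ w)) i|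
       `^ (2 + dl) * enorm (W i w) `^ (2 + dl))%:E|)%E].
  move=> AB w /= /negP; rewrite -ltNge lte_fin fE => h.
  exact: (lt_le_trans (le_lt_trans AB h) (ler_norm _)).
apply: (le_measure_subset _ _ (sub M AM) hA).
  by apply: measurableC; exact: measurable_good_tail.
have -> : [set w | (A%:E < `|(n%:R^-1 * \sum_(i < n)
    `|resid (W ^~ w) (y ^~ w) (full_estimator Sigma n (W ^~ w) (y ^~ w)) i|
       `^ (2 + dl) * enorm (W i w) `^ (2 + dl))%:E|)%E] =
   ~` [set w | good_tail Sigma n dl A (W ^~ w) (y ^~ w)].
  apply/seteqP; split => w /=; last exact: (sub A (lexx A)).
  rewrite lte_fin fE ger0_norm => [h /le_lt_trans /(_ h)|]; first by rewrite ltxx.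
  by rewrite mulr_ge0// sumr_ge0// => i _; exact: powR_ge0.
by apply: measurableC; exact: measurable_good_tail.
Qed.

End conditions_in_probability.

Section bad_event.
Context {d : measure_display} {T : measurableType d} {R : realType} {p : nat}.
Variable P : probability T R.
Variables (Sigma H : 'M[R]_p) (W : nat -> T -> 'cV[R]_p) (y : nat -> T -> R).
Variables (c : criterion) (n r0 r : nat) (I J : T -> nat -> nat).
Hypothesis Sigma_sym : Sigma^T = Sigma.
Hypothesis mW : forall i, mmx (W i).
Hypothesis my : forall i, measurable_fun setT (y i).
Hypothesis sampling : two_step_sampling P Sigma W y c n r0 r I J.
Hypotheses (n_gt0 : (0 < n)%N) (r_gt0 : (0 < r)%N).
Variables (cV dl M et : R).

Let good := good_event Sigma W y c n r0 r I H cV dl M et.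

Lemma measurable_good_event : measurable good.
Proof.
have mI := measurable_I sampling.
apply: measurableI; first exact: (measurable_in_range sampling).
exact: measurable_good_data.
Qed.

(** Union bound over the conditions. The first step is only required to be good
    when the moments are, as its bound rests on them. *)
Lemma bad_event_prob (e : R) : 0 < et -> 0 <= M ->
  (P [set w | ~ good_HW Sigma H n et (W ^~ w)] <= e%:E)%E ->
  (P [set w | ~ good_moment Sigma n M (W ^~ w) (y ^~ w)] <= e%:E)%E ->
  (P [set w | ~ good_prob Sigma c n r0 M (W ^~ w) (y ^~ w) (I w)] <= e%:E)%E ->
  (P [set w | ~ good_tail Sigma n dl M (W ^~ w) (y ^~ w)] <= e%:E)%E ->
  (P [set w | ~ good_cov Sigma c n r0 r cV (W ^~ w) (y ^~ w) (I w)] <= e%:E)%E ->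
  r0%:R * M / (et * Num.sqrt r%:R) <= e ->
  (P (~` good) <= (6 * e)%:E)%E.
Proof.
move=> et0 M0 h1 h2 h3 h4 h5 h6.
have mI := measurable_I sampling.
have m0 : measurable (~` in_range n r0 I).
  by apply: measurableC; exact: (measurable_in_range sampling).
have m1 : measurable [set w | ~ good_HW Sigma H n et (W ^~ w)].
  by apply: measurableC; exact: measurable_good_HW.
have m2 : measurable [set w | ~ good_moment Sigma n M (W ^~ w) (y ^~ w)].
  by apply: measurableC; exact: measurable_good_moment.
have m3 : measurable [set w | ~ good_prob Sigma c n r0 M (W ^~ w) (y ^~ w) (I w)].
  by apply: measurableC; exact: measurable_good_prob.
have m4 : measurable [set w | ~ good_tail Sigma n dl M (W ^~ w) (y ^~ w)].
  by apply: measurableC; exact: measurable_good_tail.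
have m5 : measurable
    [set w | ~ good_cov Sigma c n r0 r cV (W ^~ w) (y ^~ w) (I w)].
  by apply: measurableC; exact: measurable_good_cov.
have m6 : measurable ([set w | good_moment Sigma n M (W ^~ w) (y ^~ w)] `&`
     [set w | ~ good_first Sigma n r0 r et (W ^~ w) (y ^~ w) (I w)]).
  apply: measurableI; first exact: measurable_good_moment.
  by apply: measurableC; exact: measurable_good_first.
have h0 : (P (~` in_range n r0 I) <= 0%:E)%E.
  by rewrite (first_step_in_range mW my sampling n_gt0).
have h7 : (P ([set w | good_moment Sigma n M (W ^~ w) (y ^~ w)] `&`
     [set w | ~ good_first Sigma n r0 r et (W ^~ w) (y ^~ w) (I w)]) <= e%:E)%E.
  apply: (le_trans (first_step_good Sigma_sym mW my sampling n_gt0 r_gt0 et0 M0)).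
  by rewrite lee_fin.
have u1 := measurableU _ _ m0 m1; have b1 := le_measureU m0 m1 h0 h1.
have u2 := measurableU _ _ u1 m2; have b2 := le_measureU u1 m2 b1 h2.
have u3 := measurableU _ _ u2 m3; have b3 := le_measureU u2 m3 b2 h3.
have u4 := measurableU _ _ u3 m4; have b4 := le_measureU u3 m4 b3 h4.
have u5 := measurableU _ _ u4 m5; have b5 := le_measureU u4 m5 b4 h5.
have u6 := measurableU _ _ u5 m6; have b6 := le_measureU u5 m6 b5 h7.
have -> : 6 * e = 0 + e + e + e + e + e + e by ring.
apply: le_measure_subset u6 _ b6.
  by apply: measurableC; exact: measurable_good_event.
move=> w; apply: contra_notP => h; split.
  by apply: contrapT => h'; apply: h; do 6 left.
have g2 : good_moment Sigma n M (W ^~ w) (y ^~ w).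
  by apply: contrapT => h'; apply: h; do 4 left; right.
split=> //; last split.
- by apply: contrapT => h'; apply: h; do 5 left; right.
- by apply: contrapT => h'; apply: h; do 3 left; right.
- by apply: contrapT => h'; apply: h; do 2 left; right.
- by apply: contrapT => h'; apply: h; left; right.
- by apply: contrapT => h'; apply: h; right.
Qed.

End bad_event.
(** * Asymptotic normality of the two-step estimator *)

Theorem theorem5 (d : measure_display) (T : measurableType d) (R : realType)
  (P : probability T R) (p : nat)
  (beta : 'cV[R]_p) (sigma : R) (Sigma : 'M[R]_p)
  (X U W : nat -> T -> 'cV[R]_p) (eps y : nat -> T -> R)
  (model : measurement_error_model P beta sigma Sigma X U W eps y)
  (c : criterion) (r0 r : nat -> nat) (I J : nat -> T -> nat -> nat)
  (sampling : forall n, two_step_sampling P Sigma W y c n (r0 n) (r n) (I n) (J n))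
  (A1 : exists2 H : 'M[R]_p, posdefmx H &
    mx_cvg_in_prob P (fun n w => HW Sigma n (W ^~ w)) H)
  (A2W : bigO_P P (fun n w =>
    (n%:R^-1 * \sum_(i < n) enorm (W i w) ^+ 4)%:E))
  (A2e : bigO_P P (fun n w =>
    (n%:R^-1 * \sum_(i < n)
       resid (W ^~ w) (y ^~ w) (full_estimator Sigma n (W ^~ w) (y ^~ w)) i
         ^+ 4)%:E))
  (A3 : bigO_P P (fun n w =>
    \big[maxe/-oo%E]_(i < n)
      ((n%:R * pilot_subprob Sigma c n (r0 n) (W ^~ w) (y ^~ w) (I n w) i)%:E)^-1%E))
  (A4 : exists2 delta : R, 0 < delta &
    bigO_P P (fun n w =>
      (n%:R^-1 * \sum_(i < n)
         `|resid (W ^~ w) (y ^~ w) (full_estimator Sigma n (W ^~ w) (y ^~ w)) i|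
            `^ (2 + delta)
         * enorm (W i w) `^ (2 + delta))%:E))
  (* not spelled out in the source, implicit in the (V^{beta0})^{-1/2} norming *)
  (nondegenerate : nondegenerate_in_prob P (fun n w =>
    (r n)%:R *: Vc_mx Sigma c n (r0 n) (r n) (W ^~ w) (y ^~ w) (I n w)))
  (r_o_n : (r n)%:R / n%:R @[n --> \oo] --> (0 : R))
  (r0_o_sqrt_r : (r0 n)%:R / Num.sqrt (r n)%:R @[n --> \oo] --> (0 : R))
  (r_infty : r n @[n --> \oo] --> \oo) :
  cond_cvg_std_normal P (sigma_data W y) (fun n w =>
    standardized_error Sigma c n (r0 n) (r n) (W ^~ w) (y ^~ w) (I n w) (J n w)).
Proof.
have Ss : Sigma^T = Sigma.
  apply/matrixP => i j; rewrite mxE; apply: EFin_inj.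
  by rewrite -(U_cov model 0%N j i) -(U_cov model 0%N i j) covarianceC.
have mW i : mmx (W i).
  move=> j k; rewrite ord1.
  have -> : (fun w => W i w j 0) = (fun w => X i w j 0 + U i w j 0).
    by apply/funext => w; rewrite (model_W model) mxE.
  by apply: measurable_funD; [exact: (model_X model)|exact: (model_U model)].
have my i : measurable_fun setT (y i).
  have -> : y i = (fun w => dotv (X i w) beta + eps i w).
    by apply/funext => w; exact: (model_y model).
  apply: measurable_funD; last exact: (model_eps model).
  apply: measurable_dotv; last exact: mmx_cst.
  by move=> j k; rewrite ord1; exact: (model_X model).
have mI n k := measurable_I (sampling n) k.
have mJ n k := measurable_J (sampling n) k.
have [H pH cH] := A1; have [dl dl0 O4] := A4.
move=> t g gE; set l := \prod_j std_normal_cdf (t j 0).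
have l01 : 0 <= l <= 1.
  apply/andP; split; first by apply: prodr_ge0 => j _; exact: std_normal_cdf_ge0.
  have -> : (1 : R) = \prod_(j < p) 1 by rewrite big1_eq.
  apply: ler_prod => j _.
  by rewrite std_normal_cdf_ge0 std_normal_cdf_le1.
apply: near_cvg_in_prob => a e a0 e0.
(* [e1] bounds the probability of the bad event and the error of the normal
   approximation; both are doubled by [pr_good_event] and [cond_prob_deviation] *)
pose e1 := a * e / 4; have e10 : 0 < e1 by rewrite divr_gt0// mulr_gt0.
pose e2 := e1 / 6; have e20 : 0 < e2 by rewrite divr_gt0.
have [M1 near_moment] := near_good_moment Ss mW my e20 A2W A2e.
have [M2 near_prob] := near_good_prob Ss mW my e20 mI A3.
have [M3 near_tail] := near_good_tail Ss mW my e20 O4.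
have [cV cV0 near_cov] := nondegenerate e2 e20.
pose M := 1 + `|M1| + `|M2| + `|M3|.
have n1 := normr_ge0 M1; have n2 := normr_ge0 M2; have n3 := normr_ge0 M3.
have MM : [/\ 1 <= M, M1 <= M, M2 <= M & M3 <= M].
  have := ler_norm M1; have := ler_norm M2; have := ler_norm M3.
  by rewrite /M; split; lra.
have [MM0 MM1 MM2 MM3] := MM.
have M0 : 0 <= M by exact: le_trans MM0.
have [et et0 clt] := good_data_clt c t Ss pH cV0 dl0 MM0 e10.
have near_HW := near_good_HW mW et0 e20 cH.
have {}near_moment := near_moment _ MM1.
have {}near_prob := near_prob _ MM2.
have {}near_tail := near_tail _ MM3.
have near_r : \forall n \near \oo, (1 + Num.truncn (et^-1 ^+ 2) <= r n)%N.
  by move/cvgnyPge : r_infty; exact.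
have near_first : \forall n \near \oo, (r0 n)%:R / Num.sqrt (r n)%:R <= e2 / (M / et).
  have Met : 0 < M / et by rewrite divr_gt0// (lt_le_trans ltr01).
  by apply: (cvgr_le _ r0_o_sqrt_r); rewrite divr_gt0.
near=> n.
have n0 : (0 < n)%N by near: n; exact: nbhs_infty_gt.
have rn : (1 + Num.truncn (et^-1 ^+ 2) <= r n)%N by near: n.
have rn0 : (0 < r n)%N by exact: leq_trans rn.
have sr0 : 0 < Num.sqrt ((r n)%:R : R) by rewrite sqrtr_gt0 ltr0n.
have ret : (Num.sqrt (r n)%:R)^-1 <= et.
  rewrite -[et]invrK lef_pV2 ?posrE ?invr_gt0//.
  rewrite -[et^-1]ger0_norm ?invr_ge0 ?(ltW et0)// -sqrtr_sqr ler_sqrt ?ler0n//.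
  apply: ltW; apply: lt_le_trans (truncnS_gt _) _.
  by rewrite ler_nat -add1n.
have first : (r0 n)%:R * M / (et * Num.sqrt (r n)%:R) <= e2.
  have -> : (r0 n)%:R * M / (et * Num.sqrt (r n)%:R) =
    (r0 n)%:R / Num.sqrt (r n)%:R * (M / et).
    by field; rewrite !gt_eqF.
  rewrite -ler_pdivlMr ?divr_gt0// ?(lt_le_trans ltr01)//.
  by near: n.
have bad : (P (~` good_event Sigma W y c n (r0 n) (r n) (I n) H cV dl M et)
    <= e1%:E)%E.
  have -> : e1 = 6 * e2 by rewrite /e2; field.
  apply: (bad_event_prob Ss mW my (sampling n) n0 rn0 et0 M0) => //;
    try by near: n.
  have -> : [set w | ~ good_cov Sigma c n (r0 n) (r n) cV (W ^~ w) (y ^~ w) (I n w)]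
    = [set w | exists v, (quadform ((r n)%:R *:
        Vc_mx Sigma c n (r0 n) (r n) (W ^~ w) (y ^~ w) (I n w)) v
        < cV * enorm v ^+ 2)%R].
    apply/seteqP; split => w /=.
      by move=> /existsNP[v /negP]; rewrite -ltNge => h; exists v.
    by move=> [v h] /(_ v); rewrite leNgt h.
  by near: n.
have mgood : measurable (good_event Sigma W y c n (r0 n) (r n) (I n) H cV dl M et).
  exact: (measurable_good_event _ Ss mW my (sampling n)).
have mE : measurable (error_event Sigma W y c n (r0 n) (r n) (I n) (J n) t).
  exact: measurable_error_event.
have Fsub : sigma_data W y n `<=` measurable by exact: (sigma_data_sub mW my).
have dev A : sigma_data W y n A ->
    `|fine (P (A `&` error_event Sigma W y c n (r0 n) (r n) (I n) (J n) t))
      - l * fine (P A)| <= 2 * e1.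
  move=> FA; have mA : measurable A by exact: Fsub.
  apply: (pr_good_event mA mgood mE l01).
    have mbad := measurableC mgood.
    by rewrite -lee_fin -(prE P mbad).
  apply: (cond_prob_error_event Ss mW my (sampling n) n0 (ltW e10)).
    by move=> w; exact: clt.
  exact: sigma_data_le_pilot.
apply: (le_trans (cond_prob_deviation Fsub mE (gE n) a0 dev)).
by rewrite lee_fin /e1 le_eqVlt; apply/orP; left; apply/eqP; field; rewrite gt_eqF.
Unshelve. all: by end_near. Qed.
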